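(* Let $b\in(0,3)$ and let $u\in C([0,\infty);H^2(\mathbb{R}))$ be a global solution of the $b$-family equation $$\partial_t u+\partial_x\left(\tfrac12 u^2+G\left(\tfrac b2u^2+\tfrac{3-b}{2}(\partial_xu)^2\right)\right)=0 .$$ Put $m=u-\partial_x^2u$ and $m_0(x)=m(0,x)$, and suppose $m_0\ge 0$ and $m_0\in L^1(\mathbb{R})$. Then there is some $L\in\mathbb{R}$ such that $$\lim_{t\to\infty}\|m(t)\|_{L^1(\Lambda_{1/2}(t))}=\lim_{t\to\infty}\|u(t)\|_{L^1(\Lambda_{1/2}(t))}=L .$$
   Context: $G=(1-\partial_x^2)^{-1}$, i.e. $Gf=\frac12 e^{-|x|}*f$ on $\mathbb{R}$. The equation is posed for $x\in\mathbb{R}$, $t\ge 0$; in terms of $m=u-\partial_x^2u$ it reads $\partial_t m+u\,\partial_xm+b\,m\,\partial_xu=0$. For $t>1$, $$\Lambda_{1/2}(t)=\left(-\frac{t^{1/2}}{\log t},\ \frac{t^{1/2}}{\log t}\right).$$ *)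

(* Defs.v *)
From HB Require Import structures.
From mathcomp Require Import all_boot all_order all_algebra.
From mathcomp Require Import all_classical all_reals all_analysis.
Set Implicit Arguments.
Unset Strict Implicit.
Unset Printing Implicit Defensive.
Import Order.TTheory GRing.Theory Num.Theory.
Import numFieldNormedType.Exports.
Local Open Scope classical_set_scope.
Local Open Scope ring_scope.

(* Elements of L^2, H^2, ... are represented by Borel functions R -> R; all
   notions below depend only on their almost-everywhere classes. *)
Section Defs.
Variable R : realType.
Local Notation mu := (@lebesgue_measure R).
Implicit Types (f g phi : R -> R) (u : R -> R -> R).

Definition test_function phi :=
  (forall n x, derivable (phi^`(n))%classic x 1) /\
  compact (closure [set x | phi x != 0]).

Definition is_weak_derivative f g :=
  [/\ locally_integrable setT f, locally_integrable setT g &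
      forall phi, test_function phi ->
        \int[mu]_x (f x * (phi^`())%classic x) = - \int[mu]_x (g x * phi x)].

(* Unique up to a.e. equality when it exists, and 0 by convention otherwise;
   hence [sobolev] asserts existence separately. *)
Definition wderiv f : R -> R := xget (cst 0) (is_weak_derivative f).

Fixpoint sobolev (k : nat) : set (R -> R) :=
  if k is k'.+1 then
    [set f | f \in Lfun mu 2%:E /\
             exists2 g, is_weak_derivative f g & sobolev k' g]
  else [set f | f \in Lfun mu 2%:E].

Definition sobolev_norm (k : nat) f : \bar R :=
  ((\sum_(j < k.+1) 'N[mu]_2%:E[EFin \o iter j wderiv f] `^ 2) `^ 2^-1)%E.

(* u \in C([0, +oo[; H^k(R)), where u t is the function x |-> u(t, x) *)
Definition continuous_sobolev (k : nat) u :=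
  forall t, 0 <= t ->
    sobolev k (u t) /\
    sobolev_norm k (u s \- u t) @[s --> within `[0, +oo[ (nbhs t)] --> 0%E.

Definition momentum f : R -> R := fun x => f x - wderiv (wderiv f) x.

(* G = (1 - d^2/dx^2)^-1, i.e. convolution with exp(-|x|) / 2 *)
Definition G f : R -> R :=
  fun x => 2^-1 * \int[mu]_y (expR (- `|x - y|) * f y).

Definition bflux (b : R) f : R -> R := fun x =>
  2^-1 * f x ^+ 2 +
  G (fun y => b / 2 * f y ^+ 2 + (3 - b) / 2 * wderiv f y ^+ 2) x.

(* d_t u + d_x (bflux b u) = 0 at every time t > 0, in the sense of
   distributions on the line *)
Definition solves_bfamily (b : R) u :=
  forall phi, test_function phi -> forall t : R, 0 < t ->
    is_derive t 1 (fun s : R => \int[mu]_x (u s x * phi x))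
                  (\int[mu]_x (bflux b (u t) x * (phi^`())%classic x)).

Definition global_solution (b : R) u :=
  continuous_sobolev 2 u /\ solves_bfamily b u.

Definition Lambda_half (t : R) : set R :=
  `](- (t `^ 2^-1 / ln t)), (t `^ 2^-1 / ln t)[.

Definition L1norm_on (A : set R) f : \bar R := (\int[mu]_(x in A) `|f x|%:E)%E.

End Defs.

(* Main.v *)
(* The limit is L = 0.

   A momentum m = u - u_xx that starts nonnegative stays nonnegative: with an
   e-mollifier k, a cutoff chi and a C^1 convex substitute beta for the negative
   part, the functional \int chi beta(k * m) satisfies a Gronwall inequality up
   to a DiPerna-Lions commutator that vanishes with e. Hence u >= 0, and since
   the flux u^2 / 2 + G(...) is at least u^2 / 2 >= 0, mass only moves to the
   right: the mass to the left of a fixed point is nonincreasing in time.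

   Suppose that at time T the window [-r, r] carries mass a, and let d be the
   initial mass to the left of -r. At every time t <= T the window [-2r, 2r]
   carries at least a - d, so by Cauchy-Schwarz \int u^2 over it is at least
   (a - d)^2 / (4r), and testing against a cutoff of length 4r shows that mass
   crosses the origin region at a rate at least c (a - d)^2 / r^2. The total
   mass being finite, T (a - d)^2 <= C r^2. For r of order T^(1/2) / log T this
   gives a <= d + C / log T, which tends to 0. Finally the integral of m over a
   window is at most \int u (theta - theta'') for a cutoff theta, which is
   bounded by the integral of u over a window three times as long. *)
Require Import Defs.
From HB Require Import structures.
From mathcomp Require Import all_boot all_order all_algebra.
From mathcomp Require Import all_classical all_reals all_analysis.
From mathcomp Require Import measurable_realfun ring lra.
Import Order.TTheory GRing.Theory Num.Theory.
Import numFieldNormedType.Exports.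
Local Open Scope classical_set_scope.
Local Open Scope ring_scope.

Set Implicit Arguments.
Unset Strict Implicit.
Unset Printing Implicit Defensive.

(** At positive times m(t) is known only to lie in L^2 and to solve its equation weakly, which
    shapes the positivity proof. A cutoff of length l costs O(1/l) times the local L^1 norm of m,
    and L^2 control must make this small: by |m| <= z + m^2 / (4 z) that norm is O(z l) + O(1/z), so
    z is fixed before l. The functional is nonlinear in m, whereas the equation holds against fixed
    test functions; convexity of beta bounds its increment by that of a linear functional frozen at
    the later time, and a one-sided Gronwall lemma suffices. The commutator uses the 1/2-Hoelder
    continuity of u_x, which comes from u_xx in L^2.

    The flux through that edge is at most C / L with C depending on T, and L is sent to infinity at
    fixed T. The range 0 < b < 3 makes the source of G nonnegative. At time 0, integrability of u
    follows from that of m by testing m with a wide cutoff. *)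

Section elementary.
Variable R : realFieldType.
Implicit Types (x y z p q r e d t s l : R).

Lemma step_back (d1 d2 : R) d t : 0 < d -> d <= d1 -> d <= d2 -> d <= t ->
  [/\ 0 <= t - d / 2, t - d / 2 < t, `|t - d / 2 - t| = d / 2, d / 2 < d1 & d / 2 < d2].
Proof.
move=> d0 h1 h2 h3; split; try lra.
by rewrite addrAC subrr add0r normrN gtr0_norm// divr_gt0.
Qed.

Lemma close_le (x1 x2 y1 y2 : R) e : `|x1 - x2| <= e / 2 -> `|y1 - y2| <= e / 2 -> y1 <= x1 ->
  y2 <= x2 + e.
Proof. by rewrite !ler_norml => /andP[? ?] /andP[? ?] ?; lra. Qed.

Lemma far_le (x y p : R) r e : r = e + e -> r < `|x - p| -> `|y - p| = e -> e < `|x - y|.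
Proof. by move=> h1 h2 h3; have := ler_distD y x p; lra. Qed.

Lemma enlarge_itv x y r e : - r <= x -> x <= r -> e < 1 -> `|x - y| <= e -> - (r + 1) <= y <= r + 1.
Proof. by move=> ? ? ?; rewrite ler_norml => /andP[? ?]; apply/andP; split; lra. Qed.

Lemma far_norm x y r e : r + 1 < `|x| -> e < 1 -> `|x - y| <= e -> r < `|y|.
Proof. by move=> h1 h2 h3; have := lerB_dist x y; lra. Qed.

Lemma below3 (e1 e2 e3 : R) : 0 < e1 -> 0 < e2 -> 0 < e3 ->
  exists e, [/\ 0 < e, e < e1, e < e2, e <= e3 & e <= 1].
Proof.
move=> e10 e20 e30; pose m := Num.min (Num.min e1 e2) (Num.min e3 1).
have [m0 m1 m2 m3 m4] : [/\ 0 < m, m <= e1, m <= e2, m <= e3 & m <= 1].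
  by rewrite /m; split; rewrite ?lt_min ?ge_min ?lexx ?e10 ?e20 ?e30 ?ltr01 ?orbT.
by exists (m / 2); clearbody m; split; lra.
Qed.

Lemma sum3_le x y z : 0 <= x -> 0 <= y -> 0 <= z ->
  [/\ x <= x + y + z, y <= x + y + z & z <= x + y + z].
Proof. by move=> *; split; lra. Qed.

Lemma near_bound x y z s : x <= 2 * z + 2 * y -> z <= 1 -> y <= s -> x <= 2 + 2 * s.
Proof. by move=> *; lra. Qed.

Lemma quarters x y z e : 0 < e -> x <= e / 4 -> y <= e / 4 -> - (e / 4) - x - y <= z -> 0 <= z + e.
Proof. by move=> *; lra. Qed.

Lemma four_parts x e : x <= e -> x + e + e + e <= 4 * e.
Proof. by move=> *; lra. Qed.

Lemma two_halves x e : x <= e / 2 -> e / 2 + x <= e.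
Proof. by move=> *; lra. Qed.

Lemma triple_ge r l : 0 < r -> r <= l -> r <= 3 * l + 1.
Proof. by move=> *; lra. Qed.

Lemma triangle4 (A B p q I : R) e : `|A - p| <= e / 4 -> `|B - q| <= e / 4 ->
  `|A - B + I| <= e / 4 + e / 4 -> `|q - p - I| <= e.
Proof. by rewrite !ler_norml => /andP[? ?] /andP[? ?] /andP[? ?]; apply/andP; split; lra. Qed.

End elementary.

(** * Integrals of real functions *)

Section toolkit.
Variable R : realType.
Local Notation mu := (@lebesgue_measure R).
Implicit Types (f g h : R -> R) (A B : set R) (a b c r x y : R).

Lemma ae_impl (P Q : R -> Prop) : (forall x, P x -> Q x) ->
  {ae mu, forall x, P x} -> {ae mu, forall x, Q x}.
Proof.
by move=> PQ; apply: filterS => //; exact: (ae_filter_ringOfSetsType mu).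
Qed.

Lemma ae_and (P Q : R -> Prop) : {ae mu, forall x, P x} ->
  {ae mu, forall x, Q x} -> {ae mu, forall x, P x /\ Q x}.
Proof.
by move=> aP aQ; apply: filterI => //; exact: (ae_filter_ringOfSetsType mu).
Qed.

Definition integ (A : set R) (f : R -> R) := mu.-integrable A (EFin \o f).

Lemma integ_meas A f : integ A f -> measurable_fun A f.
Proof. by move=> /measurable_int /measurable_EFinP. Qed.

Lemma integ_le A f g : measurable A -> measurable_fun A f ->
  (forall x, A x -> `|f x| <= g x) -> integ A g -> integ A f.
Proof.
move=> mA mf fg; apply: le_integrable => //; first exact/measurable_EFinP.
move=> x Ax /=; rewrite lee_fin (le_trans (fg _ Ax))// ler_norm//.
Qed.

Lemma integD A f g : measurable A -> integ A f -> integ A g ->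
  integ A (fun x => f x + g x).
Proof. by move=> mA If Ig; exact: (@integrableD _ _ _ mu A mA _ _ If Ig). Qed.

Lemma integB A f g : measurable A -> integ A f -> integ A g ->
  integ A (fun x => f x - g x).
Proof. by move=> mA If Ig; exact: (@integrableB _ _ _ mu A mA _ _ If Ig). Qed.

Lemma integN A f : integ A f -> integ A (fun x => - f x).
Proof. by move=> If; exact: (@integrableN _ _ _ mu A _ If). Qed.

Lemma integZ A f c : measurable A -> integ A f -> integ A (fun x => c * f x).
Proof. by move=> mA If; exact: (@integrableZl _ _ _ mu A mA c _ If). Qed.

Lemma integS A B f : measurable A -> measurable B -> B `<=` A -> integ A f -> integ B f.
Proof. by move=> mA mB BA; apply: integrableS. Qed.

Lemma integ_abs A f : integ A f -> integ A (fun x => `|f x|).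
Proof. by move=> /integrable_abse. Qed.

Lemma integM A f g c : measurable A -> integ A f -> measurable_fun A g ->
  (forall x, A x -> `|g x| <= c) -> integ A (fun x => f x * g x).
Proof.
move=> mA If mg gc; apply: (@integ_le _ _ (fun x => c * `|f x|)) => //.
- by apply: measurable_funM => //; exact: integ_meas.
- by move=> x Ax; rewrite normrM mulrC ler_wpM2r// gc.
- by apply: integZ => //; exact: integ_abs.
Qed.

Lemma integMl A f g c : measurable A -> integ A f -> measurable_fun A g ->
  (forall x, A x -> `|g x| <= c) -> integ A (fun x => g x * f x).
Proof.
move=> mA If mg gc; have := integM mA If mg gc.
by under eq_fun do rewrite mulrC.
Qed.

Lemma eq_integ A f g : measurable A -> (forall x, A x -> f x = g x) ->
  integ A f -> integ A g.
Proof.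
move=> mA fg; apply: eq_integrable => // x /set_mem Ax /=.
by rewrite fg.
Qed.

Lemma meas_cont f : continuous f -> measurable_fun setT f.
Proof. exact: continuous_measurable_fun. Qed.

Lemma integ_itv_cont f a b : continuous f -> integ `[a, b] f.
Proof.
move=> cf; apply: continuous_compact_integrable; first exact: segment_compact.
exact: continuous_subspaceT.
Qed.

Lemma integ_mk A f : measurable A -> integ A f <-> integ setT (f \_ A).
Proof. by move=> mA; rewrite /integ integrable_mkcond// restrict_EFin. Qed.

Lemma Int_add A f g : measurable A -> integ A f -> integ A g ->
  \int[mu]_(x in A) (f x + g x) = \int[mu]_(x in A) f x + \int[mu]_(x in A) g x.
Proof. by move=> mA If Ig; exact: RintegralD. Qed.

Lemma Int_sub A f g : measurable A -> integ A f -> integ A g ->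
  \int[mu]_(x in A) (f x - g x) = \int[mu]_(x in A) f x - \int[mu]_(x in A) g x.
Proof. by move=> mA If Ig; exact: RintegralB. Qed.

Lemma Int_scale A f c : measurable A -> integ A f ->
  \int[mu]_(x in A) (c * f x) = c * \int[mu]_(x in A) f x.
Proof. by move=> mA If; exact: RintegralZl. Qed.

Lemma Int_opp A f : measurable A -> integ A f ->
  \int[mu]_(x in A) (- f x) = - \int[mu]_(x in A) f x.
Proof.
move=> mA If; rewrite -mulN1r -Int_scale//.
by apply: eq_Rintegral => x _; rewrite mulN1r.
Qed.

Lemma Int_supp A f : (forall x, ~ A x -> f x = 0) ->
  \int[mu]_x f x = \int[mu]_(x in A) f x.
Proof.
move=> fA; rewrite [RHS]Rintegral_mkcond; apply: eq_Rintegral => x _.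
rewrite patchE; case: ifPn => // /negP xA; apply: fA => Ax.
by apply: xA; rewrite inE.
Qed.

Lemma integ_supp A f : measurable A -> (forall x, ~ A x -> f x = 0) ->
  integ A f -> integ setT f.
Proof.
move=> mA fA /(integ_mk _ mA); apply: eq_integ => // x _.
rewrite patchE; case: ifPn => // /negP xA; apply/esym/fA => Ax.
by apply: xA; rewrite inE.
Qed.

Lemma Int_le A f g : measurable A -> integ A f -> integ A g ->
  (forall x, A x -> f x <= g x) ->
  \int[mu]_(x in A) f x <= \int[mu]_(x in A) g x.
Proof. by move=> mA If Ig fg; apply: le_Rintegral. Qed.

Lemma Int_abs A f : measurable A -> integ A f ->
  `|\int[mu]_(x in A) f x| <= \int[mu]_(x in A) `|f x|.
Proof. by move=> mA If; apply: le_normr_Rintegral. Qed.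

Lemma Int_abs_le A f g : measurable A -> measurable_fun A f -> integ A g ->
  (forall x, A x -> `|f x| <= g x) ->
  `|\int[mu]_(x in A) f x| <= \int[mu]_(x in A) g x.
Proof.
move=> mA mf Ig fg; have If : integ A f by apply: integ_le Ig.
by apply: (le_trans (Int_abs mA If)); apply: Int_le => //; exact: integ_abs.
Qed.

Lemma Int_subset A B f : measurable A -> measurable B -> A `<=` B ->
  integ B f -> (forall x, B x -> 0 <= f x) ->
  \int[mu]_(x in A) f x <= \int[mu]_(x in B) f x.
Proof.
move=> mA mB AB Int_sub f0; rewrite [leLHS]Rintegral_mkcond [leRHS]Rintegral_mkcond.
apply: Int_le => //; [by apply/(integ_mk _ mA); exact: (integS mB mA AB Int_sub)|by apply/(integ_mk _ mB)|].
move=> x _; rewrite !patchE; case: ifPn => [/set_mem/AB xB|_].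
  by rewrite mem_set.
by case: ifPn => // /set_mem /f0.
Qed.

Lemma integ_ae A f g : measurable A -> measurable_fun A g ->
  {ae mu, forall x, A x -> f x = g x} -> integ A f -> integ A g.
Proof.
move=> mA mg fg If; apply/integrableP; split; first exact/measurable_EFinP.
have /integrableP[mf] := If; apply: le_lt_trans.
rewrite (@ae_eq_integral _ _ _ mu A (abse \o (EFin \o f)))//.
- by apply: measurableT_comp => //; exact/measurable_EFinP.
- exact: measurableT_comp.
- by move: fg; apply: ae_impl => x /= /[apply] ->.
Qed.

Lemma Int_ae A f g : measurable A -> measurable_fun A f -> measurable_fun A g ->
  {ae mu, forall x, A x -> f x = g x} ->
  \int[mu]_(x in A) f x = \int[mu]_(x in A) g x.
Proof.
move=> mA mf mg fg; congr fine; apply: ae_eq_integral => //; [exact/measurable_EFinP..|].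
by move: fg; apply: ae_impl => x /= /[apply] ->.
Qed.

Lemma Int_ge0_ae A f : measurable A -> measurable_fun A f ->
  {ae mu, forall x, A x -> 0 <= f x} -> 0 <= \int[mu]_(x in A) f x.
Proof.
move=> mA mf f0; rewrite (@Int_ae _ _ (fun x => `|f x|))//.
- by apply: Rintegral_ge0.
- exact: measurableT_comp.
- by move: f0; apply: ae_impl => x /= /[apply] /ger0_norm ->.
Qed.

Lemma Int_le_ae A f g : measurable A -> integ A f -> integ A g ->
  {ae mu, forall x, A x -> f x <= g x} ->
  \int[mu]_(x in A) f x <= \int[mu]_(x in A) g x.
Proof.
move=> mA If Ig fg; rewrite -subr_ge0 -RintegralB//; apply: Int_ge0_ae => //.
  by apply: measurable_funB; exact: integ_meas.
by move: fg; apply: ae_impl => x /= /[apply]; rewrite subr_ge0.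
Qed.

Lemma Int_cst_itv a b c : a <= b -> \int[mu]_(x in `[a, b]) c = c * (b - a).
Proof.
move=> ab; rewrite Rintegral_cst//; congr (_ * _).
transitivity (fine (lebesgue_measure (`[a, b]%classic : set R))) => //.
rewrite lebesgue_measure_itv/= lte_fin.
by move: ab; rewrite le_eqVlt => /predU1P[->|->]//=; rewrite ltxx subrr.
Qed.

Lemma integ_cst a b c : integ `[a, b] (fun _ => c).
Proof. by apply: integ_itv_cont => x; exact: cvg_cst. Qed.

Lemma Int_itv_bound a b c f : a <= b -> measurable_fun `[a, b] f ->
  (forall x, `[a, b]%classic x -> `|f x| <= c) ->
  `|\int[mu]_(x in `[a, b]) f x| <= c * (b - a).
Proof.
move=> ab mf fc; rewrite -Int_cst_itv//.
by apply: Int_abs_le => //; exact: integ_cst.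
Qed.

Lemma integ_mul2 A f g : measurable A -> measurable_fun A f -> measurable_fun A g ->
  integ A (fun x => f x ^+ 2) -> integ A (fun x => g x ^+ 2) ->
  integ A (fun x => f x * g x).
Proof.
move=> mA mf mg If Ig; apply: (@integ_le _ _ (fun x => f x ^+ 2 + g x ^+ 2)) => //.
- exact: measurable_funM.
- move=> x _; rewrite normrM -(real_normK (num_real (f x))) -(real_normK (num_real (g x))).
  by have := normr_ge0 (f x); have := normr_ge0 (g x); nra.
- exact: integD.
Qed.

(** Nonnegativity of the quadratic polynomial s |-> \int (f + s g)^2, taken at its minimum; when G =
    0 it is affine in s and its slope must vanish. *)
Lemma CauchySchwarz A f g : measurable A -> measurable_fun A f -> measurable_fun A g ->
  integ A (fun x => f x ^+ 2) -> integ A (fun x => g x ^+ 2) ->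
  (\int[mu]_(x in A) (f x * g x)) ^+ 2 <=
  (\int[mu]_(x in A) f x ^+ 2) * (\int[mu]_(x in A) g x ^+ 2).
Proof.
move=> mA mf mg If Ig; have Ifg := integ_mul2 mA mf mg If Ig.
set F := \int[mu]_(x in A) f x ^+ 2; set G := \int[mu]_(x in A) g x ^+ 2.
set H := \int[mu]_(x in A) (f x * g x).
have F0 : 0 <= F by apply: Rintegral_ge0 => x _; exact: sqr_ge0.
have G0 : 0 <= G by apply: Rintegral_ge0 => x _; exact: sqr_ge0.
have Q s : 0 <= F + 2 * s * H + s ^+ 2 * G.
  rewrite -RintegralZl// -RintegralZl//.
  rewrite -RintegralD//; [|exact: integZ].
  rewrite -RintegralD//; [|by apply: integD => //; exact: integZ|exact: integZ].
  apply: Rintegral_ge0 => x _.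
  by rewrite (_ : _ + _ = (f x + s * g x) ^+ 2) ?sqr_ge0//; ring.
have [G1|G1] := eqVneq G 0.
  suff -> : H = 0 by rewrite expr0n mulr_ge0.
  apply/eqP/negPn/negP => H0.
  (* At this s the affine polynomial takes the value -1. *)
  have := Q (- (F + 1) / (2 * H)); rewrite G1 mulr0 addr0.
  rewrite (_ : F + _ = -1); first by lra.
  by field.
have Gp : 0 < G by rewrite lt_neqAle eq_sym G1.
have := Q (- H / G).
rewrite (_ : F + _ + _ = (F * G - H ^+ 2) / G); last by field.
by rewrite pmulr_lge0 ?invr_gt0// subr_ge0.
Qed.

Lemma CauchySchwarz1 A f r : measurable A -> integ A (fun _ => 1) ->
  measurable_fun A f -> integ A (fun x => f x ^+ 2) ->
  \int[mu]_(x in A) 1 <= r ->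
  (\int[mu]_(x in A) f x) ^+ 2 <= r * \int[mu]_(x in A) f x ^+ 2.
Proof.
move=> mA I1 mf If Ar.
have I1' : integ A (fun=> 1 ^+ 2) by apply: eq_integ I1 => // x _; rewrite expr1n.
have := @CauchySchwarz A (fun=> 1) f mA (measurable_cst _) mf I1' If.
under eq_Rintegral do rewrite mul1r.
under [X in _ <= X * _ -> _]eq_Rintegral do rewrite expr1n.
move=> /le_trans; apply; apply: ler_wpM2r => //.
by apply: Rintegral_ge0 => x _; exact: sqr_ge0.
Qed.

End toolkit.

(** * Convolution integrals and Fubini *)

Section fubini.
Variable R : realType.
Local Notation mu := (@lebesgue_measure R).
Implicit Types (f g k : R -> R) (c : R).

Lemma EFin_Int (A : set R) f : measurable A -> integ A f ->
  (\int[mu]_(x in A) (f x)%:E)%E = (\int[mu]_(x in A) f x)%:E.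
Proof. by move=> mA If; rewrite /Rintegral fineK//; exact: integrable_fin_num. Qed.

Lemma integ_conv k c g x : measurable_fun setT k -> (forall z, `|k z| <= c) ->
  integ setT g -> integ setT (fun y => k (x - y) * g y).
Proof.
move=> mk kc Ig; apply: (@integMl _ _ _ _ c) => //.
apply: measurableT_comp => //; apply: measurable_funB => //.
Qed.

Lemma integ_convr k c g x : measurable_fun setT k -> (forall z, `|k z| <= c) ->
  integ setT g -> integ setT (fun y => k (y - x) * g y).
Proof.
move=> mk kc Ig; apply: (@integMl _ _ _ _ c) => //.
apply: measurableT_comp => //; apply: measurable_funB => //.
Qed.

(** Tonelli with the majorant c |f(x)| |g(y)|. Boundedness is all that is asked of the kernel, so
    one lemma serves exp(-|x|), mollifiers and indicators. *)
Lemma conv_swap_integ k c f g : measurable_fun setT k -> (forall z, `|k z| <= c) ->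
  integ setT f -> integ setT g ->
  (mu \x mu)%E.-integrable setT
    (fun z : measurableTypeR R * measurableTypeR R => (f z.1 * (k (z.1 - z.2) * g z.2))%:E).
Proof.
move=> mk kc If Ig; apply/integrable12ltyP.
  apply/measurable_EFinP; apply: measurable_funM.
    apply: measurableT_comp => //; exact: integ_meas.
  apply: measurable_funM.
    by apply: measurableT_comp => //; apply: measurable_funB.
  apply: measurableT_comp => //; exact: integ_meas.
apply: (@le_lt_trans _ _ (\int[mu]_x (`|f x| * (c * \int[mu]_y `|g y|))%:E)%E).
  apply: ge0_le_integral => //.
  - by move=> x _; apply: integral_ge0.
  - apply: (@measurable_fun_fubini_tonelli_F _ _ _ _ _ mu
      (fun z : measurableTypeR R * measurableTypeR R => (`|f z.1 * (k (z.1 - z.2) * g z.2)|)%:E)).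
    apply/measurable_EFinP; apply: measurableT_comp => //; apply: measurable_funM.
      apply: measurableT_comp => //; exact: integ_meas.
    apply: measurable_funM.
      by apply: measurableT_comp => //; apply: measurable_funB.
    apply: measurableT_comp => //; exact: integ_meas.
  - by move=> z; rewrite lee_fin.
  - apply/measurable_EFinP; apply: measurable_funM => //.
    by apply: measurableT_comp => //; exact: integ_meas.
  - move=> x _ /=; rewrite EFin_Int//; last first.
      apply: integ_abs; apply: integZ => //; exact: (@integ_conv _ c).
    rewrite lee_fin.
    have -> : `|f x| * (c * \int[mu]_y `|g y|) = \int[mu]_y (`|f x| * c * `|g y|).
      by rewrite RintegralZl ?mulrA//; exact: integ_abs.
    apply: Int_le => //.
    + by apply: integ_abs; apply: integZ => //; exact: (@integ_conv _ c).
    + by apply: integZ => //; exact: integ_abs.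
    + move=> y _; rewrite !normrM -mulrA ler_wpM2l// ler_wpM2r//.
have /integrableP[_] : integ setT (fun x => `|f x| * (c * \int[mu]_y `|g y|)).
  have := @integZ _ setT _ (c * \int[mu]_y `|g y|) measurableT (integ_abs If).
  by apply: eq_integ => // x _; rewrite mulrC.
apply: le_lt_trans; apply: ge0_le_integral => //=.
- move=> x _; rewrite lee_fin !mulr_ge0//; last by apply: Rintegral_ge0.
  by apply: le_trans (kc 0).
- apply/measurable_EFinP; apply: measurable_funM => //.
  by apply: measurableT_comp => //; exact: integ_meas.
- apply/measurable_EFinP; apply: measurableT_comp => //; apply: measurable_funM => //.
  by apply: measurableT_comp => //; exact: integ_meas.
- by move=> x _; rewrite lee_fin ler_norm.
Qed.

(** The adjoint of convolution with [k] is convolution with the reflected kernel; writing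
    [k (x - y)] on both sides avoids naming the reflection. *)
Lemma conv_swap k c f g : measurable_fun setT k -> (forall z, `|k z| <= c) ->
  integ setT f -> integ setT g ->
  \int[mu]_x (f x * \int[mu]_y (k (x - y) * g y)) =
  \int[mu]_y (g y * \int[mu]_x (k (x - y) * f x)).
Proof.
move=> mk kc If Ig.
have /Fubini/= E := conv_swap_integ mk kc If Ig.
apply: (congr1 fine).
transitivity (\int[mu]_x \int[mu]_y (f x * (k (x - y) * g y))%:E)%E.
  apply: eq_integral => x _; have I1 := integ_conv x mk kc Ig.
  by rewrite (EFin_Int measurableT (integZ _ measurableT I1)) (Int_scale _ measurableT I1).
rewrite E; apply: eq_integral => y _; have I1 := integ_convr y mk kc If.
have I2 : integ setT (fun x => f x * (k (x - y) * g y)).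
  apply: (eq_integ measurableT _ (integZ (g y) measurableT I1)) => x _.
  by ring.
rewrite (EFin_Int measurableT I2) -(Int_scale _ measurableT I1); congr EFin.
by apply: eq_Rintegral => x _; ring.
Qed.

Lemma integ_conv_swap k c f g : measurable_fun setT k -> (forall z, `|k z| <= c) ->
  integ setT f -> integ setT g ->
  integ setT (fun x => f x * \int[mu]_y (k (x - y) * g y)).
Proof.
move=> mk kc If Ig.
have := integrable_fubini_F (conv_swap_integ mk kc If Ig).
apply: eq_integrable => // x _; rewrite /fubini_F /= EFin_Int//; last first.
  by apply: integZ => //; exact: (@integ_conv _ c).
by rewrite RintegralZl//; exact: (@integ_conv _ c).
Qed.

End fubini.

(** * Derivatives and smooth functions *)

Section derivatives.
Variable R : realType.
Implicit Types (f g : R -> R) (x y a b c d : R).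

Lemma der_add f g x a b : is_derive x 1 f a -> is_derive x 1 g b ->
  is_derive x 1 (fun y => f y + g y) (a + b).
Proof. by move=> ? ?; apply: is_deriveD. Qed.

Lemma der_sub f g x a b : is_derive x 1 f a -> is_derive x 1 g b ->
  is_derive x 1 (fun y => f y - g y) (a - b).
Proof. by move=> ? ?; apply: is_deriveB. Qed.

Lemma der_opp f x a : is_derive x 1 f a -> is_derive x 1 (fun y => - f y) (- a).
Proof. by move=> ?; apply: is_deriveN. Qed.

Lemma der_mul f g x a b : is_derive x 1 f a -> is_derive x 1 g b ->
  is_derive x 1 (fun y => f y * g y) (a * g x + f x * b).
Proof.
move=> fa gb; apply: is_derive_eq (is_deriveM fa gb) _.
by rewrite addrC -[g x *: a]mulrC.
Qed.

Lemma der_const x c : is_derive x 1 (fun=> c) (0 : R).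
Proof. exact: is_derive_cst. Qed.

Lemma der_id x : is_derive x 1 (fun y => y) (1 : R).
Proof. exact: is_derive_id. Qed.

Lemma der_scale f x a c : is_derive x 1 f a -> is_derive x 1 (fun y => c * f y) (c * a).
Proof.
by move=> fa; apply: is_derive_eq (der_mul (der_const x c) fa) _; rewrite mul0r add0r.
Qed.

Lemma der_comp f g x a b : is_derive (g x) 1 f a -> is_derive x 1 g b ->
  is_derive x 1 (fun y => f (g y)) (a * b).
Proof. by move=> fa gb; apply: is_derive1_comp. Qed.

Lemma der_val f x d : is_derive x 1 f d -> f^`()%classic x = d.
Proof. by move=> fd; rewrite derive1E derive_val. Qed.

Lemma der_derivable f x d : is_derive x 1 f d -> derivable f x 1.
Proof. by move=> fd; exact: ex_derive. Qed.

Lemma derivable_der f x : derivable f x 1 -> is_derive x 1 f (f^`()%classic x).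
Proof. by move=> df; rewrite derive1E; exact: DeriveDef. Qed.

(** A first-order expansion without a quotient, suited to functions that are given piecewise or only
    estimated, such as [flat] at 0 and [beta]. *)
Lemma is_derive_eps f x d :
  (forall e, 0 < e -> \forall y \near x, `|f y - f x - (y - x) * d| <= e * `|y - x|) ->
  is_derive x 1 f d.
Proof.
move=> H.
suff C : h^-1 *: (f (h *: 1 + x) - f x) @[h --> 0^'] --> d.
  by apply: DeriveDef; [apply/cvg_ex; exists d|exact/cvg_lim].
apply/cvgrPdist_le => e e0.
have /nbhs0P H0 := H _ e0.
near=> h.
have h0 : h != 0 by near: h; exact: nbhs_dnbhs_neq.
have : `|f (x + h) - f x - (x + h - x) * d| <= e * `|x + h - x|.
  by near: h; apply: nbhs_dnbhs.
rewrite (addrC x h) addrK /= => Hh.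
rewrite [_ *: 1]mulr1 distrC (_ : _ - d = h^-1 * (f (h + x) - f x - h * d)); last first.
  by rewrite [_ *: _]mulrC; field.
rewrite normrM normfV mulrC ler_pdivrMr ?normr_gt0//.
Unshelve. all: by end_near. Qed.

Lemma is_derive_epsP f x d : is_derive x 1 f d ->
  forall e, 0 < e -> \forall y \near x, `|f y - f x - (y - x) * d| <= e * `|y - x|.
Proof.
move=> fd e e0.
have /cvgrPdist_le/(_ _ e0) : h^-1 *: (f (h *: 1 + x) - f x) @[h --> 0^'] --> d.
  have dfx : derivable f x 1 by exact: der_derivable fd.
  have <- : 'D_1 f x = d by exact: derive_val.
  exact: dfx.
move=> /nbhs_ballP[/= r r0 Hr]; apply/nbhs_ballP; exists r => //= y.
rewrite /ball/= => xy; have [->|yx] := eqVneq y x.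
  by rewrite !subrr mul0r subrr normr0 mulr0.
have yx0 : y - x != 0 by rewrite subr_eq0.
have xy' : ball 0 r (y - x) by rewrite /ball/= sub0r normrN distrC.
have := Hr (y - x) xy' yx0.
rewrite [_ *: 1]mulr1 subrK distrC (_ : _ - d = (y - x)^-1 * (f y - f x - (y - x) * d)); last first.
  by rewrite [_ *: _]mulrC; field.
by rewrite normrM normfV mulrC ler_pdivrMr ?normr_gt0.
Qed.

Lemma is_derive_near f g x d : (\forall y \near x, f y = g y) ->
  is_derive x 1 f d -> is_derive x 1 g d.
Proof.
move=> fg /is_derive_epsP H; apply: is_derive_eps => e e0.
have gx : f x = g x by exact: nbhs_singleton fg.
near=> y; rewrite -gx -(near fg y)//; near: y; exact: H.
Unshelve. all: by end_near. Qed.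

Definition smooth f := forall n x, derivable (f^`(n))%classic x 1.

(** Replaces formulas for n-th derivatives: it is enough to exhibit a class that contains [f] and is
    stable under differentiation. *)
Lemma smooth_coind (S : set (R -> R)) :
  (forall f, S f -> exists2 f', S f' & forall x, is_derive x 1 f (f' x)) ->
  forall f, S f -> smooth f.
Proof.
move=> HS f Sf n; suff [Sn dn] : S (f^`(n))%classic /\ True.
  by have [f' Sf' Hf'] := HS _ Sn => x; exact: der_derivable (Hf' x).
split=> //; elim: n => [|n IH]; first by rewrite derive1n0.
have [f' Sf' Hf'] := HS _ IH; rewrite derive1nS.
suff -> : (f^`(n))^`()%classic = f' by [].
by apply/funext => x; exact: der_val.
Qed.

Lemma smoothD1 f : smooth f -> forall x, is_derive x 1 f (f^`()%classic x).
Proof. by move=> sf x; apply: derivable_der; exact: (sf 0%N x). Qed.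

Lemma smooth_der f : smooth f -> smooth (f^`())%classic.
Proof. by move=> sf n x; rewrite -derive1Sn; exact: sf. Qed.

Lemma smooth_cont f : smooth f -> continuous f.
Proof.
move=> sf x; apply: differentiable_continuous; apply/derivable1_diffP.
exact: (sf 0%N x).
Qed.

(* Unlike the products alone, these sums of products are closed under differentiation,
   so that [smooth_coind] applies. *)
Inductive sprod : (R -> R) -> Prop :=
| sprodM f g : smooth f -> smooth g -> sprod (fun x => f x * g x)
| sprodD f g : sprod f -> sprod g -> sprod (fun x => f x + g x).

Lemma smoothM f g : smooth f -> smooth g -> smooth (fun x => f x * g x).
Proof.
move=> sf sg; apply: (smooth_coind (S := sprod)); last exact: sprodM.
move=> h; elim=> {f g sf sg h} [f g sf sg|f g _ [f' sf' Hf] _ [g' sg' Hg]].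
  exists (fun x => f^`()%classic x * g x + f x * g^`()%classic x).
    apply: sprodD; apply: sprodM; [exact: smooth_der sf|exact: sg|exact: sf|exact: smooth_der sg].
  by move=> x; apply: der_mul; exact: smoothD1.
exists (fun x => f' x + g' x); first exact: sprodD.
by move=> x; apply: der_add.
Qed.

Lemma smooth_cst c : smooth (fun=> c).
Proof.
apply: (smooth_coind (S := fun h => exists c, h = fun=> c)); last by exists c.
move=> _ [d ->]; exists (fun=> 0); first by exists 0.
by move=> x; exact: der_const.
Qed.

Lemma smoothZ c f : smooth f -> smooth (fun x => c * f x).
Proof. by move=> sf; apply: smoothM; [exact: smooth_cst|exact: sf]. Qed.

Lemma smoothD f g : smooth f -> smooth g -> smooth (fun x => f x + g x).
Proof.
move=> sf sg.
apply: (smooth_coind (S := sprod)) => [h|].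
  elim=> {f g sf sg h} [f g sf sg|f g _ [f' sf' Hf] _ [g' sg' Hg]].
    exists (fun x => f^`()%classic x * g x + f x * g^`()%classic x).
      apply: sprodD; apply: sprodM; [exact: smooth_der sf|exact: sg|exact: sf|exact: smooth_der sg].
    by move=> x; apply: der_mul; exact: smoothD1.
  exists (fun x => f' x + g' x); first exact: sprodD.
  by move=> x; apply: der_add.
(* A sum enters [sprod] as a sum of products with the constant 1. *)
have -> : (fun x => f x + g x) = (fun x => 1 * f x + 1 * g x).
  by apply/funext => x; rewrite !mul1r.
apply: sprodD; apply: sprodM; [exact: smooth_cst|exact: sf|exact: smooth_cst|exact: sg].
Qed.

Lemma smoothB f g : smooth f -> smooth g -> smooth (fun x => f x - g x).
Proof.
move=> sf sg; have := smoothD sf (@smoothZ (-1) _ sg).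
by under eq_fun do rewrite mulN1r.
Qed.

Lemma smooth_aff f a c : smooth f -> smooth (fun x => f ((x - a) * c)).
Proof.
move=> sf; apply: (smooth_coind (S := fun h => exists2 g, smooth g &
   exists d, h = fun x => d * g ((x - a) * c))); last first.
  by exists f => //; exists 1; apply/funext => x; rewrite mul1r.
move=> h [g sg [d ->]]; exists (fun x => (d * c) * g^`()%classic ((x - a) * c)).
  by exists (g^`())%classic; [exact: smooth_der|exists (d * c)].
move=> x; have H : is_derive x 1 (fun y => (y - a) * c) c.
  apply: is_derive_eq (der_mul (der_sub (der_id x) (der_const x a)) (der_const x c)) _.
  by rewrite subr0 mul1r mulr0 addr0.
have := @der_scale _ x _ d (@der_comp g (fun y => (y - a) * c) x _ _ (smoothD1 sg _) H).
congr is_derive.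
by ring.
Qed.

(** For p = 1 this is the classical flat function exp(-1/x). The polynomial factor in 1/x makes the
    family stable under differentiation. *)
Definition flat (p : {poly R}) x := if x <= 0 then 0 else p.[x^-1] * expR (- x^-1).

Lemma poly_bound (p : {poly R}) : exists C, forall y, 1 <= y ->
  `|p.[y]| <= C * y ^+ (size p).
Proof.
exists (\sum_(i < size p) `|p`_i|) => y y1; rewrite horner_coef.
apply: (le_trans (ler_norm_sum _ _ _)); rewrite mulr_suml; apply: ler_sum => i _.
rewrite normrM ler_wpM2l// ger0_norm ?exprn_ge0 ?(le_trans ler01)//.
by apply: ler_weXn2l => //; exact: ltnW.
Qed.

(** The exponential beats every power of 1/x. A quadratic bound is what gives a vanishing derivative
    at 0 with no further limit. *)
Lemma flat_bound p : exists2 C, 0 <= C & forall x, x <= 1 -> `|flat p x| <= C * x ^+ 2.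
Proof.
have [C HC] := poly_bound p.
have C0 : 0 <= C by have := le_trans (normr_ge0 _) (HC 1 (lexx 1)); rewrite expr1n mulr1.
set n := (size p).+1.
exists (C * (n.+1)`!%:R); first by rewrite mulr_ge0.
move=> x x1; rewrite /flat; have [x0|x0] := leP x 0.
  by rewrite normr0 mulr_ge0 ?sqr_ge0// mulr_ge0.
have y1 : 1 <= x^-1 by rewrite invf_ge1.
have y0 : 0 < x^-1 by rewrite invr_gt0.
have e0 := expR_gt0 x^-1.
rewrite normrM expRN [X in _ * X]ger0_norm ?invr_ge0 ?(ltW e0)//.
rewrite ler_pdivrMr//.
apply: (le_trans (HC _ y1)).
have F0 : (0 : R) < (n.+1)`!%:R by rewrite ltr0n fact_gt0.
(* Since n = size p + 1, exp(y) dominates y^(size p + 2) up to a factorial: two powers of y = 1/x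
   are left for the factor x^2. *)
have := expR_ge1Dxn n (ltW y0); set F : R := (n.+1)`!%:R in F0 *.
move=> H.
have {}H : x^-1 ^+ n.+1 <= F * expR x^-1.
  rewrite mulrC -ler_pdivrMr//; apply: le_trans H.
  by rewrite lerDr.
rewrite -!mulrA ler_wpM2l//.
rewrite (_ : x^-1 ^+ size p = x ^+ 2 * x^-1 ^+ n.+1).
  by rewrite [leRHS](_ : _ = x ^+ 2 * (F * expR x^-1)) ?ler_wpM2l ?sqr_ge0//; ring.
by rewrite /n !exprS; field; rewrite gt_eqF.
Qed.

Lemma near0_le (e : R) : 0 < e -> \forall x \near (0 : R), `|x| <= e.
Proof.
move=> e0; apply/nbhs_ballP; exists e => // y; rewrite /ball/= sub0r normrN.
exact: ltW.
Qed.

(** With y = 1/x one has dy/dx = - y^2, so differentiating p(y) exp(-y) turns p into X^2 (p - p').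
    At 0 the quadratic bound takes over. *)
Lemma flatD p x : is_derive x 1 (flat p) (flat ('X^2 * (p - p^`())) x).
Proof.
have [x0|x0|->] := ltgtP x 0.
- have -> : flat ('X^2 * (p - p^`())) x = 0 by rewrite /flat (ltW x0).
  apply: (@is_derive_near (fun=> 0)).

  near=> y; rewrite /flat; have [//|y0] := leP y 0.
  by have : y < 0; [near: y; exact: lt_nbhsl|rewrite ltNge (ltW y0)].
- rewrite [flat ('X^2 * (p - p^`())) x]/flat leNgt x0/=.
  apply: (@is_derive_near (fun y => p.[y^-1] * expR (- y^-1))).
    near=> y; rewrite /flat leNgt; suff -> : 0 < y by [].
    by near: y; exact: lt_nbhsr.
  have xn0 : x != 0 by rewrite gt_eqF.
  have dV : is_derive x 1 (fun y : R => y^-1) (- x^-1 ^+ 2).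
    have := @is_deriveV R (fun y => y) x 1 1 xn0 (der_id x).
    by congr is_derive; rewrite [_ *: _]mulr1 exprVn.
  apply: is_derive_eq (der_mul (@der_comp _ (fun y => y^-1) _ _ _ (is_derive_poly p x^-1) dV)
      (@der_comp _ (fun y => - y^-1) _ _ _ (is_derive_expR (- x^-1)) (der_opp dV))) _.
  rewrite !(hornerM, hornerX, hornerD, hornerN); ring.
- rewrite [flat ('X^2 * (p - p^`())) 0]/flat lexx; have [C C0 HC] := flat_bound p.
  have C1 : 0 < C + 1 by rewrite ltr_wpDl.
  apply: is_derive_eps => e e0; near=> y.
  rewrite [flat p 0]/flat lexx !subr0 mulr0 subr0.
  have y1 : `|y| <= 1.
    by near: y; exact: (near0_le ltr01).
  apply: (le_trans (HC _ _)); first by rewrite (le_trans (ler_norm _)).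
  rewrite -(real_normK (num_real y)) expr2 mulrA ler_wpM2r//.
  apply: (@le_trans _ _ ((C + 1) * `|y|)); first by rewrite ler_wpM2r// lerDl.
  rewrite mulrC -ler_pdivlMr//; near: y; exact: (near0_le (divr_gt0 e0 C1)).
Unshelve. all: by end_near. Qed.

Lemma smooth_flat p : smooth (flat p).
Proof.
apply: (smooth_coind (S := range flat)); last by exists p.
move=> _ [q _ <-]; exists (flat ('X^2 * (q - q^`()))); first by exists ('X^2 * (q - q^`())).
exact: flatD.
Qed.

End derivatives.

(** * Test functions and convolution *)

Section tests.
Variable R : realType.
Local Notation mu := (@lebesgue_measure R).
Implicit Types (f g k : R -> R) (x y a b c d r : R).

Lemma deriv_cont f f' : (forall x, is_derive x 1 f (f' x)) -> continuous f.
Proof.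
move=> sf x; apply: differentiable_continuous; apply/derivable1_diffP.
exact: der_derivable (sf x).
Qed.

Lemma FTC2 f f' a b : a <= b -> (forall x, is_derive x 1 f (f' x)) ->
  continuous f' -> \int[mu]_(x in `[a, b]) f' x = f b - f a.
Proof.
rewrite le_eqVlt => /predU1P[->|ab] ff' cf'.
  by rewrite set_itv1 Rintegral_set1 subrr.
have cf := deriv_cont ff'.
apply: EFin_inj; rewrite -EFin_Int//; last exact: integ_itv_cont.
rewrite (@continuous_FTC2 _ f' f a b)//.
- exact: continuous_subspaceT.
- split.
  + by move=> x _; exact: der_derivable (ff' x).
  + exact/cvg_at_right_filter/cf.
  + exact/cvg_at_left_filter/cf.
- by move=> x _; exact: der_val.
Qed.

Lemma nonneg_deriv_le f f' a b : a <= b -> (forall x, is_derive x 1 f (f' x)) ->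
  (forall x, a <= x <= b -> 0 <= f' x) -> f a <= f b.
Proof.
rewrite le_eqVlt => /predU1P[->//|ab] ff' f'0.
have [|c /itvP cab E] := @MVT _ f f' a b ab (fun x _ => ff' x).
  exact: continuous_subspaceT (deriv_cont ff').
rewrite -subr_ge0 E mulr_ge0 ?subr_ge0 ?(ltW ab)// f'0//.
by rewrite !cab.
Qed.

(** Test functions with an explicit support radius, so that radii add under convolution. *)
Definition Cc f r := smooth f /\ forall x, r < `|x| -> f x = 0.

Lemma Cc_test f r : Cc f r -> test_function f.
Proof.
move=> [sf f0]; split; first exact: sf.
apply: (@subclosed_compact _ _ `[- r, r]).
- exact: closed_closure.
- exact: segment_compact.
- rewrite [X in _ `<=` X](_ : _ = closure `[- r, r]).
    apply: closureS => x /= fx; rewrite in_itv/= -ler_norml leNgt.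
    by apply/negP => /f0 /eqP; rewrite (negbTE fx).
  by apply: (proj1 (closure_id _)); exact: interval_closed.
Qed.

Lemma test_Cc f : test_function f -> exists2 r, 0 < r & Cc f r.
Proof.
move=> [sf /compact_bounded[M [Mr HM]]].
exists (`|M| + 1); first by rewrite ltr_wpDl.
split=> // x Mx; apply/eqP/negPn/negP => fx.
have /HM/(_ x) : M < `|M| + 1 by rewrite (le_lt_trans (ler_norm _))// ltrDl.
move=> /(_ (@subset_closure _ [set x | f x != 0] _ fx)).
by rewrite /= leNgt Mx.
Qed.

Lemma Cc_le f r r' : r <= r' -> Cc f r -> Cc f r'.
Proof. by move=> rr [sf f0]; split => // x /(le_lt_trans rr); exact: f0. Qed.

Lemma Cc_der f r : Cc f r -> Cc (f^`())%classic r.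
Proof.
move=> [sf f0]; split; first exact: smooth_der.
move=> x rx; apply: der_val; apply: (@is_derive_near _ (fun=> 0)).
apply/nbhs_ballP; exists (`|x| - r); first by rewrite /= subr_gt0.
move=> y; rewrite /ball/= => xy; apply/esym/f0.
have := ler_normD (x - y) y; rewrite subrK; lra.
Qed.

Lemma CcB f g r : Cc f r -> Cc g r -> Cc (fun x => f x - g x) r.
Proof.
by move=> [sf f0] [sg g0]; split=> [|x rx]; [exact: smoothB|rewrite f0// g0// subrr].
Qed.

Lemma CcZ c f r : Cc f r -> Cc (fun x => c * f x) r.
Proof.
by move=> [sf f0]; split=> [|x rx]; [exact: smoothZ|rewrite f0// mulr0].
Qed.

Lemma Cc_supp f r : Cc f r -> forall x, ~ `[- r, r]%classic x -> f x = 0.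
Proof.
move=> [_ f0] x; rewrite /= in_itv/= -ler_norml => /negP; rewrite -ltNge; exact: f0.
Qed.

Lemma cont_supp_bounded f r : continuous f -> (forall x, r < `|x| -> f x = 0) ->
  exists2 C, 0 <= C & forall x, `|f x| <= C.
Proof.
move=> cf f0.
have cf' : {within `[- `|r|, `|r|], continuous (fun x => `|f x|)}.
  apply: continuous_subspaceT => x; apply: (@continuous_comp _ _ _ f Num.norm); first exact: cf.
  exact: norm_continuous.
have rr : - `|r| <= `|r| by have := normr_ge0 r; lra.
have [c _ Hc] := EVT_max rr cf'.
exists (`|f c|) => // x.
have [xr|rx] := leP `|x| `|r|; first by apply: Hc; rewrite in_itv/= -ler_norml.
by rewrite f0 ?normr0// (le_lt_trans (ler_norm _)).
Qed.

Lemma Cc_bounded f r : Cc f r -> exists2 C, 0 <= C & forall x, `|f x| <= C.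
Proof. by move=> [/smooth_cont cf f0]; exact: cont_supp_bounded f0. Qed.

Lemma integ_cont_supp f r : continuous f -> (forall x, r < `|x| -> f x = 0) ->
  integ setT f.
Proof.
move=> cf f0; apply: (@integ_supp _ `[- r, r]) => //; last exact: integ_itv_cont.
move=> x; rewrite /= in_itv/= -ler_norml => /negP; rewrite -ltNge; exact: f0.
Qed.

Lemma integ_Cc f r : Cc f r -> integ setT f.
Proof. by move=> [/smooth_cont cf f0]; exact: integ_cont_supp f0. Qed.

Definition conv k g x := \int[mu]_y (k (x - y) * g y).

Lemma der_shift k k' y x : (forall x, is_derive x 1 k (k' x)) ->
  is_derive x 1 (fun z => k (z - y)) (k' (x - y)).
Proof.
move=> kk'; apply: is_derive_eq (@der_comp _ k (fun z => z - y) x _ _ (kk' _) (der_sub (der_id x) (der_const x y))) _.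
by rewrite subr0 mulr1.
Qed.

Lemma convD k k' g c x : (forall x, is_derive x 1 k (k' x)) -> 
  continuous k' -> (forall x, `|k x| <= c) -> (forall x, `|k' x| <= c) ->
  integ setT g -> is_derive x 1 (conv k g) (conv k' g x).
Proof.
move=> kk' ck' kc k'c Ig.
pose F (x y : R) := k (x - y) * g y.
have dF (z y : R) : is_derive z 1 (F^~ y) (k' (z - y) * g y).
  apply: is_derive_eq (der_mul (der_shift y z kk') (der_const z (g y))) _.
  by rewrite mulr0 addr0.
have IF (z : R) : `]x - 1, x + 1[%classic z -> mu.-integrable setT (EFin \o F z).
  by move=> _; apply: (@integ_conv _ k c) => //; exact: meas_cont (deriv_cont kk').
have dFz (z y : R) : `]x - 1, x + 1[%classic z -> setT y -> derivable (F^~ y) z 1.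
  by move=> _ _; exact: der_derivable (dF z y).
have Ix : `]x - 1, x + 1[%classic x by rewrite /= in_itv/= ltrBlDr ltrDl ltr01.
pose G y := c * `|g y|.
have G0 y : 0 <= G y by rewrite mulr_ge0// (le_trans _ (kc 0)).
have IG : mu.-integrable setT (EFin \o G) by apply: integZ => //; exact: integ_abs.
have Gub (z y : R) : `]x - 1, x + 1[%classic z -> setT y -> `|partial1of2 F z y| <= G y.
  by move=> _ _; rewrite /partial1of2 (der_val (dF z y)) normrM ler_wpM2r.
have dC := derivable_under_integral measurableT Ix IF dFz G0 IG Gub.
have eC := differentiation_under_integral measurableT Ix IF dFz G0 IG Gub.
rewrite (_ : conv k' g x = \int[mu]_y (partial1of2 F ^~ y) x).
  by rewrite -eC; exact: derivable_der.
by apply: eq_Rintegral => y _; rewrite /partial1of2 (der_val (dF x y)).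
Qed.

Lemma conv_CcD k g r x : Cc k r -> integ setT g ->
  is_derive x 1 (conv k g) (conv (k^`())%classic g x).
Proof.
move=> Ck Ig; have [c c0 kc] := Cc_bounded Ck.
have [c' c'0 kc'] := Cc_bounded (Cc_der Ck).
apply: (@convD _ _ _ (c + c')) => //.
- exact: smoothD1 Ck.1.
- exact: smooth_cont (Cc_der Ck).1.
- by move=> z; rewrite (le_trans (kc z))// lerDl.
- by move=> z; rewrite (le_trans (kc' z))// lerDr.
Qed.

Lemma conv_smooth k g r : Cc k r -> integ setT g -> smooth (conv k g).
Proof.
move=> Ck Ig.
apply: (smooth_coind (S := fun h => exists2 k, Cc k r & h = conv k g)); last by exists k.
move=> _ [h Ch ->]; exists (conv (h^`())%classic g).
  by exists (h^`())%classic => //; exact: Cc_der.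
by move=> x; exact: conv_CcD Ch Ig.
Qed.

Lemma conv_supp k g r r' : (forall x, r < `|x| -> k x = 0) ->
  (forall x, r' < `|x| -> g x = 0) -> forall x, r + r' < `|x| -> conv k g x = 0.
Proof.
move=> k0 g0 x rx; rewrite /conv (@eq_Rintegral _ _ _ _ _ (fun=> 0)).
  by rewrite Rintegral_cst// mul0r.
move=> y _; have [yr|ry] := leP `|y| r'; last by rewrite g0// mulr0.
rewrite k0 ?mul0r//; rewrite -(ltrD2r r'); apply: (lt_le_trans rx).
by rewrite -{1}(subrK y x) (le_trans (ler_normD _ _))// lerD2l.
Qed.

Lemma conv_Cc k g r r' : Cc k r -> integ setT g ->
  (forall x, r' < `|x| -> g x = 0) -> Cc (conv k g) (r + r').
Proof.
move=> Ck Ig g0; split; first exact: conv_smooth Ck Ig.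
exact: conv_supp Ck.2 g0.
Qed.

End tests.

(** * Bump functions and cutoffs *)

Section bump.
Variable R : realType.
Local Notation mu := (@lebesgue_measure R).
Implicit Types (f g k : R -> R) (x y a b c d r : R).

(** The bump and its primitive are produced together, so that the derivative of every cutoff is
    literally a difference of rescaled bumps. The lower bound near 0 later turns \int u^2 over a
    window into a flux. *)
Lemma bump_exists : exists rP : (R -> R) * (R -> R),
  [/\ Cc rP.1 1, smooth rP.2, forall x, is_derive x 1 rP.2 (rP.1 x),
      forall x, 0 <= rP.1 x &
   [/\ exists2 c, 0 < c & forall x, `|x| <= 2^-1 -> c <= rP.1 x,
      forall x, x <= -1 -> rP.2 x = 0 & forall x, 1 <= x -> rP.2 x = 1]].
Proof.
(* The product of the flat functions of 1 - x and 1 + x, positive exactly on ]-1, 1[. *)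
pose q x : R := flat 1 ((x - 1) * -1) * flat 1 ((x - -1) * 1).
have sq : smooth q by apply: smoothM; apply: smooth_aff; exact: smooth_flat.
have flat0 y : 0 <= flat (1 : {poly R}) y.
  by rewrite /flat; case: ifP => // _; rewrite hornerE mul1r expR_ge0.
have q0 x : 0 <= q x by rewrite mulr_ge0.
have qs x : 1 < `|x| -> q x = 0.
  rewrite /q /flat lter_normr => /orP[x1|x1].
    by rewrite ifT ?mul0r//; lra.
  by rewrite [X in _ * X]ifT ?mulr0//; lra.
have Cq : Cc q 1 by [].
(* The value of exp(-1/y) at y = 1/2: for |x| <= 1/2 both factors have argument at least 1/2. *)
pose e : R := expR (- 2).
have e0 : 0 < e by exact: expR_gt0.
have flate y : 2^-1 <= y -> e <= flat (1 : {poly R}) y.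
  move=> y2; have y0 : 0 < y by lra.
  rewrite /flat ifN -?ltNge// hornerE mul1r ler_expR lerN2.
  by rewrite -[leRHS]invrK lef_pV2// posrE// invr_gt0.
have qe x : `|x| <= 2^-1 -> e * e <= q x.
  by rewrite ler_norml => /andP[x1 x2]; apply: ler_pM => //; try exact: ltW; apply: flate; lra.
have cq := smooth_cont sq.
have Iq := integ_Cc Cq.
pose Z := \int[mu]_x q x.
have Z0 : 0 < Z.
  apply: (@lt_le_trans _ _ (\int[mu]_(x in `[- 2^-1, 2^-1]) (e * e))).
    rewrite Int_cst_itv; last by lra.
    by rewrite mulr_gt0 ?mulr_gt0//; lra.
  apply: (@le_trans _ _ (\int[mu]_(x in `[- 2^-1, 2^-1]) q x)).
    apply: Int_le => //; [exact: integ_cst|exact: integ_itv_cont|].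
    by move=> x; rewrite /= in_itv/= -ler_norml; exact: qe.
  by apply: Int_subset.
pose rho x := Z^-1 * q x.
have Cr : Cc rho 1 := CcZ Z^-1 Cq.
have cr := smooth_cont Cr.1.
have Ir := integ_Cc Cr.
have r0 x : 0 <= rho x by rewrite mulr_ge0// invr_ge0 ltW.
pose P x := \int[mu]_(t in [set` `]-oo, x]]) rho t.
have dP x : is_derive x 1 P (rho x).
  have x1 : x < x + 1 by rewrite ltrDl.
  have Ix : integ [set` `]-oo, (x + 1)]] rho by apply: (integS _ _ _ Ir).
  have [dP E] := @continuous_FTC1 R rho -oo%O x (x + 1) x1 Ix (ltNyr _) (cr x).
  by have := derivable_der dP; rewrite E.
have P1 x : x <= -1 -> P x = 0.
  move=> x1; rewrite /P (@eq_Rintegral _ _ _ _ _ (fun=> 0)).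
    by rewrite Rintegral_cst// mul0r.
  move=> y; rewrite inE/= in_itv/= => yx; rewrite /rho /q /flat.
  by rewrite [X in _ * (_ * X)]ifT ?mulr0//; lra.
have P2 x : 1 <= x -> P x = 1.
  move=> x1; rewrite /P Rintegral_mkcond -[RHS](mulVf (lt0r_neq0 Z0)).
  rewrite /Z -RintegralZl//; apply: eq_Rintegral => y _.
  rewrite patchE; case: ifPn => // /negP yx.
  rewrite qs ?mulr0// lter_normr; apply/orP; left.
  apply: (le_lt_trans x1); rewrite ltNge; apply/negP => xy; apply: yx.
  by rewrite inE/= in_itv.
have sP : smooth P.
  apply: (smooth_coind (S := fun h => h = P \/ smooth h)); last by left.
  move=> h [->|sh]; first by exists rho => //; right; exact: Cr.1.
  by exists (h^`())%classic; [right; exact: smooth_der|exact: smoothD1].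
exists (rho, P); split=> //; split=> //.
exists (Z^-1 * (e * e)); first by rewrite !mulr_gt0// invr_gt0.
by move=> x /qe; rewrite ler_pM2l// invr_gt0.
Qed.

Definition rho : R -> R := (projT1 (cid bump_exists)).1.
Definition step : R -> R := (projT1 (cid bump_exists)).2.

Lemma rho_Cc : Cc rho 1.
Proof. by rewrite /rho; case: cid => ? []. Qed.

Lemma rho_ge0 x : 0 <= rho x.
Proof. by rewrite /rho; case: cid => ? []. Qed.

Lemma step_smooth : smooth step.
Proof. by rewrite /step; case: cid => ? []. Qed.

Lemma stepD x : is_derive x 1 step (rho x).
Proof. by rewrite /rho/step; case: cid => ? []. Qed.

Lemma rho_lower : exists2 c, 0 < c & forall x, `|x| <= 2^-1 -> c <= rho x.
Proof. by rewrite /rho; case: cid => ? [? ? ? ? []]. Qed.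

Lemma step0 x : x <= -1 -> step x = 0.
Proof. by rewrite /step; case: cid => ? [? ? ? ? []] /= _ + _; exact. Qed.

Lemma step1 x : 1 <= x -> step x = 1.
Proof. by rewrite /step; case: cid => ? [? ? ? ? []] /= _ _; exact. Qed.

Lemma step_nd x y : x <= y -> step x <= step y.
Proof. by move=> xy; apply: (nonneg_deriv_le xy stepD) => z _; exact: rho_ge0. Qed.

Lemma step_ge0 x : 0 <= step x.
Proof.
have [x1|x1] := leP x (-1); first by rewrite step0.
by rewrite -(step0 (lexx (-1))) step_nd// ltW.
Qed.

Lemma step_le1 x : step x <= 1.
Proof.
have [x1|x1] := leP 1 x; first by rewrite step1.
by rewrite -(step1 (lexx 1)) step_nd// ltW.
Qed.

Lemma der_rescale f f' a e x : (forall x, is_derive x 1 f (f' x)) ->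
  is_derive x 1 (fun z => f ((z - a) * e)) (e * f' ((x - a) * e)).
Proof.
move=> ff'.
apply: is_derive_eq (@der_comp _ f (fun z => (z - a) * e) x _ _ (ff' _) (der_mul (der_sub (der_id x) (der_const x a)) (der_const x e))) _.
by rewrite subr0 mul1r mulr0 addr0 mulrC.
Qed.

(* Rises from 0 to 1 on [a - l, a + l], falls back to 0 on [b - l', b + l']. *)
Definition cut a l b l' x := step ((x - a) * l^-1) - step ((x - b) * l'^-1).

Definition dcut a l b l' x := l^-1 * rho ((x - a) * l^-1) - l'^-1 * rho ((x - b) * l'^-1).

Lemma cutD a l b l' x : is_derive x 1 (cut a l b l') (dcut a l b l' x).
Proof. by apply: der_sub; apply: der_rescale; exact: stepD. Qed.

Section cut.
Variables (a l b l' : R).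
Hypotheses (l0 : 0 < l) (l'0 : 0 < l') (ab : a + l <= b - l').

Lemma step_sc0 c s x : 0 < s -> x <= c - s -> step ((x - c) * s^-1) = 0.
Proof. by move=> s0 xc; apply: step0; rewrite ler_pdivrMr//; lra. Qed.

Lemma step_sc1 c s x : 0 < s -> c + s <= x -> step ((x - c) * s^-1) = 1.
Proof. by move=> s0 xc; apply: step1; rewrite ler_pdivlMr//; lra. Qed.

Lemma cut_in x : a + l <= x <= b - l' -> cut a l b l' x = 1.
Proof. by move=> /andP[ax xb]; rewrite /cut step_sc1// step_sc0// subr0. Qed.

Lemma cut_left x : x <= a - l -> cut a l b l' x = 0.
Proof.
move=> xa; rewrite /cut step_sc0// step_sc0// ?subrr//.
by have := l0; have := l'0; have := ab; lra.
Qed.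

Lemma cut_right x : b + l' <= x -> cut a l b l' x = 0.
Proof.
move=> xa; rewrite /cut step_sc1// ?step_sc1// ?subrr//.
by have := l0; have := l'0; have := ab; lra.
Qed.

Lemma cut_ge0 x : 0 <= cut a l b l' x.
Proof.
have [xm|xm] := leP x (a + l).
  by rewrite /cut [X in _ - X]step_sc0 ?subr0 ?step_ge0// (le_trans xm).
by rewrite /cut step_sc1 ?(ltW xm)// subr_ge0 step_le1.
Qed.

Lemma cut_le1 x : cut a l b l' x <= 1.
Proof.
rewrite /cut; have := step_le1 ((x - a) * l^-1); have := step_ge0 ((x - b) * l'^-1).
by lra.
Qed.

Lemma cut_Cc : Cc (cut a l b l') (Num.max (l - a) (b + l')).
Proof.
split; first by apply: smoothB; apply: smooth_aff; exact: step_smooth.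
move=> x; rewrite gt_max => /andP[x1 x2]; have [x0|x0] := leP 0 x.
  by apply: cut_right; rewrite ger0_norm// in x2; exact: ltW.
by apply: cut_left; rewrite ltr0_norm// in x1; lra.
Qed.

End cut.
End bump.

(** * Absolutely continuous functions *)

Section AC.
Variable R : realType.
Local Notation mu := (@lebesgue_measure R).
Implicit Types (f g w : R -> R) (x y a b c d e r : R).

Lemma Int_cat a b c f : a <= c -> c <= b -> integ `[a, b] f ->
  \int[mu]_(x in `[a, b]) f x =
  \int[mu]_(x in `[a, c]) f x + \int[mu]_(x in `[c, b]) f x.
Proof.
move=> ac cb If.
have := @Rintegral_itvB R f (BLeft a) (BRight b) c If.
rewrite !bnd_simp => /(_ ac cb) E.
rewrite -(@Rintegral_itv_obnd_cbnd R c (BRight b) f) -?E; first by rewrite addrC subrK.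
apply: (integS _ _ _ If) => // x; rewrite /= !in_itv/= => /andP[cx ->].
by rewrite (le_trans ac (ltW cx)).
Qed.

(** Compactness of [a, b] makes the threshold uniform in [x]; [y] stays free because a mollifier
    reaches beyond the interval. *)
Lemma unif_cont f a b : continuous f -> forall e, 0 < e -> exists2 d, 0 < d &
  forall x y, a <= x <= b -> `|x - y| <= d -> `|f x - f y| <= e.
Proof.
move=> cf e e0.
have := @segment_compact R a b; rewrite compact_near_coveringP => /(_ R 0^'+).
pose P (d x : R) := forall y, `|x - y| <= d -> `|f x - f y| <= e.
move=> /(_ P _) [x _|/= d d0 H].
  have /cvgrPdist_le/(_ (e / 2)) := cf x; rewrite divr_gt0// => /(_ isT).
  move=> /nbhs_ballP[r /= r0 Hr].
  near=> z d => y /= zy.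
  have xz : `|f x - f z| <= e / 2.
    apply: Hr; near: z; apply/nbhs_ballP; exists (r / 2); first by rewrite /= divr_gt0.
    by apply: le_ball; lra.
  have xy : `|f x - f y| <= e / 2.
    apply: Hr; rewrite /ball/=.
    have x2 : `|x - z| < r / 2.
      by near: z; apply/nbhs_ballP; exists (r / 2) => //; rewrite /= divr_gt0.
    have d2 : d < r / 2 by near: d; apply: nbhs_right_lt; rewrite divr_gt0.
    by have := ler_normD (x - z) (z - y); rewrite addrA subrK; lra.
  by have := ler_normB (f x - f y) (f x - f z); rewrite opprB addrC addrA subrK; lra.
exists (d / 2); first by rewrite divr_gt0.
move=> x y axb xy; apply: (H (d / 2)) => //.
- by rewrite /ball_/= sub0r normrN gtr0_norm ?divr_gt0// ltr_pdivrMr// ltr_pMr ?ltr1n.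
- by rewrite divr_gt0.
Unshelve. all: by end_near. Qed.

Lemma cont_bounded f a b : continuous f -> exists2 C, 0 <= C &
  forall x, a <= x <= b -> `|f x| <= C.
Proof.
move=> cf; have [ab|ba] := leP a b; last first.
  by exists 0 => // x /andP[ax xb]; have := le_trans ax xb; rewrite leNgt ba.
have cf' : {within `[a, b], continuous (fun x => `|f x|)}.
  apply: continuous_subspaceT => x; apply: (@continuous_comp _ _ _ f Num.norm); first exact: cf.
  exact: norm_continuous.
have [c _ Hc] := EVT_max ab cf'.
by exists (`|f c|) => // x axb; apply: Hc; rewrite in_itv.
Qed.

(** Absolute continuity through the fundamental theorem with a fixed density [w], which may be
    altered on null sets; no pointwise derivative is involved. *)
Definition AC f w := [/\ continuous f, measurable_fun setT w,
  forall a b, integ `[a, b] w &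
  forall a b, a <= b -> f b - f a = \int[mu]_(x in `[a, b]) w x].

Lemma AC_C1 f f' : (forall x, is_derive x 1 f (f' x)) -> continuous f' -> AC f f'.
Proof.
move=> ff' cf'; split; first exact: deriv_cont ff'.
- exact: meas_cont.
- by move=> a b; exact: integ_itv_cont.
- by move=> a b ab; rewrite (FTC2 ab ff').
Qed.

Lemma integ_itvM f w a b : continuous f -> measurable_fun setT w ->
  integ `[a, b] w -> integ `[a, b] (fun x => w x * f x).
Proof.
move=> cf mw Iw; have [C C0 HC] := cont_bounded a b cf.
apply: (@integM _ _ _ _ C) => //; exact: measurable_funTS (meas_cont cf).
Qed.

(* Replaces differentiation almost everywhere in the product rule for [AC] functions below: the
   defect [q] of the product formula is small compared with the variation [V]. *)
Lemma null_increments (q V : R -> R) a b : a <= b ->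
  (forall e, 0 < e -> exists2 d, 0 < d & forall x y, a <= x -> x <= y -> y <= b ->
     y - x <= d -> `|q y - q x| <= e * (V y - V x)) -> q b = q a.
Proof.
move=> ab H.
suff E e : 0 < e -> `|q b - q a| <= e * (V b - V a).
  apply/eqP; rewrite -subr_eq0 -normr_le0; apply/ler_addgt0Pl => e e0; rewrite addr0.
  apply: (le_trans (E (e / (`|V b - V a| + 1)) _)).
    by rewrite divr_gt0// ltr_wpDl.
  rewrite mulrAC ler_pdivrMr ?ltr_wpDl// ler_pM2l//.
  by rewrite (le_trans (ler_norm _))// lerDl.
move=> e0; have [d d0 Hd] := H e e0.
pose N := Num.truncn ((b - a) / d).
have bN : (b - a) / d < N.+1%:R by exact: truncnS_gt.
pose h := (b - a) / N.+1%:R.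
have N0 : (0 : R) < N.+1%:R by rewrite ltr0n.
have h0 : 0 <= h by rewrite divr_ge0 ?subr_ge0// ltW.
have hd : h <= d.
  by rewrite /h ler_pdivrMr// mulrC -ler_pdivrMr// ltW.
have K (k : nat) : (k <= N.+1)%N -> `|q (a + k%:R * h) - q a| <= e * (V (a + k%:R * h) - V a).
  elim: k => [|k IH] kN; first by rewrite mul0r addr0 !subrr normr0 mulr0.
  have /IH {}IH := ltnW kN.
  have kb : a + k.+1%:R * h <= b.
    rewrite -lerBrDl -[leRHS](divfK (lt0r_neq0 N0)) mulrC ler_wpM2l// ler_nat//.
  have kS : a + k.+1%:R * h - (a + k%:R * h) = h by rewrite -natr1; ring.
  have := Hd (a + k%:R * h) (a + k.+1%:R * h).
  rewrite lerDl mulr_ge0 ?ler0n// => /(_ isT).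
  rewrite -subr_ge0 kS h0 => /(_ isT kb hd) H1.
  by have := ler_distD (q (a + k%:R * h)) (q (a + k.+1%:R * h)) (q a); lra.
have := K N.+1 (leqnn _).
by rewrite /h mulrC divfK ?lt0r_neq0// addrCA subrr addr0.
Qed.

Lemma AC_M f f' g g' : AC f f' -> AC g g' ->
  AC (fun x => f x * g x) (fun x => f' x * g x + g' x * f x).
Proof.
move=> [cf mf If Ef] [cg mg Ig Eg].
have mcf := meas_cont cf; have mcg := meas_cont cg.
have IS a b : integ `[a, b] (fun x => f' x * g x + g' x * f x).
  by apply: integD => //; exact: integ_itvM.
split.
- by move=> x; apply: continuousM; [exact: cf|exact: cg].
- by apply: measurable_funD; apply: measurable_funM.
- exact: IS.
move=> a b ab.
pose w x := f' x * g x + g' x * f x.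
pose q x := f x * g x - \int[mu]_(t in `[a, x]) w t.
pose V x := \int[mu]_(t in `[a, x]) (`|f' t| + `|g' t|).
have IV c d : integ `[c, d] (fun t => `|f' t| + `|g' t|).
  by apply: integD => //; exact: integ_abs.
suff : q b = q a.
  rewrite /q set_itv1 Rintegral_set1 subr0 => E.
  by rewrite -E opprB addrCA subrr addr0.
apply: (@null_increments q V) => // e e0.
have [d1 d10 H1] := @unif_cont f a b cf e e0.
have [d2 d20 H2] := @unif_cont g a b cg e e0.
exists (Num.min d1 d2); first by rewrite lt_min d10.
move=> x y ax xy yb; rewrite le_min => /andP[xy1 xy2].
rewrite /q /V (@Int_cat a y x w)// ?(@Int_cat a y x (fun t => `|f' t| + `|g' t|))//.
rewrite [X in _ <= _ * X](_ : _ = \int[mu]_(t in `[x, y]) (`|f' t| + `|g' t|)); last by ring.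
rewrite opprD addrA.
(* From f(y) g(y) - f(x) g(x) = g(y) (f(y) - f(x)) + f(x) (g(y) - g(x)): the defect contains only
   oscillations of f and g over [x, y], which uniform continuity makes small. *)
have -> : f y * g y - \int[mu]_(t in `[a, x]) w t - \int[mu]_(t in `[x, y]) w t -
  (f x * g x - \int[mu]_(t in `[a, x]) w t) =
  \int[mu]_(t in `[x, y]) ((g y - g t) * f' t + (f x - f t) * g' t).
  transitivity (\int[mu]_(t in `[x, y]) ((g y * f' t + f x * g' t) - w t)).
    rewrite RintegralB//; last 2 first.
    - by apply: integD => //; exact: integZ.
    - exact: IS.
    rewrite (@RintegralD _ _ _ mu `[x, y]%classic (fun t => g y * f' t) (fun t => f x * g' t))//; [|exact: integZ..].
    rewrite (@RintegralZl _ _ _ mu `[x, y]%classic f')// ?(@RintegralZl _ _ _ mu `[x, y]%classic g')//; [|exact: Ig|exact: If].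
    by rewrite -Ef// -Eg//; ring.
  by apply: eq_Rintegral => t _; rewrite /w; ring.
rewrite -(@RintegralZl _ _ _ mu `[x, y]%classic (fun t => `|f' t| + `|g' t|))//; last exact: IV.
apply: Int_abs_le => //.
- apply: measurable_funTS; apply: measurable_funD; apply: measurable_funM => //;
    exact: measurable_funB.
- exact: integZ.
move=> t; rewrite /= in_itv/= => /andP[xt ty].
apply: (le_trans (ler_normD _ _)); rewrite !normrM mulrDr.
have [yx1 yx2] : `|y - t| <= d2 /\ `|x - t| <= d1.
  by rewrite ger0_norm ?subr_ge0// distrC ger0_norm ?subr_ge0//; split; lra.
by apply: lerD; apply: ler_wpM2r => //; [apply: H2|apply: H1] => //;
  rewrite ?yb ?ax ?(le_trans ax xy)// (le_trans xy yb).
Qed.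

Lemma AC_B f f' g g' : AC f f' -> AC g g' ->
  AC (fun x => f x - g x) (fun x => f' x - g' x).
Proof.
move=> [cf mf If Ef] [cg mg Ig Eg]; split.
- by move=> x; apply: cvgB; [exact: cf|exact: cg].
- exact: measurable_funB.
- by move=> a b; exact: integB.
- by move=> a b ab; rewrite (Int_sub _ (If a b) (Ig a b))// -Ef// -Eg//; ring.
Qed.

Lemma AC_ibp f f' g g' r : AC f f' -> AC g g' ->
  (forall x, r < `|x| -> g x = 0) -> (forall x, r < `|x| -> g' x = 0) ->
  [/\ integ setT (fun x => f x * g' x), integ setT (fun x => f' x * g x) &
   \int[mu]_x (f x * g' x) = - \int[mu]_x (f' x * g x)].
Proof.
move=> ACf ACg g0 g'0; have [_ _ IM EM] := AC_M ACf ACg.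
move: ACf ACg => [cf mf If Ef] [cg mg Ig Eg].
(* The enlargement puts the endpoints strictly outside the support, so the boundary terms vanish. *)
pose s := `|r| + 1.
have rs : r < s by rewrite /s (le_lt_trans (ler_norm r))// ltrDl.
have s0 : 0 < s by rewrite ltr_wpDl.
have out x : ~ `[- s, s]%classic x -> r < `|x|.
  rewrite /= in_itv/= -ler_norml => /negP; rewrite -ltNge; exact: lt_trans.
have Is1 : integ `[- s, s] (fun x => f x * g' x).
  by have := @integ_itvM f g' (- s) s cf mg (Ig _ _); apply: eq_integ => // x _; exact: mulrC.
have Is2 : integ `[- s, s] (fun x => f' x * g x) by exact: integ_itvM.
have S1 x : ~ `[- s, s]%classic x -> f x * g' x = 0 by move=> /out/g'0 ->; rewrite mulr0.
have S2 x : ~ `[- s, s]%classic x -> f' x * g x = 0 by move=> /out/g0 ->; rewrite mulr0.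
split; [exact: integ_supp S1 Is1|exact: integ_supp S2 Is2|].
rewrite (Int_supp S1) (Int_supp S2).
have ss : - s <= s by lra.
have := EM _ _ ss; rewrite !g0 ?normrN ?gtr0_norm// !mulr0 subrr.
rewrite RintegralD//; last by exact: integ_itvM.
move=> E; apply/eqP; rewrite -addr_eq0 addrC; apply/eqP; rewrite [in RHS]E.
by congr (_ + _); apply: eq_Rintegral => x _; exact: mulrC.
Qed.

End AC.

(** * Representatives of Sobolev functions *)

Section weak.
Variable R : realType.
Local Notation mu := (@lebesgue_measure R).
Implicit Types (f g w k : R -> R) (x y a b c d e r : R).

Lemma locint_itv f a b : locally_integrable setT f -> integ `[a, b] f.
Proof.
move=> [mf _ If]; apply/integrableP; split.
  by apply/measurable_EFinP; exact: measurable_funTS.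
by apply: If => //; exact: segment_compact.
Qed.

Lemma locint_meas f : locally_integrable setT f -> measurable_fun setT f.
Proof. by case. Qed.

Lemma right_nbhs (P : R -> Prop) : (\forall r \near 0^'+, P r) ->
  exists2 d, 0 < d & forall r, 0 < r -> r < d -> P r.
Proof.
move=> /nbhs_ballP[d /= d0 H]; exists d => // r r0 rd; apply: H => //.
by rewrite /ball/= sub0r normrN gtr0_norm.
Qed.

Lemma lebpt_avg f a : locally_integrable setT f -> lebesgue_pt f a ->
  forall h, 0 < h -> exists2 d, 0 < d & forall e, 0 < e -> e < d ->
  \int[mu]_(x in `[a - e, a + e]) `|f x - f a| <= h * e.
Proof.
move=> lf lfa h h0.
have Ic (c d : R) : integ `[c, d] (fun x => `|f x - f a|).
  by apply: integ_abs; apply: integB => //; [exact: locint_itv|exact: integ_cst].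
have h4 : 0 < h / 4 by rewrite divr_gt0.
have /fine_cvgP[fin /cvgrPdist_le/(_ _ h4) H] := lfa.
have [d d0 Hd] := right_nbhs (filterI fin H).
exists (d / 2); first by rewrite divr_gt0.
(* The open ball of radius 2 e contains the closed interval and has measure 4 e, so an average of at
   most h / 4 becomes an integral of at most h e. *)
move=> e e0 ed; have e20 : 0 < e *+ 2 by rewrite mulrn_wgt0.
have [] := Hd (e *+ 2) e20; first by rewrite -mulr_natr; lra.
rewrite /= sub0r normrN => fi; rewrite ger0_norm; last by rewrite fine_ge0// davg_ge0.
move=> davgh.
pose A : set R := ball a (e *+ 2).
have mA : measurable A by exact: measurable_ball.
have AE : A = `](a - e *+ 2), (a + e *+ 2)[%classic by rewrite /A ball_itv.
have IA : integ A (fun x => `|f x - f a|).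
  apply: (integS _ _ _ (Ic (a - e *+ 2) (a + e *+ 2))) => //.
  by rewrite AE => x; rewrite /= !in_itv/= => /andP[/ltW -> /ltW ->].
apply: (@le_trans _ _ (\int[mu]_(x in A) `|f x - f a|)).
  apply: Int_subset => //.
  by rewrite AE => x; rewrite /= !in_itv/= => /andP[x1 x2]; apply/andP; split; rewrite -mulr_natr; lra.
have : davg f a (e *+ 2) = ((e *+ 4)^-1 * \int[mu]_(x in A) `|f x - f a|)%:E.
  rewrite /davg /iavg lebesgue_measure_ball ?ltW// -mulrnA.
  rewrite inver ifF; last by apply/negbTE; rewrite mulrn_eq0/= gt_eqF.
  by rewrite EFinM -EFin_Int.
move=> E; move: davgh; rewrite E/= ler_pdivrMl ?mulrn_wgt0// => /le_trans; apply.
by rewrite -mulr_natr; lra.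
Qed.

(** The kernel need not be centred at [a] nor be nonnegative: height O(1/e), support within distance
    e and integral 1 suffice. This freedom allows bumps placed on one side of the point. *)
Lemma lebpt_approx f a C : locally_integrable setT f -> lebesgue_pt f a -> 0 < C ->
  forall h, 0 < h -> exists2 d, 0 < d & forall e, 0 < e -> e < d ->
  forall k, measurable_fun setT k -> (forall x, `|k x| <= C / e) ->
   (forall x, e < `|x - a| -> k x = 0) -> \int[mu]_x k x = 1 ->
   `|\int[mu]_x (f x * k x) - f a| <= h.
Proof.
move=> lf lfa C0 h h0; have hC : 0 < h / C by rewrite divr_gt0.
have [d d0 H] := lebpt_avg lf lfa hC.
exists d => // e e0 ed k mk kC k0 k1.
pose A : set R := `[a - e, a + e]%classic.
have mA : measurable A by exact: measurable_itv.
have kA x : ~ A x -> k x = 0.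
  rewrite /A /= in_itv/= => xA; apply: k0; rewrite ltNge; apply/negP => xa; apply: xA.
  by move: xa; rewrite ler_norml => /andP[x1 x2]; apply/andP; split; lra.
have Ik : integ A k.
  apply: (@integ_le _ _ _ (fun=> C / e)) => //; first exact: measurable_funTS.
  exact: integ_cst.
have IfA : integ A f by exact: locint_itv.
have Ifk : integ A (fun x => f x * k x).
  by apply: (@integM _ _ _ _ (C / e)) => //; exact: measurable_funTS.
have -> : \int[mu]_x (f x * k x) - f a = \int[mu]_(x in A) ((f x - f a) * k x).
  under [RHS]eq_Rintegral do rewrite mulrBl.
  rewrite (Int_sub _ Ifk (integZ _ _ Ik))// Int_scale//.
  by rewrite -(Int_supp kA) k1 mulr1 -(@Int_supp _ A)// => x /kA ->; rewrite mulr0.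
apply: (@le_trans _ _ (\int[mu]_(x in A) (C / e * `|f x - f a|))).
  apply: Int_abs_le => //.
  - apply: measurable_funTS; apply: measurable_funM => //; apply: measurable_funB => //.
    exact: locint_meas.
  - by apply: integZ => //; apply: integ_abs; apply: integB => //; exact: integ_cst.
  - by move=> x _; rewrite normrM mulrC ler_wpM2r.
rewrite Int_scale//; last by apply: integ_abs; apply: integB => //; exact: integ_cst.
apply: (@le_trans _ _ (C / e * (h / C * e))).
  by apply: ler_wpM2l (H _ e0 ed); rewrite divr_ge0// ltW.
by rewrite le_eqVlt; apply/orP; left; apply/eqP; field; rewrite !gt_eqF.
Qed.

Definition bumpat c e x := e^-1 * rho ((x - c) * e^-1).

Lemma bumpat_ge0 c e x : 0 < e -> 0 <= bumpat c e x.
Proof. by move=> e0; rewrite mulr_ge0 ?rho_ge0// invr_ge0 ltW. Qed.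

Lemma bumpat0 c e x : 0 < e -> e < `|x - c| -> bumpat c e x = 0.
Proof.
move=> e0 xc; rewrite /bumpat (rho_Cc _).2 ?mulr0//.
by rewrite normrM normfV (gtr0_norm e0) ltr_pdivlMr// mul1r.
Qed.

Lemma bumpat_smooth c e : smooth (bumpat c e).
Proof. by apply: smoothZ; apply: smooth_aff; exact: (rho_Cc _).1. Qed.

Lemma bumpat_Cc c e : 0 < e -> Cc (bumpat c e) (`|c| + e).
Proof.
move=> e0; split; first exact: bumpat_smooth.
move=> x xc; apply: bumpat0 => //.
have := ler_distD c x 0; rewrite !subr0; lra.
Qed.

Lemma bumpat_int c e : 0 < e -> \int[mu]_x bumpat c e x = 1.
Proof.
move=> e0; rewrite (@Int_supp _ `[c - e, c + e]); last first.
  move=> x xA; apply: bumpat0 => //; rewrite ltNge; apply/negP => xc; apply: xA.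
  by move: xc; rewrite ler_norml /= in_itv/= => /andP[x1 x2]; apply/andP; split; lra.
have ce : c - e <= c + e by lra.
have D x : is_derive x 1 (fun z : R => step ((z - c) * e^-1)) (bumpat c e x).
  by apply: der_rescale; exact: stepD.
rewrite (FTC2 ce D (smooth_cont (@bumpat_smooth c e))).
by rewrite step_sc1// step_sc0// subr0.
Qed.

Lemma rho_bd : exists2 C, 0 < C & forall x, `|rho x| <= C :> R.
Proof.
have [C C0 H] := Cc_bounded (rho_Cc R).
exists (C + 1); first by rewrite ltr_wpDl.
by move=> x; rewrite (le_trans (H x))// lerDl.
Qed.

(** A set of full measure meets [0, 1], which has measure 1. This supplies a Lebesgue point at which
    to anchor a primitive. *)
Lemma ae_ex (P : R -> Prop) : {ae mu, forall x, P x} -> exists x, P x.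
Proof.
move=> aP; apply/not_existsP => H.
have : mu.-negligible (setT : set R).
  by move: aP; apply: (@negligibleS _ _ _ mu) => x _; exact: H.
case=> A [mA A0 TA].
pose J : set R := `[0, 1]%classic.
have : (mu J <= mu A)%E by apply: le_measure; rewrite ?inE//; [exact: measurable_itv|exact: subset_trans TA].
rewrite A0 leNgt => /negP; apply.
rewrite (_ : mu _ = 1%:E) ?lte_fin//.
transitivity (lebesgue_measure J) => //; rewrite /J.
by rewrite lebesgue_measure_itv/= lte_fin ltr01 oppr0 adde0.
Qed.

Lemma prim_cont w c x : (forall a b, integ `[a, b] w) -> c < x ->
  {for x, continuous (fun y => \int[mu]_(t in `[c, y]) w t)}.
Proof.
move=> Iw cx; have cx1 : c < x + 1 by lra.
have xI : x \in `]c, (x + 1)[ by rewrite in_itv/= cx ltrDl ltr01.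
have H := @parameterized_integral_continuous R c (x + 1) w (ltW cx1) (Iw _ _).
exact: (within_continuous_continuous cx1 H xI).
Qed.

Lemma small_left w a : (forall a b, integ `[a, b] w) -> forall h, 0 < h ->
  exists2 d, 0 < d & forall e, 0 < e -> e < d -> \int[mu]_(x in `[a - e, a]) `|w x| <= h.
Proof.
move=> Iw h h0; have Iw' c d : integ `[c, d] (fun x => `|w x|) by exact: integ_abs.
have a1 : a - 1 < a by rewrite ltrBlDr ltrDl.
have /cvgrPdist_le/(_ _ h0)/nbhs_ballP[d /= d0 H] := prim_cont Iw' a1.
exists (Num.min d 1); first by rewrite lt_min d0 ltr01.
move=> e e0; rewrite lt_min => /andP[ed e1].
have := H (a - e); rewrite /ball/= opprB addrCA subrr addr0 gtr0_norm// => /(_ ed).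
rewrite (@Int_cat _ (a - 1) a (a - e))//; [|lra|lra].
by rewrite addrAC subrr add0r; apply: le_trans; exact: ler_norm.
Qed.

Lemma small_right w a : (forall a b, integ `[a, b] w) -> forall h, 0 < h ->
  exists2 d, 0 < d & forall e, 0 < e -> e < d -> \int[mu]_(x in `[a, a + e]) `|w x| <= h.
Proof.
move=> Iw h h0; have Iw' c d : integ `[c, d] (fun x => `|w x|) by exact: integ_abs.
have a1 : a - 1 < a by rewrite ltrBlDr ltrDl.
have /cvgrPdist_le/(_ _ h0)/nbhs_ballP[d /= d0 H] := prim_cont Iw' a1.
exists d => // e e0 ed.
have := H (a + e); rewrite /ball/= opprD addrA subrr add0r normrN gtr0_norm// => /(_ ed).
rewrite (@Int_cat _ (a - 1) (a + e) a)//; [|lra|lra].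
by rewrite distrC addrAC subrr add0r; apply: le_trans; exact: ler_norm.
Qed.

(* Test the weak derivative against a cutoff whose derivative is a bump at [a] minus a bump
   at [b]; at Lebesgue points the bumps recover the values of [f]. *)
Lemma weak_lebpt f g a b : is_weak_derivative f g -> a < b ->
  lebesgue_pt f a -> lebesgue_pt f b -> f b - f a = \int[mu]_(x in `[a, b]) g x.
Proof.
move=> [lf lg fg] ab la lb.
have Ig c d : integ `[c, d] g by exact: locint_itv.
have Ig' c d : integ `[c, d] (fun x => `|g x|) by exact: integ_abs.
have mg := locint_meas lg; have mf := locint_meas lf.
have [C C0 HC] := rho_bd.
have C20 : 0 < 2 * C by rewrite mulr_gt0.
apply/eqP; rewrite -subr_eq0 -normr_le0; apply/ler_addgt0Pl => h h0; rewrite addr0.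
have h4 : 0 < h / 4 by rewrite divr_gt0.
have [d1 d10 H1] := lebpt_approx lf la C20 h4.
have [d2 d20 H2] := lebpt_approx lf lb C20 h4.
have [d3 d30 H3] := small_left a Ig h4.
have [d4 d40 H4] := small_right b Ig h4.
pose d := Num.min (Num.min d1 d2) (Num.min d3 d4).
have d0 : 0 < d by rewrite !lt_min d10 d20 d30.
pose e2 := d / 2; pose e := e2 / 2.
have e20 : 0 < e2 by rewrite divr_gt0.
have e0 : 0 < e by rewrite divr_gt0.
have e2d : e2 < d by rewrite /e2; lra.
have ee2 : e2 = e + e by rewrite /e; lra.
move: e2d; rewrite !lt_min => /andP[/andP[ed1 ed2] /andP[ed3 ed4]].
have cutab : (a - e) + e <= (b + e) - e by rewrite subrK addrK ltW.
have Ct := cut_Cc e0 e0 cutab; have Tc := Cc_test Ct.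
have := fg _ Tc.
have -> : (cut (a - e) e (b + e) e)^`()%classic = dcut (a - e) e (b + e) e.
  by apply/funext => x; apply: der_val; exact: cutD.
have bA c : `|c| = e -> forall a, (forall x, `|bumpat (a + c) e x| <= 2 * C / e2) /\
    (forall x, e2 < `|x - a| -> bumpat (a + c) e x = 0).
  move=> ce a'; split=> x.
    rewrite /bumpat normrM (gtr0_norm (x := e^-1)) ?invr_gt0//.
    rewrite (_ : 2 * C / e2 = e^-1 * C); last by rewrite /e; field; rewrite gt_eqF.
    by rewrite ler_wpM2l// invr_ge0 ltW.
  move=> xa; apply: bumpat0 => //.
  by apply: far_le xa _ => //; rewrite addrAC subrr add0r.
have := H1 e2 e20 ed1 (bumpat (a - e) e).
have := H2 e2 e20 ed2 (bumpat (b + e) e).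
have [] := bA e (gtr0_norm e0) b; have [] := bA (- e) _ a; first by rewrite normrN gtr0_norm.
move=> a1 a2 b1 b2.
move=> /(_ (meas_cont (smooth_cont (@bumpat_smooth _ _))) b1 b2 (bumpat_int _ e0)) Hb.
move=> /(_ (meas_cont (smooth_cont (@bumpat_smooth _ _))) a1 a2 (bumpat_int _ e0)) Ha.
have Ifb c : integ setT (fun x => f x * bumpat c e x).
  have Cb := bumpat_Cc c e0.
  apply: (@integ_supp _ `[- (`|c| + e), `|c| + e]) => //.
    by move=> x /(Cc_supp Cb) ->; rewrite mulr0.
  have [B B0 HB] := Cc_bounded Cb.
  apply: (@integM _ _ _ _ B) => //; first exact: locint_itv.
  exact: measurable_funTS (meas_cont (smooth_cont Cb.1)).
have -> : \int[mu]_x (f x * dcut (a - e) e (b + e) e x) =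
   \int[mu]_x (f x * bumpat (a - e) e x) - \int[mu]_x (f x * bumpat (b + e) e x).
  rewrite -Int_sub//; apply: eq_Rintegral => x _; rewrite /dcut /bumpat; ring.
set A := \int[mu]_x (f x * _) in Ha *; set B := \int[mu]_x (f x * _) in Hb *.
move=> E.
have {}E : `|A - B + \int[mu]_(x in `[a, b]) g x| <= h / 4 + h / 4.
  rewrite E (@Int_supp _ `[a - e2, b + e2]); last first.
    move=> x; rewrite /= in_itv/= => xA.
    have [xa|xa] := leP x (a - e2).
      by rewrite (cut_left e0 e0 cutab) ?mulr0// -addrA -opprD -ee2.
    have [xb|xb] := leP (b + e2) x.
      by rewrite (cut_right e0 e0 cutab) ?mulr0// -addrA -ee2.
    by exfalso; apply: xA; rewrite !ltW.
  have Igc c d' : integ `[c, d'] (fun x => g x * cut (a - e) e (b + e) e x).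
    apply: (@integM _ _ _ _ 1) => //.
      exact: measurable_funTS (meas_cont (smooth_cont Ct.1)).
    by move=> x _; rewrite ger0_norm ?cut_ge0// cut_le1.
  have ae2 : a - e2 <= a by rewrite gerBl ltW.
  have be2 : b <= b + e2 by rewrite lerDl ltW.
  rewrite (Int_cat ae2 (le_trans (ltW ab) be2) (Igc _ _)) (Int_cat (ltW ab) be2 (Igc _ _)).
  have -> : \int[mu]_(x in `[a, b]) (g x * cut (a - e) e (b + e) e x) = \int[mu]_(x in `[a, b]) g x.
    apply: eq_Rintegral => x; rewrite inE/= in_itv/= => /andP[ax xb].
    by rewrite (cut_in e0 e0) ?mulr1// subrK addrK ax.
  rewrite (_ : - (_ + (_ + _)) + _ = - (\int[mu]_(x in `[(a - e2), a]) (g x * cut (a - e) e (b + e) e x) + \int[mu]_(x in `[b, (b + e2)]) (g x * cut (a - e) e (b + e) e x))); last by ring.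
  have cle c d' : `|\int[mu]_(x in `[c, d']) (g x * cut (a - e) e (b + e) e x)| <= \int[mu]_(x in `[c, d']) `|g x|.
    apply: Int_abs_le => //; first exact: integ_meas.
    by move=> x _; rewrite normrM ler_piMr// ger0_norm ?cut_ge0// cut_le1.
  rewrite normrN (le_trans (ler_normD _ _))// lerD// (le_trans (cle _ _))//.
    exact: H3.
  exact: H4.
exact: triangle4 Ha Hb E.
Qed.

(** The primitive of [g] anchored at one Lebesgue point of [f] agrees with [f] at every other
    Lebesgue point, hence almost everywhere. *)
Lemma weak_AC f g : is_weak_derivative f g ->
  exists2 v, AC v g & {ae mu, forall x, f x = v x}.
Proof.
move=> fg; have [lf lg _] := fg.
have Ig c d : integ `[c, d] g by exact: locint_itv.
have al := lebesgue_differentiation lf.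
have [a la] := ae_ex al.
pose v x := if a <= x then f a + \int[mu]_(t in `[a, x]) g t
            else f a - \int[mu]_(t in `[x, a]) g t.
have vE x y : x <= y -> v y - v x = \int[mu]_(t in `[x, y]) g t.
  move=> xy; rewrite /v; have [ax|xa] := leP a x.
    by rewrite (le_trans ax xy) (@Int_cat _ a y x)//; ring.
  have [ay|ya] := leP a y.
    by rewrite (@Int_cat _ x y a)// ?(ltW xa)//; ring.
  by rewrite (@Int_cat _ x a y)// ?(ltW ya)//; ring.
exists v.
  split=> //; [|exact: locint_meas].
  move=> x.
  have x1 : x - 1 < x by rewrite ltrBlDr ltrDl.
  have H0 : {for x, continuous (fun y => v (x - 1) + \int[mu]_(t in `[x - 1, y]) g t)}.
    by apply: cvgD; [exact: cvg_cst|exact: prim_cont].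
  have E0 : v x = v (x - 1) + \int[mu]_(t in `[x - 1, x]) g t by rewrite -vE ?ltW//; ring.
  have /cvgrPdist_le H : v (x - 1) + \int[mu]_(t in `[x - 1, y]) g t @[y --> x] --> v x.
    by rewrite E0; exact: H0.
  apply/cvgrPdist_le => h h0.
  have /nbhs_ballP[d /= d0 Hd] := H _ h0.
  apply/nbhs_ballP; exists (Num.min d 1); first by rewrite /= lt_min d0 ltr01.
  move=> y; rewrite /ball/= lt_min => /andP[xyd xy1].
  have : x - 1 <= y by move: xy1; rewrite ltr_norml => /andP[? ?]; lra.
  by move=> /vE Ey; have := Hd y xyd; rewrite -Ey addrCA subrr addr0.
move: al; apply: ae_impl => x lx; rewrite /v.
have [ax|xa|<-] := ltgtP a x.
- by rewrite -(weak_lebpt fg ax la lx); ring.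
- by rewrite -(weak_lebpt fg xa lx la); ring.
- by rewrite set_itv1 Rintegral_set1 addr0.
Qed.

End weak.

Section H2.
Variable R : realType.
Local Notation mu := (@lebesgue_measure R).
Implicit Types (f g h w k : R -> R) (x y a b c d e r : R).

Lemma integ_Cc_M f k r : measurable_fun setT f -> (forall a b, integ `[a, b] f) ->
  Cc k r -> integ setT (fun x => f x * k x).
Proof.
move=> mf If Ck; apply: (@integ_supp _ `[- r, r]) => //.
  by move=> x /(Cc_supp Ck) ->; rewrite mulr0.
have [B B0 HB] := Cc_bounded Ck.
apply: (@integM _ _ _ _ B) => //.
exact: measurable_funTS (meas_cont (smooth_cont Ck.1)).
Qed.

(** At a Lebesgue point the value of [f] is the limit of its pairings with nonnegative bumps. *)
Lemma test_ge0_ae f : locally_integrable setT f ->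
  (forall k r, Cc k r -> (forall x, 0 <= k x) -> 0 <= \int[mu]_x (f x * k x)) ->
  {ae mu, forall x, 0 <= f x}.
Proof.
move=> lf H; have := lebesgue_differentiation lf; apply: ae_impl => c lc.
rewrite -[leRHS]addr0; apply/ler_addgt0Pr => h h0; rewrite addr0.
have [C C0 HC] := rho_bd R.
have [d d0 Hd] := lebpt_approx lf lc C0 h0.
have d20 : 0 < d / 2 by rewrite divr_gt0.
have := Hd (d / 2) d20 _ (bumpat c (d / 2)).
have -> : d / 2 < d by lra.
move=> /(_ isT (meas_cont (smooth_cont (@bumpat_smooth _ _ _)))).
have bd x : `|bumpat c (d / 2) x| <= C / (d / 2).
  rewrite /bumpat normrM (gtr0_norm (x := (d / 2)^-1)) ?invr_gt0// mulrC.
  by rewrite ler_wpM2r// invr_ge0 ltW.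
move=> /(_ bd (fun x => bumpat0 d20) (bumpat_int c d20)).
have := H _ _ (bumpat_Cc c d20) (fun x => bumpat_ge0 c x d20).
by rewrite ler_norml => ? /andP[? ?]; lra.
Qed.

Lemma test_eq0_ae f : locally_integrable setT f ->
  (forall k r, Cc k r -> \int[mu]_x (f x * k x) = 0) ->
  {ae mu, forall x, f x = 0}.
Proof.
move=> lf H.
have p1 := test_ge0_ae lf (fun k r Ck _ => eq_ind_r (fun z => 0 <= z) (lexx 0) (H k r Ck)).
have p2 : {ae mu, forall x, 0 <= - f x}.
  apply: test_ge0_ae => [|k r Ck _]; first exact: locally_integrableN.
  under eq_Rintegral do rewrite mulNr.
  rewrite Int_opp ?(H _ _ Ck) ?oppr0//; apply: integ_Cc_M Ck; first exact: locint_meas.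
  by move=> a b; exact: locint_itv.
apply: ae_impl (ae_and p1 p2) => x [f0 f0']; apply/eqP; rewrite eq_le f0 andbT.
by rewrite -oppr_ge0.
Qed.

Lemma weak_uniq f g1 g2 : is_weak_derivative f g1 -> is_weak_derivative f g2 ->
  {ae mu, forall x, g1 x = g2 x}.
Proof.
move=> [_ l1 H1] [_ l2 H2].
have := @test_eq0_ae (g1 \- g2) (locally_integrableB l1 l2) _.
suff H k r : Cc k r -> \int[mu]_x ((g1 \- g2) x * k x) = 0.
  by move=> /(_ H); apply: ae_impl => x /= /eqP; rewrite subr_eq0 => /eqP.
move=> Ck; have Tk := Cc_test Ck.
under eq_Rintegral do rewrite /= mulrBl.
rewrite Int_sub//; last 2 first.
- by apply: integ_Cc_M Ck; [exact: locint_meas|move=> a b; exact: locint_itv].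
- by apply: integ_Cc_M Ck; [exact: locint_meas|move=> a b; exact: locint_itv].
have := H1 k Tk; rewrite H2// => /eqP; rewrite eqr_opp => /eqP ->.
by rewrite subrr.
Qed.

Definition L2 f := measurable_fun setT f /\ integ setT (fun x => f x ^+ 2).

Lemma Lfun_L2 f : f \in Lfun mu 2%:E -> L2 f.
Proof.
move=> lf; split; last exact: Lfun2_integrable_sqr.
by move: lf; rewrite inE => /andP[]; rewrite inE.
Qed.

Lemma L2_ae f g : {ae mu, forall x, f x = g x} -> measurable_fun setT g -> L2 f -> L2 g.
Proof.
move=> fg mg [mf If]; split => //; apply: integ_ae If => //.
  exact: measurable_funX.
by move: fg; apply: ae_impl => x ->.
Qed.

Lemma weak_ae f f' g : {ae mu, forall x, f x = f' x} -> locally_integrable setT f' ->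
  is_weak_derivative f g -> is_weak_derivative f' g.
Proof.
move=> ff' lf' [lf lg H]; split => // k /[dup] Tk /H <-.
have [r r0 Ck] := test_Cc Tk.
have mk := meas_cont (smooth_cont (Cc_der Ck).1).
apply: Int_ae => //; [by apply: measurable_funM => //; exact: locint_meas..|].
by move: ff'; apply: ae_impl => x ->.
Qed.

Lemma wderivP f g : is_weak_derivative f g -> is_weak_derivative f (wderiv f).
Proof. by move=> fg; rewrite /wderiv; apply: (xgetPex (cst 0)); exists g. Qed.

Lemma AC_ae f g g' : {ae mu, forall x, g x = g' x} -> measurable_fun setT g' ->
  AC f g -> AC f g'.
Proof.
move=> gg' mg' [cf mg Ig Eg]; split=> //.
- move=> a b; apply: integ_ae (Ig a b) => //; first exact: measurable_funTS.
  by move: gg'; apply: ae_impl => x ->.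
- move=> a b /Eg ->; apply: Int_ae => //; [exact: measurable_funTS..|].
  by move: gg'; apply: ae_impl => x ->.
Qed.

(** [weak_AC] is applied to [f] and to [wderiv f]; the density in the first result is then replaced
    by the continuous representative from the second. Uniqueness of weak derivatives passes from the
    witnesses inside [sobolev] to [wderiv]. *)
Lemma sobolev2P f : sobolev 2 f -> exists vg : (R -> R) * (R -> R),
  [/\ AC vg.1 vg.2, AC vg.2 (wderiv (wderiv f)),
      {ae mu, forall x, f x = vg.1 x}, {ae mu, forall x, wderiv f x = vg.2 x} &
   [/\ L2 vg.1, L2 vg.2, L2 (wderiv (wderiv f)), is_weak_derivative f (wderiv f)
    & is_weak_derivative (wderiv f) (wderiv (wderiv f))]].
Proof.
move=> [/Lfun_L2 Lf [g0 fg0 [/Lfun_L2 Lg0 [w0 gw0 /Lfun_L2 Lw0]]]].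
have fg := wderivP fg0; have gg := weak_uniq fg0 fg.
have [lf lg _] := fg.
have gw := weak_ae gg lg gw0.
have gw' := wderivP gw; have ww := weak_uniq gw gw'.
have [_ lw _] := gw'.
have [v ACv fv] := weak_AC fg; have [g ACg gg'] := weak_AC gw'.
have [cg _ _ _] := ACg; have mg := meas_cont cg.
have [cv _ _ _] := ACv; have mv := meas_cont cv.
exists (v, g); split => //=.
- exact: AC_ae gg' mg ACv.
- split=> //.
  + exact: L2_ae fv mv Lf.
  + by apply: (L2_ae gg') => //; apply: (L2_ae gg) => //; exact: locint_meas.
  + by apply: (L2_ae ww) => //; exact: locint_meas.
Qed.

Lemma weakB f1 f2 g1 g2 : is_weak_derivative f1 g1 -> is_weak_derivative f2 g2 ->
  is_weak_derivative (f1 \- f2) (g1 \- g2).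
Proof.
move=> [l1 k1 H1] [l2 k2 H2]; split; [exact: locally_integrableB..|].
move=> k Tk; have [r r0 Ck] := test_Cc Tk.
have I1 f l : locally_integrable setT f -> Cc l r -> integ setT (fun x => f x * l x).
  by move=> lf; apply: integ_Cc_M; [exact: locint_meas|move=> a b; exact: locint_itv].
under eq_Rintegral do rewrite /= mulrBl.
under [in RHS]eq_Rintegral do rewrite /= mulrBl.
have Ck' := Cc_der Ck.
rewrite (Int_sub _ (I1 _ _ l1 Ck') (I1 _ _ l2 Ck'))// (Int_sub _ (I1 _ _ k1 Ck) (I1 _ _ k2 Ck))//.
by rewrite H1// H2//; ring.
Qed.

Lemma wderivB f1 f2 : is_weak_derivative f1 (wderiv f1) -> is_weak_derivative f2 (wderiv f2) ->
  is_weak_derivative (f1 \- f2) (wderiv (f1 \- f2)) /\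
  {ae mu, forall x, wderiv f1 x - wderiv f2 x = wderiv (f1 \- f2) x}.
Proof.
move=> H1 H2; have H := weakB H1 H2; have H' := wderivP H.
by split=> //; have := weak_uniq H H'; apply: ae_impl.
Qed.

Lemma sobolev_norm_le f (j : 'I_3) e : 0 <= e -> measurable_fun setT (iter j (@wderiv R) f) ->
  (sobolev_norm 2 f < e%:E)%E -> \int[mu]_x (iter j (@wderiv R) f x) ^+ 2 <= e ^+ 2.
Proof.
move=> e0 mj; rewrite /sobolev_norm; set S := (\sum_(i < 3) _)%E => Se.
have S0 : (0 <= S)%E by apply: sume_ge0 => i _; exact: poweR_ge0.
have Se2 : (S <= (e ^+ 2)%:E)%E.
  rewrite leNgt; apply/negP => eS; move: Se; rewrite ltNge => /negP; apply.
  have -> : e%:E = ((e ^+ 2)%:E `^ 2^-1)%E.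
    by rewrite poweR_EFin -powR_mulrn// -powRrM mulfV// powRr1.
  apply: gt0_ler_poweR; rewrite ?invr_ge0// ?in_itv/= ?leey ?andbT//.
  - by rewrite lee_fin sqr_ge0.
  - exact: ltW.
have : ('N[mu]_2%:E[EFin \o iter j (@wderiv R) f] `^ 2 <= S)%E.
  rewrite /S (bigD1 j)//= leeDl// sume_ge0// => i _; exact: poweR_ge0.
rewrite powR_Lnorm// => /le_trans/(_ Se2).
set h := iter j _ f.
have -> : (\int[mu]_x (`|(EFin \o h) x| `^ 2) = \int[mu]_x (h x ^+ 2)%:E)%E.
  by apply: eq_integral => x _; rewrite /= powR_mulrn// real_normK// num_real.
move=> H; rewrite -lee_fin -EFin_Int//.
apply/integrableP; split; first by apply/measurable_EFinP; exact: measurable_funX.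
apply: le_lt_trans (ltry (e ^+ 2)); apply: le_trans H.
rewrite le_eqVlt; apply/orP; left; apply/eqP; apply: eq_integral => x _ /=.
by rewrite ger0_norm// sqr_ge0.
Qed.

End H2.

(** * The Green function and the solution *)

Section pack.
Variable R : realType.
Local Notation mu := (@lebesgue_measure R).
Implicit Types (f g h w k : R -> R) (x y a b c d e r t s : R).

Definition ker x : R := expR (- `|x|).

Lemma ker_bound x : `|ker x| <= 1.
Proof. by rewrite ger0_norm ?expR_ge0// -expR0 ler_expR oppr_le0. Qed.

Lemma ker_lip x y : `|ker x - ker y| <= `|x - y|.
Proof.
wlog xy : x y / `|x| <= `|y|.
  by move=> H; have [/H //|/ltW/H] := leP `|x| `|y|; rewrite distrC (distrC y).
(* The inequality 1 + s <= exp(s) at s = |x| - |y|. *)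
have e1 : ker y >= ker x * (1 + (`|x| - `|y|)).
  have -> : ker y = ker x * expR (`|x| - `|y|).
    by rewrite /ker -expRD; congr expR; ring.
  by rewrite ler_pM2l ?expR_gt0// expR_ge1Dx.
have e2 : ker y <= ker x by rewrite ler_expR lerN2.
rewrite ger0_norm ?subr_ge0//.
apply: (@le_trans _ _ (ker x * (`|y| - `|x|))); first by lra.
apply: (@le_trans _ _ (`|y| - `|x|)).
  by rewrite ler_piMl ?subr_ge0// (le_trans (ler_norm _))// ker_bound.
by rewrite distrC lerB_dist.
Qed.

Lemma lip_cont f c : (forall x y, `|f x - f y| <= c * `|x - y|) -> continuous f.
Proof.
move=> H x; apply/cvgrPdist_le => e e0.
have c0 : 0 < `|c| + 1 by rewrite ltr_wpDl.
apply/nbhs_ballP; exists (e / (`|c| + 1)); first by rewrite /= divr_gt0.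
move=> y; rewrite /ball/= => xy; apply: (le_trans (H _ _)).
apply: (@le_trans _ _ ((`|c| + 1) * `|x - y|)).
  by rewrite ler_wpM2r// (le_trans (ler_norm _))// lerDl.
by rewrite mulrC -ler_pdivlMr// ltW.
Qed.

Lemma ker_cont : continuous ker.
Proof. by apply: (@lip_cont _ 1) => x y; rewrite mul1r ker_lip. Qed.

Lemma ker_meas : measurable_fun setT ker.
Proof. exact: meas_cont ker_cont. Qed.

Lemma GE h x : G h x = 2^-1 * conv ker h x.
Proof. by []. Qed.

Lemma conv_ker_cont h : integ setT h -> continuous (conv ker h).
Proof.
move=> Ih; apply: (@lip_cont _ (\int[mu]_y `|h y|)) => x y.
have I1 z := integ_conv z ker_meas ker_bound Ih.
rewrite -Int_sub// mulrC -Int_scale//; last exact: integ_abs.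
apply: Int_abs_le => //; first by apply: integ_meas; exact: integB.
  by apply: integZ => //; exact: integ_abs.
move=> z _; rewrite -mulrBl normrM ler_wpM2r//.
have -> : x - y = (x - z) - (y - z) by ring.
exact: ker_lip.
Qed.

Lemma G_cont h : integ setT h -> continuous (G h).
Proof.
move=> Ih x; apply: cvgM; first exact: cvg_cst.
exact: (conv_ker_cont Ih).
Qed.

Lemma G_ae h h' : measurable_fun setT h -> measurable_fun setT h' ->
  {ae mu, forall x, h x = h' x} -> G h = G h'.
Proof.
move=> mh mh' hh'; apply/funext => x; rewrite !GE; congr (_ * _).
apply: Int_ae => //.
- by apply: measurable_funM => //; apply: measurableT_comp; [exact: ker_meas|exact: measurable_funB].
- by apply: measurable_funM => //; apply: measurableT_comp; [exact: ker_meas|exact: measurable_funB].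
- by move: hh'; apply: ae_impl => y ->.
Qed.

Definition hsrc b f g x := b / 2 * f x ^+ 2 + (3 - b) / 2 * g x ^+ 2.

(** [bflux] with the derivative as a separate argument, so that a continuous representative of u_x
    can be inserted. *)
Definition flux b f g x := 2^-1 * f x ^+ 2 + G (hsrc b f g) x.

Lemma hsrc_integ b f g : L2 f -> L2 g -> integ setT (hsrc b f g).
Proof. by move=> [_ If] [_ Ig]; apply: integD => //; exact: integZ. Qed.

(* [V t], [D t], [W t] are representatives of u(t), u_x(t), u_xx(t) that satisfy the fundamental
   theorem of calculus everywhere. *)
Record H2sol b (V D W : R -> R -> R) := {
  H2_AC1 : forall t, 0 <= t -> AC (V t) (D t);
  H2_AC2 : forall t, 0 <= t -> AC (D t) (W t);
  H2_V : forall t, 0 <= t -> L2 (V t);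
  H2_D : forall t, 0 <= t -> L2 (D t);
  H2_W : forall t, 0 <= t -> L2 (W t);
  H2_cont : forall t, 0 <= t -> forall e, 0 < e -> exists2 d, 0 < d &
    forall s, 0 <= s -> `|s - t| < d ->
    [/\ \int[mu]_x (V s x - V t x) ^+ 2 <= e,
        \int[mu]_x (D s x - D t x) ^+ 2 <= e &
        \int[mu]_x (W s x - W t x) ^+ 2 <= e];
  H2_eq : forall k r, Cc k r -> forall t, 0 < t ->
    is_derive t 1 (fun s => \int[mu]_x (V s x * k x))
      (\int[mu]_x (flux b (V t) (D t) x * k^`()%classic x)) }.

(** Representatives are chosen separately at each time. Continuity in time survives because [wderiv]
    of a difference is almost everywhere the difference of the [wderiv]s, and the equation survives
    because it sees only almost-everywhere classes. *)
Lemma global_H2sol b u : global_solution b u -> exists VDW : (R -> R -> R) * (R -> R -> R) * (R -> R -> R),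
  H2sol b VDW.1.1 VDW.1.2 VDW.2 /\
  forall t, 0 <= t -> [/\ measurable_fun setT (u t), {ae mu, forall x, u t x = VDW.1.1 t x},
   measurable_fun setT (momentum (u t)) &
   {ae mu, forall x, momentum (u t) x = VDW.1.1 t x - VDW.2 t x}].
Proof.
move=> [cu su].
pose Q t (vg : (R -> R) * (R -> R)) := let f := u t in
  [/\ AC vg.1 vg.2, AC vg.2 (wderiv (wderiv f)),
      {ae mu, forall x, f x = vg.1 x}, {ae mu, forall x, wderiv f x = vg.2 x} &
   [/\ L2 vg.1, L2 vg.2, L2 (wderiv (wderiv f)), is_weak_derivative f (wderiv f)
    & is_weak_derivative (wderiv f) (wderiv (wderiv f))]].
have /choice[F HF] : forall t, exists vg, 0 <= t -> Q t vg.
  move=> t; have [t0|t0] := leP 0 t; last by exists (cst 0, cst 0).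
  by have [/sobolev2P[vg H] _] := cu t t0; exists vg.
pose V t := (F t).1; pose D t := (F t).2; pose W t := wderiv (wderiv (u t)).
have mVD t : 0 <= t -> [/\ measurable_fun setT (V t), measurable_fun setT (D t),
    measurable_fun setT (u t), measurable_fun setT (wderiv (u t)) & measurable_fun setT (W t)].
  move=> t0; have [_ _ _ _ [[mV _] [mD _] [mW _] [lu lD _] _]] := HF _ t0.
  by split=> //; exact: locint_meas.
exists (V, D, W); split=> /=; last first.
  move=> t t0; have [_ _ uV _ _] := HF _ t0; have [mV mD mu' mD' mW] := mVD _ t0; split => //.
    exact: measurable_funB.
  by move: uV; apply: ae_impl => x; rewrite /momentum /V => ->.
split.
- by move=> t t0; have [] := HF _ t0.
- by move=> t t0; have [] := HF _ t0.
- by move=> t t0; have [_ _ _ _ []] := HF _ t0.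
- by move=> t t0; have [_ _ _ _ []] := HF _ t0.
- by move=> t t0; have [_ _ _ _ []] := HF _ t0.
- move=> t t0 e e0.
  have [_ /fine_cvgP[fin /cvgrPdist_lt H]] := cu t t0.
  have ee0 : 0 < Num.sqrt e by rewrite sqrtr_gt0.
  have H3 : \forall s \near within `[0, +oo[ (nbhs t),
      sobolev_norm 2 (u s \- u t) \is a fin_num /\
      `|0 - fine (sobolev_norm 2 (u s \- u t))| < Num.sqrt e.
    by apply: filterI => //; exact: (H _ ee0).
  have [d /= d0 Hd] := proj1 (@nbhs_ballP R R t _) H3.
  exists d => // s s0 st.
  have sb : ball t d s by rewrite /ball/= distrC.
  have sI : s \in `[0, +oo[ by rewrite in_itv/= s0.
  have [fi] := Hd s sb sI; rewrite sub0r normrN => Hlt.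
  have sn : (sobolev_norm 2 (u s \- u t)%R < (Num.sqrt e)%:E)%E.
    by rewrite -(fineK fi) lte_fin (le_lt_trans (ler_norm _)).
  have [_ _ us Ds [_ _ _ u1s u2s]] := HF _ s0; have [_ _ ut Dt [_ _ _ u1t u2t]] := HF _ t0.
  have [mVs mDs mus mds mWs] := mVD _ s0; have [mVt mDt mut mdt mWt] := mVD _ t0.
  have [w1 e1] := wderivB u1s u1t; have [l1 l1' _] := w1.
  (* Linearity of [wderiv] holds only almost everywhere, so the first derivative is replaced by an
     almost everywhere equal function before the second is identified. *)
  have w2' := weak_ae e1 l1' (weakB u2s u2t).
  have w2 := wderivP w2'; have e2 := weak_uniq w2' w2; have [_ l2 _] := w2.
  have se : Num.sqrt e ^+ 2 = e by rewrite sqr_sqrtr// ltW.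
  have m0 : measurable_fun setT (u s \- u t) by exact: measurable_funB.
  have m1 := locint_meas l1'; have m2 := locint_meas l2.
  have s1 := @sobolev_norm_le R (u s \- u t) (@Ordinal 3 0 isT) _ (ltW ee0) m0 sn.
  have s2 := @sobolev_norm_le R (u s \- u t) (@Ordinal 3 1 isT) _ (ltW ee0) m1 sn.
  have s3 := @sobolev_norm_le R (u s \- u t) (@Ordinal 3 2 isT) _ (ltW ee0) m2 sn.
  rewrite se /= in s1 s2 s3.
  split.
  + apply: le_trans s1; rewrite le_eqVlt; apply/orP; left; apply/eqP.
    apply: Int_ae => //; [by apply: measurable_funX; exact: measurable_funB..|].
    by apply: ae_impl (ae_and us ut) => x [-> ->].
  + apply: le_trans s2; rewrite le_eqVlt; apply/orP; left; apply/eqP.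
    apply: Int_ae => //; [by apply: measurable_funX; exact: measurable_funB|exact: measurable_funX|].
    by apply: ae_impl (ae_and e1 (ae_and Ds Dt)) => x [<- [-> ->]].
  + move: s3 m2 e2; set w2f := wderiv (wderiv (u s \- u t)) => s3 m2 e2.
    apply: le_trans s3; rewrite le_eqVlt; apply/orP; left; apply/eqP.
    apply: (Int_ae measurableT _ _ _).
    * by apply: measurable_funX; exact: (measurable_funB mWs mWt).
    * exact: (measurable_funX 2 m2).
    * by apply: ae_impl e2 => x <-.
- move=> k r Ck t t0; have t0' := ltW t0.
  have [mV mD mu' mD' mW] := mVD _ t0'.
  have [_ _ uV uD [LV LD _ _ _]] := HF _ t0'.
  have -> : \int[mu]_x (flux b (V t) (D t) x * k^`()%classic x) =
            \int[mu]_x (bflux b (u t) x * k^`()%classic x).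
    have mk := meas_cont (smooth_cont (Cc_der Ck).1).
    rewrite /bflux (@G_ae _ (hsrc b (V t) (D t))); last 3 first.
    + by apply: measurable_funD; apply: measurable_funM => //; exact: measurable_funX.
    + by apply: measurable_funD; apply: measurable_funM => //; exact: measurable_funX.
    + by apply: ae_impl (ae_and uV uD) => x [ux dx]; rewrite /hsrc ux dx.
    have mG := meas_cont (G_cont (hsrc_integ b LV LD)).
    apply: Int_ae => //.
    + apply: measurable_funM => //; apply: measurable_funD => //.
      by apply: measurable_funM => //; exact: measurable_funX.
    + apply: measurable_funM => //; apply: measurable_funD => //.
      by apply: measurable_funM => //; exact: measurable_funX.
    + by move: uV; apply: ae_impl => x ux _; rewrite /flux ux.
  apply: (@is_derive_near _ (fun s => \int[mu]_x (u s x * k x))); last exact: su (Cc_test Ck) _ t0.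
  near=> s.
  have s0 : 0 <= s by apply/ltW; near: s; exact: lt_nbhsr.
  have [mVs _ mus _ _] := mVD _ s0; have [_ _ us _ _] := HF _ s0.
  have mk := meas_cont (smooth_cont Ck.1).
  apply: Int_ae => //; [exact: measurable_funM..|].
  by move: us; apply: ae_impl => x ->.
Unshelve. all: by end_near. Qed.

End pack.

(** * Spatial estimates *)

Section spatial.
Variable R : realType.
Local Notation mu := (@lebesgue_measure R).
Implicit Types (f g h v w k : R -> R) (x y a b c d e r t s : R).

Lemma AC_derive f f' : AC f f' -> continuous f' -> forall x, is_derive x 1 f (f' x).
Proof.
move=> [cf mf If Ef] cf' x; apply: is_derive_eps => e e0.
have /cvgrPdist_le/(_ _ e0)/nbhs_ballP[d /= d0 Hd] := cf' x.
apply/nbhs_ballP; exists d => //= y; rewrite /ball/= => xy.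
have mff c : measurable_fun setT (fun z => f' z - c) by exact: measurable_funB.
have [xy'|yx] := leP x y.
  have -> : f y - f x - (y - x) * f' x = \int[mu]_(z in `[x, y]) (f' z - f' x).
    by rewrite Int_sub//; [rewrite -Ef// Int_cst_itv//; ring|exact: integ_cst].
  rewrite [X in _ * X]ger0_norm ?subr_ge0//; apply: Int_itv_bound => //; first exact: measurable_funTS.
  move=> z; rewrite /= in_itv/= => /andP[xz zy]; rewrite distrC; apply: Hd.
  rewrite /ball/= distrC ger0_norm ?subr_ge0//; move: xy; rewrite distrC ger0_norm ?subr_ge0//; lra.
have -> : f y - f x - (y - x) * f' x = - \int[mu]_(z in `[y, x]) (f' z - f' x).
  by rewrite Int_sub//; [rewrite -Ef ?ltW// Int_cst_itv ?ltW//; ring|exact: integ_cst].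
rewrite normrN distrC [X in _ * X]ger0_norm ?subr_ge0 ?(ltW yx)//.
apply: Int_itv_bound => //; [exact: ltW|exact: measurable_funTS|].
move=> z; rewrite /= in_itv/= => /andP[xz zy]; rewrite distrC; apply: Hd.
by rewrite /ball/= ger0_norm ?subr_ge0//; move: xy; rewrite ger0_norm ?subr_ge0 ?ltW//; lra.
Qed.

Definition sqnorm f := \int[mu]_x f x ^+ 2.

Lemma sqnorm_ge0 f : 0 <= sqnorm f.
Proof. by apply: Rintegral_ge0 => x _; exact: sqr_ge0. Qed.

Lemma sqnorm_itv f a b : L2 f -> \int[mu]_(x in `[a, b]) f x ^+ 2 <= sqnorm f.
Proof. by move=> [mf If]; apply: Int_subset => // x _; exact: sqr_ge0. Qed.

Lemma L2_itv f a b : L2 f -> integ `[a, b] (fun x => f x ^+ 2).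
Proof. by move=> [mf If]; apply: integS If. Qed.

Lemma L2_itv1 f a b : L2 f -> integ `[a, b] f.
Proof.
move=> Lf; have [mf If] := Lf.
apply: (@integ_le _ _ _ (fun x => 1 + f x ^+ 2)) => //; first exact: measurable_funTS.
  move=> x _; rewrite -(real_normK (num_real (f x))); nra.
by apply: integD => //; [exact: integ_cst|exact: L2_itv].
Qed.

Lemma CS_itv f a b : a <= b -> L2 f ->
  (\int[mu]_(x in `[a, b]) f x) ^+ 2 <= (b - a) * sqnorm f.
Proof.
move=> ab Lf; have [mf If] := Lf.
apply: (le_trans (@CauchySchwarz1 _ _ f (b - a) _ _ _ _ _)) => //.
- exact: integ_cst.
- exact: measurable_funTS.
- exact: L2_itv.
- by rewrite Int_cst_itv// mul1r.
- by apply: ler_wpM2l; [rewrite subr_ge0|exact: sqnorm_itv].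
Qed.

Lemma L2_abs f : L2 f -> L2 (fun x => `|f x|).
Proof.
move=> [mf If]; split; first exact: measurableT_comp.
by apply: eq_integ If => // x _; rewrite real_normK// num_real.
Qed.

Lemma sqnorm_abs f : sqnorm (fun x => `|f x|) = sqnorm f.
Proof. by apply: eq_Rintegral => x _; rewrite real_normK// num_real. Qed.

Lemma L2B f g : L2 f -> L2 g -> L2 (fun x => f x - g x).
Proof.
move=> [mf If] [mg Ig]; split; first exact: measurable_funB.
apply: (@integ_le _ _ _ (fun x => 2 * f x ^+ 2 + 2 * g x ^+ 2)) => //.
- by apply: measurable_funX; exact: measurable_funB.
- by move=> x _; rewrite ger0_norm ?sqr_ge0//; have := sqr_ge0 (f x + g x); nra.
- by apply: integD => //; exact: integZ.
Qed.

Lemma sqnorm_sub f g : L2 f -> L2 g -> sqnorm (fun x => f x - g x) <= 2 * sqnorm f + 2 * sqnorm g.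
Proof.
move=> Lf Lg; have [mf If] := Lf; have [mg Ig] := Lg.
rewrite /sqnorm -!Int_scale// -Int_add//; [|exact: integZ..].
apply: Int_le => //; [exact: (L2B Lf Lg).2|by apply: integD => //; exact: integZ|].
by move=> x _; have := sqr_ge0 (f x + g x); nra.
Qed.

Lemma AC_holder f f' : AC f f' -> L2 f' -> forall x y, (f x - f y) ^+ 2 <= `|x - y| * sqnorm f'.
Proof.
move=> [cf mf If Ef] Lf' x y.
wlog xy : x y / x <= y.
  move=> H; have [/H //|/ltW/H] := leP x y.
  by rewrite distrC -[X in X <= _ -> _]sqrrN opprB.
rewrite -sqrrN opprB Ef// distrC ger0_norm ?subr_ge0//.
exact: CS_itv.
Qed.

(** Compare f(x) with f(y) by [AC_holder] and average over y in [x, x + 1]. *)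
Lemma sup_bound f f' : AC f f' -> L2 f -> L2 f' -> forall x, f x ^+ 2 <= 2 * sqnorm f + 2 * sqnorm f'.
Proof.
move=> ACf Lf Lf' x; have [cf mf If Ef] := ACf.
have x1 : x <= x + 1 by lra.
have <- : \int[mu]_(y in `[x, x + 1]) f x ^+ 2 = f x ^+ 2.
  by rewrite Int_cst_itv// addrAC subrr add0r mulr1.
apply: (@le_trans _ _ (\int[mu]_(y in `[x, x + 1]) (2 * f y ^+ 2 + 2 * sqnorm f'))).
  apply: Int_le => //; first exact: integ_cst.
    by apply: integD => //; [apply: integZ => //; exact: L2_itv|exact: integ_cst].
  move=> y; rewrite /= in_itv/= => /andP[xy yx].
  have := AC_holder ACf Lf' x y; rewrite distrC ger0_norm ?subr_ge0//.
  have : (y - x) * sqnorm f' <= sqnorm f' by rewrite ler_piMl ?sqnorm_ge0//; lra.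
  (* This square is 2 f(y)^2 + 2 (f(x) - f(y))^2 - f(x)^2. *)
  by have := sqr_ge0 (f x - 2 * f y); nra.
rewrite Int_add//; [|apply: integZ => //; exact: L2_itv|exact: integ_cst].
rewrite Int_cst_itv// Int_scale//; last exact: L2_itv.
rewrite [X in _ + X](_ : _ = 2 * sqnorm f'); last by ring.
by rewrite lerD2r ler_wpM2l// sqnorm_itv.
Qed.

(** exp(-|x - y|) is twice the fundamental solution of 1 - d^2/dx^2. On each side of the kink at [y]
    the integrand has an explicit primitive, and the two jumps at [y] add up to 2 k(y). *)
Lemma kerconv k r y : Cc k r ->
  \int[mu]_x (ker (x - y) * (k x - k^`()^`()%classic x)) = 2 * k y.
Proof.
move=> Ck; have Ck1 := Cc_der Ck; have Ck2 := Cc_der Ck1.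
(* Beyond both the support of [k] and the point [y]. *)
pose s := `|r| + `|y| + 1.
have rs : r < s.
  by rewrite /s (le_lt_trans (ler_norm r))// -addrA ltrDl ltr_wpDl.
have ys : - s <= y <= s.
  by rewrite -ler_norml /s addrAC lerDr addr_ge0.
have /andP[sy ys'] := ys.
have ss : - s <= s by lra.
have rns : r < `|s|.
  by apply: (lt_le_trans rs); exact: ler_norm.
have ks : k s = 0 /\ k^`()%classic s = 0 by split; [apply: Ck.2|apply: Ck1.2].
have kns : k (- s) = 0 /\ k^`()%classic (- s) = 0 by split; [apply: Ck.2|apply: Ck1.2]; rewrite normrN.
have ck := smooth_cont Ck.1; have ck1 := smooth_cont Ck1.1; have ck2 := smooth_cont Ck2.1.
have cF (F : R -> R) : continuous F -> continuous (fun x => F x * (k x - k^`()^`()%classic x)).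
  by move=> cF x; apply: cvgM; [exact: cF|apply: cvgB; [exact: ck|exact: ck2]].
have c1 : continuous (fun x => ker (x - y)).
  by move=> x; apply: (@continuous_comp _ _ _ (fun x : R => x - y) (@ker R));
   [apply: cvgB; [exact: cvg_id|exact: cvg_cst]|exact: ker_cont].
rewrite (@Int_supp _ `[- s, s]); last first.
  move=> x; rewrite /= in_itv/= -ler_norml => /negP; rewrite -ltNge => sx.
  by rewrite Ck.2 ?Ck2.2 ?(lt_trans rs)// subrr mulr0.
rewrite (@Int_cat _ (- s) s y)//; last by apply: integ_itv_cont; exact: cF.
have de1 (x : R) : is_derive x 1 (fun x => expR (- (x - y))) (- expR (- (x - y))).
  apply: is_derive_eq (@der_comp _ expR (fun x => - (x - y)) x _ _ (is_derive_expR _) (der_opp (der_sub (der_id x) (der_const x y)))) _.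
  by rewrite subr0 mulrN1.
have de2 (x : R) : is_derive x 1 (fun x => expR (x - y)) (expR (x - y)).
  apply: is_derive_eq (@der_comp _ expR (fun x => x - y) x _ _ (is_derive_expR _) (der_sub (der_id x) (der_const x y))) _.
  by rewrite subr0 mulr1.
have dA (x : R) : is_derive x 1 (fun x => expR (- (x - y)) * (- k^`()%classic x - k x))
    (expR (- (x - y)) * (k x - k^`()^`()%classic x)).
  apply: is_derive_eq (der_mul (de1 x) (der_sub (der_opp (smoothD1 Ck1.1 x)) (smoothD1 Ck.1 x))) _.
  by ring.
have dB' (x : R) : is_derive x 1 (fun x => expR (x - y) * (k x - k^`()%classic x))
    (expR (x - y) * (k x - k^`()^`()%classic x)).
  apply: is_derive_eq (der_mul (de2 x) (der_sub (smoothD1 Ck.1 x) (smoothD1 Ck1.1 x))) _.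
  by ring.
have -> : \int[mu]_(x in `[y, s]) (ker (x - y) * (k x - k^`()^`()%classic x)) =
  \int[mu]_(x in `[y, s]) (expR (- (x - y)) * (k x - k^`()^`()%classic x)).
  apply: eq_Rintegral => x; rewrite inE/= in_itv/= => /andP[yx _].
  by rewrite /ker ger0_norm// subr_ge0.
have -> : \int[mu]_(x in `[- s, y]) (ker (x - y) * (k x - k^`()^`()%classic x)) =
  \int[mu]_(x in `[- s, y]) (expR (x - y) * (k x - k^`()^`()%classic x)).
  apply: eq_Rintegral => x; rewrite inE/= in_itv/= => /andP[_ xy].
  by rewrite /ker ler0_norm ?subr_le0// opprK.
have ce1 := cF _ (deriv_cont de1); have ce2 := cF _ (deriv_cont de2).
rewrite (FTC2 sy dB' ce2) (FTC2 ys' dA ce1) subrr oppr0 expR0.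
by case: ks => -> ->; case: kns => -> ->; ring.
Qed.

Lemma integ_cont_Cc f k r : continuous f -> Cc k r -> integ setT (fun x => f x * k x).
Proof.
move=> cf; apply: integ_Cc_M; first exact: meas_cont.
by move=> a b; exact: integ_itv_cont.
Qed.

(** Fubini moves the kernel onto the test function, where [kerconv] inverts 1 - d^2/dx^2. *)
Lemma G_test h k r : integ setT h -> Cc k r ->
  \int[mu]_x (G h x * (k x - k^`()^`()%classic x)) = \int[mu]_x (h x * k x).
Proof.
move=> Ih Ck; have C2 := CcB Ck (Cc_der (Cc_der Ck)).
have := conv_swap (@ker_meas R) (@ker_bound R) (integ_Cc C2) Ih.
have -> : \int[mu]_y (h y * \int[mu]_x (ker (x - y) * (k x - k^`()^`()%classic x))) =
   2 * \int[mu]_x (h x * k x).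
  rewrite -Int_scale//; last first.
    have [B B0 HB] := Cc_bounded Ck.
    by apply: (@integM _ _ _ _ B) => //; exact: meas_cont (smooth_cont Ck.1).
  by apply: eq_Rintegral => y _; rewrite (kerconv y Ck); ring.
move=> E; apply: (@mulfI _ 2) => //; rewrite -E -Int_scale//; last first.
  by apply: (integ_cont_Cc (G_cont Ih) C2).
by apply: eq_Rintegral => x _; rewrite GE /conv; field.
Qed.

(** The spatial part of m_t + (u m)_x + (b - 1) u_x m = 0 in weak form, with v, g, w for u, u_x,
    u_xx. Testing the flux with the derivative of k - k'' makes [G] disappear. *)
Lemma flux_test b v g w k r : AC v g -> AC g w -> L2 v -> L2 g -> L2 w -> Cc k r ->
  \int[mu]_x (flux b v g x * (k^`()%classic x - k^`()^`()^`()%classic x)) =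
  \int[mu]_x (v x * (v x - w x) * k^`()%classic x)
   - (b - 1) * \int[mu]_x (g x * (v x - w x) * k x).
Proof.
move=> ACv ACg Lv Lg Lw C0.
have C1 := Cc_der C0; set k1 := k^`()%classic in C1 *.
have C2 := Cc_der C1; set k2 := k1^`()%classic in C2 *.
have C3 := Cc_der C2; set k3 := k2^`()%classic in C3 *.
have [cv _ _ _] := ACv; have [cg mw Iw _] := ACg.
have Ih := hsrc_integ b Lv Lg.
have ACk0 : AC k k1 by apply: AC_C1; [exact: smoothD1 C0.1|exact: smooth_cont C1.1].
have ACk1 : AC k1 k2 by apply: AC_C1; [exact: smoothD1 C1.1|exact: smooth_cont C2.1].
have ACk2 : AC k2 k3 by apply: AC_C1; [exact: smoothD1 C2.1|exact: smooth_cont C3.1].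
(* Four integrations by parts reduce all integrals to \int v g k, \int w g k and \int w v k'; no
   derivative of [w] ever appears. *)
have [I1 I1' E1] := AC_ibp (AC_M ACv ACv) ACk2 C2.2 C3.2.
have [I2 I2' E2] := AC_ibp (AC_M ACv ACg) ACk1 C1.2 C2.2.
have [I3 I3' E3] := AC_ibp (AC_M ACv ACv) ACk0 C0.2 C1.2.
have [I4 I4' E4] := AC_ibp (AC_M ACg ACg) ACk0 C0.2 C1.2.
have cM f1 f2 : continuous f1 -> continuous f2 -> continuous (fun x => f1 x * f2 x).
  by move=> h1 h2 x; apply: cvgM; [exact: h1|exact: h2].
have Ivk1 := integ_cont_Cc (cM _ _ cv cv) C1.
have Igk1 := integ_cont_Cc (cM _ _ cg cg) C1.
have Ivgk2 := integ_cont_Cc (cM _ _ cv cg) C2.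
have Ivgk0 := integ_cont_Cc (cM _ _ cv cg) C0.
have Ivw a c : integ `[a, c] (fun x => w x * v x) by exact: integ_itvM.
have Igw a c : integ `[a, c] (fun x => w x * g x) by exact: integ_itvM.
have mv := meas_cont cv; have mg := meas_cont cg.
have Ivwk1 : integ setT (fun x => w x * v x * k1 x) := integ_Cc_M (measurable_funM mw mv) Ivw C1.
have Igwk0 : integ setT (fun x => w x * g x * k x) := integ_Cc_M (measurable_funM mw mg) Igw C0.
have Ivk3 := integ_cont_Cc (cM _ _ cv cv) C3.
have IGk := integ_cont_Cc (G_cont Ih) (CcB C1 C3).
have EG : \int[mu]_x (G (hsrc b v g) x * (k1 x - k3 x)) = \int[mu]_x (hsrc b v g x * k1 x) :=
  G_test Ih C1.
clearbody k1 k2 k3.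
have -> : \int[mu]_x (flux b v g x * (k1 x - k3 x)) =
  2^-1 * \int[mu]_x (v x * v x * k1 x) - 2^-1 * \int[mu]_x (v x * v x * k3 x) +
  \int[mu]_x (hsrc b v g x * k1 x).
  have J1 := integZ 2^-1 measurableT Ivk1; have J3 := integZ 2^-1 measurableT Ivk3.
  rewrite -EG.
  rewrite -(Int_scale _ measurableT Ivk1) -(Int_scale _ measurableT Ivk3).
  rewrite -(Int_sub measurableT J1 J3) -(Int_add measurableT (integB measurableT J1 J3) IGk).
  by apply: eq_Rintegral => x _; rewrite /flux; ring.
have -> : \int[mu]_x (hsrc b v g x * k1 x) =
  b / 2 * \int[mu]_x (v x * v x * k1 x) + (3 - b) / 2 * \int[mu]_x (g x * g x * k1 x).
  rewrite -(Int_scale _ measurableT Ivk1) -(Int_scale _ measurableT Igk1).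
  rewrite -(Int_add measurableT (integZ _ measurableT Ivk1) (integZ _ measurableT Igk1)).
  by apply: eq_Rintegral => x _; rewrite /hsrc; ring.
have -> : \int[mu]_x (v x * (v x - w x) * k1 x) =
  \int[mu]_x (v x * v x * k1 x) - \int[mu]_x (w x * v x * k1 x).
  by rewrite -Int_sub//; apply: eq_Rintegral => x _; ring.
have -> : \int[mu]_x (g x * (v x - w x) * k x) =
  \int[mu]_x (v x * g x * k x) - \int[mu]_x (w x * g x * k x).
  by rewrite -Int_sub//; apply: eq_Rintegral => x _; ring.
have {}E1 : \int[mu]_x (v x * v x * k3 x) = - 2 * \int[mu]_x (v x * g x * k2 x).
  rewrite E1 -(Int_opp measurableT I1') -(Int_scale _ measurableT Ivgk2).
  by apply: eq_Rintegral => x _; ring.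
have {}E2 : \int[mu]_x (v x * g x * k2 x) = - (\int[mu]_x (g x * g x * k1 x) + \int[mu]_x (w x * v x * k1 x)).
  rewrite E2 -(Int_add measurableT Igk1 Ivwk1); congr (- _).
  by apply: eq_Rintegral => x _; ring.
have {}E3 : \int[mu]_x (v x * v x * k1 x) = - 2 * \int[mu]_x (v x * g x * k x).
  rewrite E3 -(Int_opp measurableT I3') -(Int_scale _ measurableT Ivgk0).
  by apply: eq_Rintegral => x _; ring.
have {}E4 : \int[mu]_x (g x * g x * k1 x) = - 2 * \int[mu]_x (w x * g x * k x).
  rewrite E4 -(Int_opp measurableT I4') -(Int_scale _ measurableT Igwk0).
  by apply: eq_Rintegral => x _; ring.
by rewrite E1 E2 E3 E4; field.
Qed.

End spatial.

(** * A renormalized transport estimate *)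

Section beta.
Variable R : realType.
Implicit Types (a c s r q : R).

Definition npart s : R := Num.max (- s) 0.

Lemma npart_ge0 s : 0 <= npart s.
Proof. by rewrite le_max lexx orbT. Qed.

Lemma npart_geN s : - s <= npart s.
Proof. by rewrite le_max lexx. Qed.

Lemma npartE s : (0 <= s /\ npart s = 0) \/ (s < 0 /\ npart s = - s).
Proof.
rewrite /npart; have [s0|s0] := leP 0 s; [left|right]; split=> //.
  by apply/max_idPr; rewrite oppr_le0.
by apply/max_idPl; rewrite oppr_ge0 ltW.
Qed.

Lemma npart_lip a c : `|npart a - npart c| <= `|a - c|.
Proof.
have [[a0 ->]|[a0 ->]] := npartE a; have [[c0 ->]|[c0 ->]] := npartE c.
- by rewrite subrr normr0.
- by rewrite sub0r opprK ltr0_norm// ger0_norm; lra.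
- by rewrite subr0 normrN ltr0_norm// ltr0_norm; lra.
- by rewrite -opprD normrN.
Qed.

(* A C^1 convex function vanishing on [0, +oo[ and growing like the negative part. The bound
   [|dbeta s * s| <= 2 * beta s] lets Gronwall absorb the stretching term of the equation. *)
Definition beta s := npart s - 1 + (1 + npart s)^-1.
Definition dbeta s := (1 + npart s)^-1 ^+ 2 - 1.

Lemma inv_bd r : 0 <= r -> 0 < (1 + r)^-1 <= 1.
Proof.
move=> r0; have r1 : 0 < 1 + r by lra.
by rewrite invr_gt0 r1 invf_le1//; lra.
Qed.

Lemma invE r : 0 <= r -> (1 + r)^-1 * (1 + r) = 1.
Proof. by move=> r0; rewrite mulVf// gt_eqF//; lra. Qed.

(** In terms of the negative parts r of a and q of c, the Taylor remainder is the explicit square (q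
    - r)^2 / ((1 + r)^2 (1 + q)). Passing from q, r back to c, a costs nothing: q + c >= 0, and r +
    a = 0 unless the slope at a vanishes. *)
Lemma beta_convex a c : beta a - beta c <= dbeta a * (a - c).
Proof.
rewrite /beta /dbeta; have r0 := npart_ge0 a; have q0 := npart_ge0 c.
have qc := npart_geN c.
have := invE r0; have := invE q0; have /andP[i0 i1] := inv_bd r0; have /andP[j0 j1] := inv_bd q0.
have ra := npartE a.
set r := npart a in r0 ra i0 i1 *; set q := npart c in q0 qc j0 j1 *.
set i := (1 + r)^-1 in i0 i1 *; set j := (1 + q)^-1 in j0 j1 *.
move=> Ej Ei.
have H : j - i + (q - r) * i ^+ 2 = (q - r) ^+ 2 * i ^+ 2 * j.
  have -> : q = (q * j) + q * (1 - j) by ring.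
  have qj : q * j = 1 - j by rewrite -Ej; ring.
  have ri : r * i = 1 - i by rewrite -Ei; ring.
  have -> : q * j + q * (1 - j) = q by ring.
  have -> : (q - r) ^+ 2 * i ^+ 2 * j = (q * j) * q * i ^+ 2 - 2 * (q * j) * (r * i) * i + (r * i) ^+ 2 * j by ring.
  rewrite qj ri.
  have -> : (1 - j) * q * i ^+ 2 = q * i ^+ 2 - (q * j) * i ^+ 2 by ring.
  have -> : j - i + (q - r) * i ^+ 2 = j - i + q * i ^+ 2 - (r * i) * i by ring.
  by rewrite qj ri; ring.
have H0 : 0 <= (q - r) ^+ 2 * i ^+ 2 * j by rewrite mulr_ge0 ?(ltW j0)// mulr_ge0 ?sqr_ge0.
have i21 : 0 <= 1 - i ^+ 2 by nra.
have H1 : 0 <= (1 - i ^+ 2) * (q + c) by rewrite mulr_ge0//; lra.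
have H2 : (1 - i ^+ 2) * (r + a) = 0.
  case: ra => -[a0 E]; last by rewrite E addNr mulr0.
  have -> : i = 1 by rewrite /i E addr0 invr1.
  by rewrite expr1n subrr mul0r.
nra.
Qed.

Lemma dbeta_bd s : -1 <= dbeta s <= 0.
Proof.
rewrite /dbeta; have /andP[i0 i1] := inv_bd (npart_ge0 s).
by move: i0 i1; set i := (_)^-1 => i0 i1; apply/andP; split; nra.
Qed.

Lemma dbeta_norm s : `|dbeta s| <= 1.
Proof. by have := dbeta_bd s; rewrite ler_norml => /andP[-> /=]; lra. Qed.

Lemma dbeta_lip a c : `|dbeta a - dbeta c| <= 2 * `|a - c|.
Proof.
apply: (@le_trans _ _ (2 * `|npart a - npart c|)); last by rewrite ler_pM2l// npart_lip.
rewrite /dbeta; have r0 := npart_ge0 a; have q0 := npart_ge0 c.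
have := invE r0; have := invE q0; have /andP[i0 i1] := inv_bd r0; have /andP[j0 j1] := inv_bd q0.
move: r0 i0 i1 q0 j0 j1; set r := npart a; set q := npart c; set i := (1 + r)^-1; set j := (1 + q)^-1.
move=> r0 i0 i1 q0 j0 j1 Ej Ei.
have -> : i ^+ 2 - 1 - (j ^+ 2 - 1) = (i - j) * (i + j) by ring.
have -> : i - j = (q - r) * (i * j).
  have -> : (q - r) * (i * j) = (j * (1 + q)) * i - (i * (1 + r)) * j by ring.
  by rewrite Ej Ei; ring.
rewrite !normrM distrC [leRHS]mulrC -mulrA ler_wpM2l//.
rewrite (gtr0_norm i0) (gtr0_norm j0) ger0_norm; last by lra.
have ij : i * j <= 1 by nra.
have ij0 : 0 < i * j by nra.
nra.
Qed.

Lemma dbeta_cont : continuous dbeta.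
Proof. exact: lip_cont dbeta_lip. Qed.

(** The tangent inequalities at both ends squeeze the remainder between 0 and the increment of
    [dbeta] times the step, which is quadratic in the step. *)
Lemma betaD s : is_derive s 1 beta (dbeta s).
Proof.
apply: is_derive_eps => e e0; apply/nbhs_ballP; exists (e / 2); first by rewrite /= divr_gt0.
move=> c; rewrite /ball/= => sc.
have H1 := beta_convex s c; have H2 := beta_convex c s.
have H3 := dbeta_lip c s.
have H0 : 0 <= beta c - beta s - (c - s) * dbeta s by lra.
rewrite ger0_norm//.
apply: (@le_trans _ _ ((dbeta c - dbeta s) * (c - s))); first by lra.
apply: (le_trans (ler_norm _)); rewrite normrM ler_wpM2r//.
by apply: (le_trans H3); rewrite distrC; lra.
Qed.

Lemma beta_ge0 s : 0 <= beta s.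
Proof.
rewrite /beta; have r0 := npart_ge0 s; have := invE r0; have /andP[i0 i1] := inv_bd r0.
move: r0 i0 i1; set r := npart s; set i := (_)^-1 => r0 i0 i1; nra.
Qed.

Lemma beta_le s : beta s <= `|s|.
Proof.
rewrite /beta; have r0 := npart_ge0 s; have /andP[i0 i1] := inv_bd r0.
have : npart s <= `|s|.
  have [[s0 ->]|[s0 ->]] := npartE s => //; by rewrite ltr0_norm.
lra.
Qed.

Lemma beta_pos s : 0 <= s -> beta s = 0.
Proof.
by move=> s0; rewrite /beta; have [[_ ->]|[? _]] := npartE s; [rewrite addr0 invr1; ring|lra].
Qed.

Lemma dbeta_mul s : `|dbeta s * s| <= 2 * beta s.
Proof.
rewrite /beta /dbeta; have r0 := npart_ge0 s; have := invE r0; have /andP[i0 i1] := inv_bd r0.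
have rs := npartE s.
move: r0 i0 i1 rs; set r := npart s; set i := (1 + r)^-1 => r0 i0 i1 rs Ei.
case: rs => -[s0 E].
  have -> : i = 1 by rewrite /i E addr0 invr1.
  by rewrite E expr1n subrr mul0r normr0; lra.
have -> : s = - r by rewrite E opprK.
have -> : (i ^+ 2 - 1) * - r = (1 - i ^+ 2) * r by ring.
have i2 : 0 <= 1 - i ^+ 2 by nra.
rewrite ger0_norm ?mulr_ge0//.
have ri : r * i = 1 - i by rewrite -Ei; ring.
have -> : (1 - i ^+ 2) * r = r - (r * i) * i by ring.
rewrite ri; nra.
Qed.

(** [beta] equals r^2 / (1 + r) with r the negative part: quadratic for small r, so r <= e is
    conceded, while for r > e one has r / (1 + r) >= e / (1 + e). *)
Lemma npart_le s e : 0 < e -> npart s <= e + (1 + e) / e * beta s.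
Proof.
move=> e0; rewrite /beta; have r0 := npart_ge0 s; have := invE r0; have /andP[i0 i1] := inv_bd r0.
move: r0 i0 i1; set r := npart s; set i := (1 + r)^-1 => r0 i0 i1 Ei.
have B : r - 1 + i = r * (r * i).
  have ri : r * i = 1 - i by rewrite -Ei; ring.
  have E : r * (1 - i) = r - r * i by ring.
  by rewrite ri E ri; ring.
rewrite B; have [re|er] := leP r e.
  have : 0 <= (1 + e) / e * (r * (r * i)) by apply: mulr_ge0; [apply: divr_ge0; lra|rewrite mulr_ge0// mulr_ge0// ltW].
  lra.
have : r <= (1 + e) / e * (r * (r * i)); last by lra.
rewrite mulrAC ler_pdivlMr// mulrC.
have -> : (1 + e) * (r * (r * i)) = r * ((1 + e) * (r * i)) by ring.
rewrite [e * r]mulrC ler_wpM2l//.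
have ri : r * i = 1 - i by rewrite -Ei; ring.
rewrite ri.
have : i * (1 + e) <= i * (1 + r) by rewrite ler_wpM2l ?ltW//; lra.
by rewrite Ei; lra.
Qed.

End beta.

Lemma sum_ineq (R : realType) (I1 I2 I3 A B P Q S S' c : R) :
  - I2 <= A + B -> - I1 + I2 - c * I3 <= P + Q + S -> S <= S' ->
  - I1 - c * I3 <= A + P + B + Q + S'.
Proof. by move=> *; lra. Qed.

(** The integrand of the renormalized estimate. [Bx] stands for chi times [dbeta] of the mollified
    momentum [c]; [X1] and [X4] are mollified products. Replacing them by v X2 + g X3 and g c costs
    two commutators, replacing [X3] by [c] costs the zero-mean error, and what remains is - b g Bx
    c, which [beta] itself controls. *)
Lemma pointwise_ineq (R : realType) (Bx X1 X2 X3 X4 v g c b D S N K : R) :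
  `|Bx * c| <= 2 * N -> `|g| <= K -> 0 <= S -> `|Bx| <= 1 ->
  `|X4 - g * c| <= D * S -> `|X1 - v * X2 - g * X3| <= D * S ->
  - (Bx * X1) + Bx * (v * X2) - (b - 1) * (Bx * X4) <=
  2 * `|b| * K * N + K * `|X3 - c| + (1 + `|b - 1|) * D * S.
Proof.
move=> hb gK S0 Bb H0 H1.
have -> : - (Bx * X1) + Bx * (v * X2) - (b - 1) * (Bx * X4) =
    - (Bx * (X1 - v * X2 - g * X3)) - (b - 1) * (Bx * (X4 - g * c))
    - b * (g * (Bx * c)) - Bx * (g * (X3 - c)) by ring.
have a1 : `|Bx * (X1 - v * X2 - g * X3)| <= D * S.
  by rewrite normrM -[leRHS]mul1r; apply: ler_pM.
have a2 : `|(b - 1) * (Bx * (X4 - g * c))| <= `|b - 1| * (D * S).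
  by rewrite normrM ler_wpM2l// normrM -[leRHS]mul1r; apply: ler_pM.
have a3 : `|b * (g * (Bx * c))| <= `|b| * (K * (2 * N)).
  by rewrite normrM ler_wpM2l// normrM; apply: ler_pM.
have a4 : `|Bx * (g * (X3 - c))| <= K * `|X3 - c|.
  rewrite normrM -[leRHS]mul1r; apply: ler_pM => //.
  by rewrite normrM ler_wpM2r.
have -> : (1 + `|b - 1|) * D * S = D * S + `|b - 1| * (D * S) by ring.
have -> : 2 * `|b| * K * N = `|b| * (K * (2 * N)) by ring.
move: a1 a2 a3 a4; rewrite !ler_norml => /andP[p1 _] /andP[p2 _] /andP[p3 _] /andP[p4 _].
lra.
Qed.

(** * The commutator estimate *)

Section key.
Variable R : realType.
Local Notation mu := (@lebesgue_measure R).
Implicit Types (h : R -> R) (x y z : R).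

Definition near_ind e z : R := \1_(`[- e, e]%classic : set R) z.

Lemma near_indE e z : near_ind e z = if `|z| <= e then 1 else 0.
Proof.
rewrite /near_ind indicE; case: ifPn => ze.
  by rewrite mem_set//= in_itv/= -ler_norml.
by rewrite memNset//= in_itv/= -ler_norml; exact/negP.
Qed.

Lemma near_ind_meas e : measurable_fun setT (near_ind e).
Proof. by apply: measurable_indic; exact: measurable_itv. Qed.

Lemma near_ind_bd e z : `|near_ind e z| <= 1.
Proof. by rewrite near_indE; case: ifP; rewrite ?normr1// normr0. Qed.

(** The mass of |h| within distance e of the point: a common majorant for convolutions with kernels
    of width e, whose integral over any interval is at most 2 e times the L^1 norm of [h]. *)
Definition smear e h := conv (near_ind e) (fun y => `|h y|).

Lemma integ_ind (a b : R) : integ setT (\1_(`[a, b]%classic : set R)).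
Proof. exact: integrable_indic_itv. Qed.

Lemma Int_ind (a b : R) h : \int[mu]_x (\1_(`[a, b]%classic : set R) x * h x) =
  \int[mu]_(x in `[a, b]) h x.
Proof.
rewrite [RHS]Rintegral_mkcond; apply: eq_Rintegral => x _.
rewrite patchE indicE; case: ifP => _; first by rewrite mul1r.
by rewrite mul0r.
Qed.

Lemma smear_int e h (a b : R) : 0 < e -> integ setT h ->
  integ `[a, b] (smear e h) /\
  \int[mu]_(x in `[a, b]) smear e h x <= 2 * e * \int[mu]_y `|h y|.
Proof.
move=> e0 Ih; have Iah := integ_abs Ih.
have I1 := integ_conv_swap (near_ind_meas e) (near_ind_bd e) (integ_ind a b) Iah.
split.
  have := integS measurableT (measurable_itv `[a, b]) (@subsetT _ _) I1.
  apply: eq_integ; first exact: measurable_itv.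
  by move=> x xab; rewrite indicE mem_set// mul1r.
rewrite -Int_ind (conv_swap (near_ind_meas e) (near_ind_bd e) (integ_ind a b) Iah).
have E y : \int[mu]_x (near_ind e (x - y) * \1_(`[a, b]%classic : set R) x) <= 2 * e.
  have Iy : integ setT (fun x => near_ind e (x - y)).
    apply: (@integ_supp _ `[y - e, y + e]) => //.
      move=> x; rewrite near_indE; case: ifP => // + H; rewrite ler_norml => /andP[x1 x2].
      by exfalso; apply: H; rewrite /= in_itv/=; apply/andP; split; lra.
    apply: (@integ_le _ _ _ (fun=> 1)) => //; last exact: integ_cst.
      by apply: measurable_funTS; apply: measurableT_comp; [exact: near_ind_meas|exact: measurable_funB].
    by move=> x _; exact: near_ind_bd.
  apply: (@le_trans _ _ (\int[mu]_x near_ind e (x - y))).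
    apply: Int_le => //.
      by apply: (@integM _ _ _ _ 1) => // x _; rewrite indicE; case: (x \in (`[a, b]%classic : set R)); rewrite ?normr1 ?normr0.
    move=> x _; rewrite near_indE indicE.
    by case: ifP => _; case: (x \in (`[a, b]%classic : set R)); rewrite /= ?mulr1 ?mulr0 ?mul0r ?ler01.
  rewrite (@Int_supp _ `[y - e, y + e]); last first.
    move=> x; rewrite near_indE; case: ifP => // + H; rewrite ler_norml => /andP[x1 x2].
    by exfalso; apply: H; rewrite /= in_itv/=; apply/andP; split; lra.
  apply: (@le_trans _ _ (\int[mu]_(x in `[y - e, y + e]) 1)).
    apply: Int_le => //; [by apply: integS Iy|exact: integ_cst|].
    by move=> x _; rewrite (le_trans (ler_norm _))// near_ind_bd.
  by rewrite Int_cst_itv; lra.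
rewrite [leRHS](_ : _ = \int[mu]_x (`|h x| * (2 * e))); last first.
  by rewrite -Int_scale//; apply: eq_Rintegral => x _; rewrite mulrC.
apply: Int_le => //.
- have := integ_conv_swap (near_ind_meas e) (near_ind_bd e) Iah (integ_ind a b).
  apply: eq_integ => // y _; congr (_ * _); apply: eq_Rintegral => x _.
  by rewrite !near_indE distrC.
- by have := integZ (2 * e) measurableT Iah; apply: eq_integ => // x _; rewrite mulrC.
- by move=> y _; apply: ler_wpM2l.
Qed.

Lemma smear_bound (e M : R) h (H : R -> R) x : 0 <= M -> integ setT h ->
  measurable_fun setT H -> (forall y, `|H y| <= M * (near_ind e (x - y) * `|h y|)) ->
  `|\int[mu]_y H y| <= M * smear e h x.
Proof.
move=> M0 Ih mH HH; have Iah := integ_abs Ih.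
rewrite /smear /conv -Int_scale//; last exact: (integ_conv x (near_ind_meas e) (near_ind_bd e) Iah).
apply: Int_abs_le => //.
by apply: integZ => //; exact: (integ_conv x (near_ind_meas e) (near_ind_bd e) Iah).
Qed.

Lemma conv_smear (e M : R) (k h : R -> R) x : 0 <= M -> measurable_fun setT k -> integ setT h ->
  (forall z, `|k z| <= M) -> (forall z, e < `|z| -> k z = 0) ->
  `|conv k h x| <= M * smear e h x.
Proof.
move=> M0 mk Ih kM k0; apply: smear_bound => //.
  apply: measurable_funM; last exact: integ_meas.
  by apply: measurableT_comp => //; exact: measurable_funB.
move=> y; rewrite normrM mulrA ler_wpM2r// near_indE; have [z|z] := leP `|x - y| e.
  by rewrite mulr1 kM.
by rewrite k0// normr0 mulr0.
Qed.

Lemma conv_L1 (e M : R) (k h : R -> R) (a b : R) : 0 < e -> 0 <= M -> continuous k -> continuous (conv k h) -> integ setT h ->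
  (forall z, `|k z| <= M) -> (forall z, e < `|z| -> k z = 0) ->
  \int[mu]_(x in `[a, b]) `|conv k h x| <= 2 * e * M * \int[mu]_y `|h y|.
Proof.
move=> e0 M0 ck cc Ih kM k0; have [Is Hs] := smear_int a b e0 Ih.
apply: (@le_trans _ _ (\int[mu]_(x in `[a, b]) (M * smear e h x))).
  apply: Int_le => //; [by apply: integ_abs; exact: integ_itv_cont|exact: integZ|].
  by move=> x _; apply: conv_smear => //; exact: meas_cont.
rewrite Int_scale//; apply: (le_trans (ler_wpM2l M0 Hs)).
by rewrite le_eqVlt; apply/orP; left; apply/eqP; ring.
Qed.

Variables (v g f chi k k' : R -> R) (b K om e C r c1 : R).
Hypotheses (dv : forall x, is_derive x 1 v (g x)) (cg : continuous g).
Hypotheses (vK : forall x, `|v x| <= K) (gK : forall x, `|g x| <= K).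
Hypothesis gmod : forall x y, `|x - y| <= e -> `|g x - g y| <= om.
Hypothesis If : integ setT f.
Hypotheses (Cchi : Cc chi r) (chi01 : forall x, 0 <= chi x <= 1).
Hypothesis dchi : forall x, `|chi^`()%classic x| <= c1.
Hypotheses (e0 : 0 < e) (Ck : Cc k e) (Ck' : Cc k' e) (C0 : 0 <= C).
Hypothesis dk : forall x, is_derive x 1 k (k' x).
Hypothesis kC : forall z, `|k z| <= C / e.
Hypothesis dkC : forall z, `|k' z| <= C / e ^+ 2.

Let c := conv k f.
Definition Bfun x := chi x * dbeta (c x).
(** The kernel left by the first-order term in the expansion of [v], since k'(x - y) (y - x) = sgm(x
    - y). Integration by parts gives it the same integral as [k]. *)
Definition sgm z := - (z * k' z).
(* The differential at [f] of h |-> \int chi * beta (conv k h), as a test function. *)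
Definition psi y := \int[mu]_x (k (x - y) * Bfun x).

Let kE : k^`()%classic = k'.
Proof. by apply/funext => x; exact: der_val. Qed.

Let cD x h : integ setT h -> is_derive x 1 (conv k h) (conv k' h x).
Proof. by move=> Ih; rewrite -kE; exact: conv_CcD Ck Ih. Qed.

Lemma sgm_Cc : Cc sgm e.
Proof.
have [s0 z0] := Ck'; split; last by move=> x /z0; rewrite /sgm => ->; rewrite mulr0 oppr0.
have -> : sgm = fun z => -1 * (z * k' z) by apply/funext => z; rewrite mulN1r.
apply: smoothZ; apply: smoothM; last exact: s0.
apply: (smooth_coind (S := fun h => h = (fun z => z) \/ smooth h)); last by left.
move=> h [->|sh]; first by exists (fun=> 1); [right; exact: smooth_cst|move=> x; exact: der_id].
by exists (h^`())%classic; [right; exact: smooth_der|exact: smoothD1].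
Qed.

Let cv : continuous v := deriv_cont dv.

Lemma conv_c h q : Cc q e -> integ setT h -> continuous (conv q h).
Proof. by move=> Cq Ih; apply: smooth_cont; exact: conv_smooth Cq Ih. Qed.

Let cc : continuous c := conv_c Ck If.

Let cM (f1 f2 : R -> R) : continuous f1 -> continuous f2 -> continuous (fun x => f1 x * f2 x).
Proof. by move=> h1 h2 x; apply: cvgM; [exact: h1|exact: h2]. Qed.

Lemma Bfun_cont : continuous Bfun.
Proof.
apply: cM; first exact: smooth_cont Cchi.1.
by move=> x; apply: (@continuous_comp _ _ _ c (@dbeta R)); [exact: cc|exact: dbeta_cont].
Qed.

Lemma Bfun0 x : r < `|x| -> Bfun x = 0.
Proof. by move=> /Cchi.2; rewrite /Bfun => ->; rewrite mul0r. Qed.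

Lemma Bfun_bd x : `|Bfun x| <= 1.
Proof.
rewrite normrM; have /andP[h0 h1] := chi01 x; rewrite ger0_norm//.
by rewrite mulr_ile1// dbeta_norm.
Qed.

Lemma Bfun_integ : integ setT Bfun.
Proof. exact: integ_cont_supp Bfun_cont Bfun0. Qed.

Let kc z := k ((z - 0) * -1).

Lemma psiE : psi = conv kc Bfun.
Proof.
apply/funext => y; apply: eq_Rintegral => x _; congr (k _ * _); ring.
Qed.

Lemma kc_Cc : Cc kc e.
Proof.
split; first by apply: smooth_aff; exact: Ck.1.
by move=> x ex; apply: Ck.2; rewrite subr0 mulrN1 normrN.
Qed.

Lemma psi_Cc : Cc psi (e + r).
Proof. by rewrite psiE; exact: conv_Cc kc_Cc Bfun_integ Bfun0. Qed.

Lemma dpsiE y : psi^`()%classic y = - \int[mu]_x (k' (x - y) * Bfun x).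
Proof.
rewrite psiE (der_val (conv_CcD y kc_Cc Bfun_integ)) -Int_opp//; last first.
  have [M M0 HM] := Cc_bounded Ck'.
  by apply: (integ_convr y _ HM Bfun_integ); exact: meas_cont (smooth_cont Ck'.1).
apply: eq_Rintegral => x _.
rewrite (der_val (der_rescale 0 (-1) (y - x) dk)).
by rewrite (_ : (y - x - 0) * -1 = x - y); [rewrite mulN1r mulNr|ring].
Qed.

Lemma integ_cM h : continuous h -> (exists M, forall x, `|h x| <= M) -> integ setT (fun x => h x * f x).
Proof. by move=> ch [M HM]; apply: (@integMl _ _ _ _ M) => //; exact: meas_cont. Qed.

Lemma pair_k q h : Cc q e -> integ setT h ->
  \int[mu]_y (h y * \int[mu]_x (q (x - y) * Bfun x)) =
  \int[mu]_x (Bfun x * conv q h x).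
Proof.
move=> Cq Ih; have [M M0 HM] := Cc_bounded Cq.
by rewrite (conv_swap (meas_cont (smooth_cont Cq.1)) HM Bfun_integ Ih).
Qed.

Let J : set R := `[- r, r]%classic.
Let mJ : measurable J.
Proof. exact: measurable_itv. Qed.

Lemma outJ x : ~ J x -> r < `|x|.
Proof. by rewrite /J/= in_itv/= -ler_norml => /negP; rewrite -ltNge. Qed.

Lemma B_J h : \int[mu]_x (Bfun x * h x) = \int[mu]_(x in J) (Bfun x * h x).
Proof. by apply: Int_supp => x /outJ/Bfun0 ->; rewrite mul0r. Qed.

Lemma integ_J h : continuous h -> integ J h.
Proof. exact: integ_itv_cont. Qed.

(* [Bfun * conv k' f] is [chi] times the derivative of [beta (conv k f)]: an integration by
   parts moves that derivative onto [chi * v]. *)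
Lemma transport : - (\int[mu]_(x in J) (Bfun x * (v x * conv k' f x))) <=
  K * \int[mu]_x (chi x * beta (c x)) + c1 * K * \int[mu]_(x in J) `|c x|.
Proof.
have dc x : is_derive x 1 c (conv k' f x) := cD x If.
have cc' := conv_c Ck' If.
have dbc x : is_derive x 1 (fun x => beta (c x)) (dbeta (c x) * conv k' f x).
  exact: (@der_comp _ (@beta R) c x _ _ (betaD _) (dc x)).
have cbc : continuous (fun x => beta (c x)) := deriv_cont dbc.
have cdb : continuous (fun x => dbeta (c x)).
  by move=> x; apply: (@continuous_comp _ _ _ c (@dbeta R)); [exact: cc|exact: dbeta_cont].
have cchi := smooth_cont Cchi.1; have cchi' := smooth_cont (Cc_der Cchi).1.
have cchiv' : continuous (fun x => chi^`()%classic x * v x + chi x * g x).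
  by move=> x; apply: cvgD; [exact: cM cchi' cv _|exact: cM cchi cg _].
have AC1 := AC_C1 dbc (cM cdb cc').
have AC2 : AC (fun x => chi x * v x) (fun x => chi^`()%classic x * v x + chi x * g x).
  by apply: AC_C1 cchiv' => x; exact: der_mul (smoothD1 Cchi.1 x) (dv x).
have [||_ _ E] := AC_ibp (r := r) AC1 AC2.
- by move=> x /Cchi.2 ->; rewrite mul0r.
- by move=> x rx; rewrite Cchi.2// (Cc_der Cchi).2// !mul0r addr0.
have -> : - (\int[mu]_(x in J) (Bfun x * (v x * conv k' f x))) =
  \int[mu]_x (beta (c x) * (chi^`()%classic x * v x + chi x * g x)).
  rewrite E -B_J; congr (- _); apply: eq_Rintegral => x _; rewrite /Bfun; ring.
have IchiB : integ J (fun x => chi x * beta (c x)) := integ_J (cM cchi cbc).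
rewrite (@Int_supp _ J); last first.
  by move=> x /outJ rx; rewrite Cchi.2// (Cc_der Cchi).2// !mul0r addr0 mulr0.
rewrite [X in K * X](@Int_supp _ J); last by move=> x /outJ/Cchi.2 ->; rewrite mul0r.
have Iac : integ J (fun x => `|c x|) by apply: integ_abs; exact: integ_J.
rewrite -!Int_scale// -Int_add//; [|exact: integZ..].
apply: Int_le => //.
- exact: integ_J (cM cbc cchiv').
- by apply: integD => //; exact: integZ.
move=> x _; have b0 := beta_ge0 (c x); have bc := beta_le (c x).
have /andP[h0 h1] := chi01 x.
have := dchi x; have := vK x; have := gK x.
set B := beta _ in b0 bc *; set X := chi^`()%classic x; set h := chi x in h0 h1 *.
move=> gk vk Xc.
have K0 : 0 <= K by exact: le_trans vk.
have c10 : 0 <= c1 by exact: le_trans Xc.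
rewrite mulrDr addrC; apply: lerD.
  have -> : B * (h * g x) = (h * B) * g x by ring.
  rewrite [leRHS]mulrC; apply: ler_wpM2l; first exact: mulr_ge0.
  by rewrite (le_trans (ler_norm _)).
apply: (@le_trans _ _ (`|B| * (c1 * K))).
  rewrite (le_trans (ler_norm _))// normrM ler_wpM2l// normrM.
  by apply: ler_pM.
by rewrite [leRHS]mulrC (ger0_norm b0) ler_wpM2r// mulr_ge0.
Qed.

(* The DiPerna-Lions commutator; freezing the transport velocity [v] costs only the oscillation
   [om] of its derivative at the scale [e] of the mollifier. *)
Lemma commutator x :
  `|conv k' (fun y => v y * f y) x - v x * conv k' f x - g x * conv sgm f x|
   <= C * om / e * smear e f x.
Proof.
have [M M0 HM] := Cc_bounded Ck'; have [M2 M20 HM2] := Cc_bounded sgm_Cc.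
have mk := meas_cont (smooth_cont Ck'.1); have ms := meas_cont (smooth_cont sgm_Cc.1).
have Iv : integ setT (fun y => v y * f y) by apply: integ_cM => //; exists K.
have I1 := integ_conv x mk HM Iv; have I2 := integ_conv x mk HM If.
have I3 := integ_conv x ms HM2 If.
have om0 : 0 <= om by apply: le_trans (normr_ge0 _) (gmod (x := 0) (y := 0) _); rewrite subrr normr0; exact: ltW.
have J2 := integZ (v x) measurableT I2; have J3 := integZ (g x) measurableT I3.
rewrite /conv -(Int_scale (v x) measurableT I2) -(Int_scale (g x) measurableT I3).
rewrite -(Int_sub measurableT I1 J2) -(Int_sub measurableT (integB measurableT I1 J2) J3).
apply: smear_bound => //.
- by rewrite divr_ge0 ?(ltW e0)// mulr_ge0.
- by apply: integ_meas; apply: integB => //; exact: integB.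
move=> y.
have -> : k' (x - y) * (v y * f y) - v x * (k' (x - y) * f y) - g x * (sgm (x - y) * f y) =
  k' (x - y) * (v y - v x - (y - x) * g x) * f y by rewrite /sgm; ring.
rewrite normrM mulrA ler_wpM2r// near_indE; have [xy|xy] := leP `|x - y| e; last first.
  by rewrite Ck'.2// mul0r normr0 mulr0.
rewrite mulr1 normrM.
apply: (@le_trans _ _ (C / e ^+ 2 * (om * e))); last first.
  by rewrite le_eqVlt; apply/orP; left; apply/eqP; field; rewrite gt_eqF.
apply: ler_pM => //.
(* By the mean value theorem the expansion error is (y - x) (g(z) - g(x)) with z within e of x,
   hence at most e times [om]. *)
have [z z1 z2] : exists2 z, `|x - z| <= e & v y - v x = (y - x) * g z.
  have cvT (p q : R) : {within `[p, q], continuous v} by exact: continuous_subspaceT.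
  have [xy'|yx|->] := ltgtP x y.
  - have [z zI E] := MVT xy' (fun u _ => dv u) (cvT _ _).
    exists z; last by rewrite E mulrC.
    move: zI xy; rewrite in_itv/= => /andP[? ?]; rewrite !ler_norml => /andP[? ?].
    by apply/andP; split; lra.
  - have [z zI E] := MVT yx (fun u _ => dv u) (cvT _ _).
    exists z; last by rewrite -[LHS]opprB E; ring.
    move: zI xy; rewrite in_itv/= => /andP[? ?]; rewrite !ler_norml => /andP[? ?].
    by apply/andP; split; lra.
  - by exists y; rewrite ?subrr ?normr0 ?mul0r// ltW.
rewrite z2 -mulrBr normrM mulrC; apply: ler_pM => //; last by rewrite distrC.
by rewrite distrC gmod.
Qed.

Lemma commutator0 x :
  `|conv k (fun y => g y * f y) x - g x * c x| <= C * om / e * smear e f x.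
Proof.
have [M M0 HM] := Cc_bounded Ck.
have mk := meas_cont (smooth_cont Ck.1).
have Iv : integ setT (fun y => g y * f y) by apply: integ_cM => //; exists K.
have I1 := integ_conv x mk HM Iv; have I2 := integ_conv x mk HM If.
have om0 : 0 <= om by apply: le_trans (normr_ge0 _) (gmod (x := 0) (y := 0) _); rewrite subrr normr0; exact: ltW.
have J2 := integZ (g x) measurableT I2.
rewrite /c /conv -(Int_scale (g x) measurableT I2) -(Int_sub measurableT I1 J2).
apply: smear_bound => //.
- by rewrite divr_ge0 ?(ltW e0)// mulr_ge0.
- by apply: integ_meas; exact: integB.
move=> y.
have -> : k (x - y) * (g y * f y) - g x * (k (x - y) * f y) =
  k (x - y) * (g y - g x) * f y by ring.
rewrite normrM mulrA ler_wpM2r// near_indE; have [xy|xy] := leP `|x - y| e; last first.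
  by rewrite Ck.2// mul0r normr0 mulr0.
rewrite mulr1 normrM mulrAC; apply: ler_pM => //.
by rewrite distrC gmod.
Qed.

(** With f = m the left side is the weak right-hand side of the momentum equation tested with [psi].
    On the right stand, in order, the Gronwall term, the cost of the cutoff, the error of the
    zero-mean kernel sgm - k, and the commutators. *)
Theorem renormalized_bound :
  \int[mu]_y (v y * f y * psi^`()%classic y) - (b - 1) * \int[mu]_y (g y * f y * psi y) <=
  (K + 2 * `|b| * K) * \int[mu]_x (chi x * beta (c x)) +
  c1 * K * \int[mu]_(x in J) `|c x| +
  K * \int[mu]_(x in J) `|conv (fun z => sgm z - k z) f x| +
  2 * C * (1 + `|b - 1|) * om * \int[mu]_y `|f y|.
Proof.
have Ivf : integ setT (fun y => v y * f y) by apply: integ_cM => //; exists K.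
have Igf : integ setT (fun y => g y * f y) by apply: integ_cM => //; exists K.
have E1 : \int[mu]_y (v y * f y * psi^`()%classic y) =
   - (\int[mu]_(x in J) (Bfun x * conv k' (fun y => v y * f y) x)).
  rewrite -B_J -(pair_k Ck' Ivf); apply: (canRL (@opprK _)); rewrite -Int_opp//.
    by apply: eq_Rintegral => y _; rewrite dpsiE; ring.
  have [M' M'0 HM'] := Cc_bounded (Cc_der psi_Cc).
  apply: (@integM _ _ _ _ M') => //; exact: meas_cont (smooth_cont (Cc_der psi_Cc).1).
have E2 : \int[mu]_y (g y * f y * psi y) =
   \int[mu]_(x in J) (Bfun x * conv k (fun y => g y * f y) x).
  by rewrite -B_J -(pair_k Ck Igf).
have cB := Bfun_cont.
have c_vf := conv_c Ck' Ivf; have c_gf := conv_c Ck Igf; have c_f' := conv_c Ck' If.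
have c_s := conv_c sgm_Cc If.
have c_sk := conv_c (CcB sgm_Cc Ck) If.
have skE x : conv (fun z => sgm z - k z) f x = conv sgm f x - c x.
  have [M2 M20 HM2] := Cc_bounded sgm_Cc; have [M3 M30 HM3] := Cc_bounded Ck.
  rewrite /c /conv -(Int_sub measurableT (integ_conv x (meas_cont (smooth_cont sgm_Cc.1)) HM2 If)
    (integ_conv x (meas_cont (smooth_cont Ck.1)) HM3 If)).
  by apply: eq_Rintegral => y _; ring.
have cchi := smooth_cont Cchi.1.
have cbc : continuous (fun x => beta (c x)).
  have dc x : is_derive x 1 c (conv k' f x) := cD x If.
  exact: (deriv_cont (fun x => @der_comp _ (@beta R) c x _ _ (betaD _) (dc x))).
have IchiB : integ J (fun x => chi x * beta (c x)) := integ_J (cM cchi cbc).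
have [Ism Hsm] := smear_int (- r) r e0 If.
have IJ1 := integ_J (cM cB c_vf); have IJ2 := integ_J (cM cB (cM cv c_f')).
have IJ3 := integ_J (cM cB c_gf).
have Iab : integ J (fun x => `|conv (fun z => sgm z - k z) f x|).
  by apply: integ_abs; exact: integ_J.
set D := C * om / e.
have T := transport.
have H : \int[mu]_(x in J) (- (Bfun x * conv k' (fun y => v y * f y) x)
      + Bfun x * (v x * conv k' f x)
      - (b - 1) * (Bfun x * conv k (fun y => g y * f y) x)) <=
   \int[mu]_(x in J) (2 * `|b| * K * (chi x * beta (c x)) + K * `|conv (fun z => sgm z - k z) f x|
     + (1 + `|b - 1|) * D * smear e f x).
  apply: (Int_le mJ).
  - exact: integB mJ (integD mJ (integN IJ1) IJ2) (integZ (b - 1) mJ IJ3).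
  - exact: integD mJ (integD mJ (integZ _ mJ IchiB) (integZ K mJ Iab)) (integZ _ mJ Ism).
  move=> x _; have := commutator x; have := commutator0 x; rewrite -/D skE.
  have := Bfun_bd x; have B0 := gK x.
  have hb : `|Bfun x * c x| <= 2 * (chi x * beta (c x)).
    have /andP[h0 h1] := chi01 x.
    rewrite /Bfun -mulrA normrM (ger0_norm h0) mulrCA.
    exact: ler_wpM2l h0 _ _ (dbeta_mul _).
  have S0 : 0 <= smear e f x.
    by apply: Rintegral_ge0 => y _; rewrite mulr_ge0// near_indE; case: ifP.
  move: hb S0.
  set X1 := conv k' (fun y => v y * f y) x; set X2 := conv k' f x; set X3 := conv sgm f x.
  set X4 := conv k (fun y => g y * f y) x; set Bx := Bfun x; set S := smear e f x.
  set N := chi x * beta (c x).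
  move=> hb S0 Bb H0 H1.
  exact (pointwise_ineq b hb B0 S0 Bb H0 H1).
move: H; rewrite (Int_sub mJ (integD mJ (integN IJ1) IJ2) (integZ (b - 1) mJ IJ3)).
rewrite (Int_add mJ (integN IJ1) IJ2) (Int_opp mJ IJ1) (Int_scale _ mJ IJ3).
rewrite (Int_add mJ (integD mJ (integZ _ mJ IchiB) (integZ K mJ Iab)) (integZ _ mJ Ism)).
rewrite (Int_add mJ (integZ _ mJ IchiB) (integZ K mJ Iab)) (Int_scale _ mJ IchiB) (Int_scale _ mJ Iab) (Int_scale _ mJ Ism).
rewrite -(@Int_supp _ J (fun x => chi x * beta (c x))); last by move=> x /outJ/Cchi.2 ->; rewrite mul0r.
rewrite E1 E2 => H.
have om0 : 0 <= om by apply: le_trans (normr_ge0 _) (gmod (x := 0) (y := 0) _); rewrite subrr normr0; exact: ltW.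
have D0 : 0 <= D := divr_ge0 (mulr_ge0 C0 om0) (ltW e0).
have HS : (1 + `|b - 1|) * D * \int[mu]_(x in J) smear e f x <=
   2 * C * (1 + `|b - 1|) * om * \int[mu]_y `|f y|.
  apply: (@le_trans _ _ ((1 + `|b - 1|) * D * (2 * e * \int[mu]_y `|f y|))).
    exact: ler_wpM2l (mulr_ge0 (addr_ge0 ler01 (normr_ge0 _)) D0) _ _ Hsm.
  by rewrite /D le_eqVlt; apply/orP; left; apply/eqP; field; rewrite gt_eqF.
rewrite [(K + _) * _]mulrDl; exact: (sum_ineq T H HS).
Qed.

End key.

(** * Compactness in time and a Gronwall inequality *)

Section time.
Variable R : realType.
Local Notation mu := (@lebesgue_measure R).
Implicit Types (t s T e d : R).

(** Compactness of [0, T]: a threshold on e valid near each time becomes uniform in time. *)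
Lemma uniform_on_segment T (P : R -> R -> Prop) :
  (forall t0, 0 <= t0 <= T -> exists2 d, 0 < d & forall t e, 0 <= t -> `|t - t0| < d -> 0 < e -> e < d -> P e t) ->
  exists2 d, 0 < d & forall e t, 0 < e -> e < d -> 0 <= t <= T -> P e t.
Proof.
move=> H; have := @segment_compact R 0 T; rewrite compact_near_coveringP => /(_ R 0^'+).
pose Q (e t : R) := 0 <= t -> P e t.
move=> /(_ Q _) [t0 t0I|/= d d0 Hd].
  have [d d0 Hd] := H t0 t0I.
  near=> t e => t1 /=; apply: (Hd t e t1).
  - by near: t; apply/nbhs_ballP; exists d => // s; rewrite /ball/= distrC.
  - by near: e; exact: nbhs_right_gt.
  - by near: e; exact: nbhs_right_lt.
exists d => // e t e0 ed tT; apply: (Hd e) => //.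
- by rewrite /ball_/= sub0r normrN gtr0_norm.
- by move: tT => /andP[].
Unshelve. all: by end_near. Qed.

(** Arithmetic of a first contact at time t: [y] and [ys] are the barrier at t and at an earlier s,
    [fs] is the function at s, and p = t - s. Going back from t the barrier drops by about p (A + 1)
    y >= p (A y + c + e), the function by at most p (A y + c + e / 4), so it would already lie above
    the barrier at s. *)
Lemma gronwall_contra (A c e y ys fs p : R) : 0 < p -> c + e <= y -> 0 < e ->
  ys - y - - p * ((A + 1) * y) <= e / 4 * p -> fs < ys ->
  y - fs <= (A * y + c + e / 4) * p -> False.
Proof.
move=> p0 cy e0 h1 h2 h3; have h4 := ler_wpM2l (ltW p0) cy.
have h5 : 0 < p * e by rewrite mulr_gt0.
have h6 : p * (c + e) <= p * y := h4.
have : y - ys < (A * y + c + e / 4) * p by lra.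
have -> : (A * y + c + e / 4) * p = p * A * y + p * c + p * e / 4 by ring.
move: h1; have -> : ys - y - - p * ((A + 1) * y) = ys - y + p * A * y + p * y by ring.
have -> : e / 4 * p = p * e / 4 by ring.
move: h6; have -> : p * (c + e) = p * c + p * e by ring.
move: (p * A * y) (p * y) (p * c) (p * e) h5 => a1 a2 a3 a4; lra.
Qed.

(* Only left upper difference quotients are controlled: convexity of [beta] bounds increments of
   the functional from one side. *)
Lemma gronwall_dini (f : R -> R) T A c : 0 < T -> 0 <= A -> 0 <= c ->
  f 0 <= 0 ->
  (forall t, 0 <= t <= T -> forall e, 0 < e -> exists2 d, 0 < d &
     forall s, 0 <= s -> `|s - t| < d -> `|f s - f t| <= e) ->
  (forall t, 0 < t <= T -> forall e, 0 < e -> exists2 d, 0 < d &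
     forall s, 0 <= s -> s < t -> t - s < d -> f t - f s <= (A * f t + c + e) * (t - s)) ->
  forall e, 0 < e -> f T <= (c + e) * expR ((A + 1) * T).
Proof.
move=> T0 A0 c0 f0 cf Df e e0.
(* The rate A + 1 instead of A: since y >= c + e, the extra y in y' pays for the source c and leaves
   a margin e. *)
pose y t := (c + e) * expR ((A + 1) * t).
have ce : 0 < c + e by lra.
have dy t : is_derive t 1 y ((A + 1) * y t).
  have d1 : is_derive t 1 (fun t => (A + 1) * t) (A + 1).
    by apply: is_derive_eq (der_scale (A + 1) (der_id t)) _; rewrite mulr1.
  apply: is_derive_eq (der_scale (c + e) (@der_comp _ expR (fun t => (A + 1) * t) t _ _ (is_derive_expR _) d1)) _.
  by rewrite /y; ring.
have ylow t : 0 <= t -> c + e <= y t.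
  move=> t0; rewrite /y ler_peMr ?(ltW ce)// -[leLHS]expR0 ler_expR mulr_ge0//; lra.
rewrite leNgt; apply/negP => fT.
pose E := [set t | 0 <= t <= T /\ y t <= f t].
have ET : E T by split; [rewrite lexx ltW|exact: ltW].
have lE : lbound E 0 by move=> t [/andP[]].
have hE : has_inf E by split; [exists T|exists 0].
(* The first time at which [f] reaches the barrier; continuity gives equality there. *)
pose t := inf E.
have t0 : 0 <= t by apply: lb_le_inf => //; exists T.
have tT : t <= T by apply: ge_inf => //; case: hE.
have below s : 0 <= s -> s < t -> f s < y s.
  move=> s0 st; rewrite ltNge; apply/negP => ys.
  have : t <= s by apply: ge_inf; [case: hE|split=> //; rewrite s0/= (le_trans (ltW st))].
  by rewrite leNgt st.
have cyy : continuous y := deriv_cont dy.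
have cy h : 0 < h -> exists2 d, 0 < d & forall s, `|s - t| < d -> `|y s - y t| <= h.
  move=> h0; have /cvgrPdist_le/(_ _ h0)/nbhs_ballP[d /= d0 Hd] := cyy t.
  by exists d => // s st; rewrite distrC; apply: Hd; rewrite /ball/= distrC.
have tI : 0 <= t <= T by rewrite t0.
have yf : y t <= f t.
  apply/ler_addgt0Pr => h h0; have h2 : 0 < h / 2 by rewrite divr_gt0.
  have [d1 d10 H1] := cf t tI _ h2; have [d2 d20 H2] := cy _ h2.
  have d0 : 0 < Num.min d1 d2 by rewrite lt_min d10.
  have [s [/andP[s0 sT] ys] st] := inf_adherent d0 hE.
  have ts : t <= s by apply: ge_inf; [case: hE|split=> //; rewrite s0].
  have : `|s - t| < Num.min d1 d2 by rewrite ger0_norm ?subr_ge0// ltrBlDl.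
  by rewrite lt_min => /andP[/(H1 _ s0) h1 /H2 h3]; exact: close_le h1 h3 ys.
have tpos : 0 < t.
  rewrite lt_neqAle t0 andbT; apply/negP => /eqP E0; move: yf; rewrite -E0 leNgt => /negP; apply.
  by apply: (le_lt_trans f0); apply: lt_le_trans ce (ylow 0 _).
have fy : f t <= y t.
  apply/ler_addgt0Pr => h h0; have h2 : 0 < h / 2 by rewrite divr_gt0.
  have [d1 d10 H1] := cf t tI _ h2; have [d2 d20 H2] := cy _ h2.
  pose d := Num.min (Num.min d1 d2) t.
  have d0 : 0 < d by rewrite !lt_min d10 d20.
  have dle : [/\ d <= d1, d <= d2 & d <= t] by rewrite /d !ge_min !lexx !orbT.
  have [dd1 dd2 dt] := dle.
  have [s0 st ns n1 sqnorm] := step_back d0 dd1 dd2 dt.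
  rewrite -ns in n1 sqnorm.
  exact: close_le (H2 _ sqnorm) (H1 _ s0 n1) (ltW (below _ s0 st)).
have e4 : 0 < e / 4 by rewrite divr_gt0.
have tI' : 0 < t <= T by rewrite tpos.
have [d1 d10 H1] := Df t tI' _ e4.
have /nbhs_ballP[d2 /= d20 H2] := is_derive_epsP (dy t) e4.
pose d := Num.min (Num.min d1 d2) t.
have d0 : 0 < d by rewrite !lt_min d10 d20.
have [dd1 dd2 dt] : [/\ d <= d1, d <= d2 & d <= t] by rewrite /d !ge_min !lexx !orbT.
pose s := t - d / 2.
have [s0 st ns n1 sqnorm] := step_back d0 dd1 dd2 dt.
rewrite -/s in s0 st ns.
have ts1 : t - s < d1 by rewrite /s opprB addrC subrK.
have ts2 : ball t d2 s by rewrite /ball/= distrC ns.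
have h1 := H1 s s0 st ts1; have h2 := H2 s ts2; have h3 := below s s0 st.
have fE : f t = y t by apply/eqP; rewrite eq_le fy.
move: h2; rewrite (distrC s) (gtr0_norm (x := t - s)) ?subr_gt0// => /ler_normlW h2.
have p : 0 < t - s by rewrite subr_gt0.
move: h1; rewrite fE => h1.
rewrite -(opprB t s) in h2.
exact: gronwall_contra p (ylow t t0) e0 h2 h3 h1.
Qed.

End time.

(** * Mollifiers and the zero-mean kernel *)

Section moll.
Variable R : realType.
Local Notation mu := (@lebesgue_measure R).
Implicit Types (f h k : R -> R) (t s T e d x y z q r : R).

Lemma sqr_le_le x y : 0 <= y -> x ^+ 2 <= y ^+ 2 -> x <= y.
Proof. by move=> y0 H; rewrite leNgt; apply/negP => yx; nra. Qed.

Definition moll_der e z : R := e^-1 * (e^-1 * (@rho R)^`()%classic ((z - 0) * e^-1)).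
Notation moll e := (bumpat 0 e).

Lemma moll_is_der e z : is_derive z 1 (moll e) (moll_der e z).
Proof. by apply: der_scale; apply: der_rescale; exact: smoothD1 (rho_Cc R).1. Qed.

Lemma moll_Cc e : 0 < e -> Cc (moll e) e.
Proof. by move=> e0; have := bumpat_Cc 0 e0; rewrite normr0 add0r. Qed.

Lemma moll_der_Cc e : 0 < e -> Cc (moll_der e) e.
Proof.
move=> e0; have := Cc_der (moll_Cc e0).
by rewrite (_ : (moll e)^`()%classic = moll_der e)//; apply/funext => z; exact: der_val (moll_is_der e z).
Qed.

Lemma moll_bounds : exists2 C, 0 < C & forall e, 0 < e ->
  (forall z, `|moll e z| <= C / e) /\ (forall z, `|moll_der e z| <= C / e ^+ 2).
Proof.
have [C C0 HC] := Cc_bounded (rho_Cc R); have [C' C'0 HC'] := Cc_bounded (Cc_der (rho_Cc R)).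
exists (C + C' + 1); first by lra.
move=> e e0; have ei : 0 <= e^-1 by rewrite invr_ge0 ltW.
split=> z.
  rewrite /bumpat normrM (ger0_norm ei) mulrC ler_wpM2r//.
  by rewrite (le_trans (HC _))//; lra.
rewrite /moll_der !normrM (ger0_norm ei) mulrA -expr2 -exprVn mulrC.
rewrite ler_wpM2r ?exprn_ge0//.
by rewrite (le_trans (HC' _))//; lra.
Qed.

(* This is minus the derivative of z |-> z * moll e z, so its integral vanishes. *)
Definition zero_mean_ker e z := sgm (moll_der e) z - moll e z.

Lemma zero_mean_ker_Cc e : 0 < e -> Cc (zero_mean_ker e) e.
Proof. by move=> e0; apply: CcB; [apply: sgm_Cc; exact: moll_der_Cc|exact: moll_Cc]. Qed.

Lemma zero_mean_ker_bound C e : 0 < e -> 0 < C -> (forall z, `|moll e z| <= C / e) ->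
  (forall z, `|moll_der e z| <= C / e ^+ 2) -> forall z, `|zero_mean_ker e z| <= 2 * C / e.
Proof.
move=> e0 C0 H1 H2 z; have [ze|ze] := leP `|z| e; last first.
  by rewrite (zero_mean_ker_Cc e0).2// normr0 divr_ge0// ?(ltW e0)// mulr_ge0// ltW.
rewrite /zero_mean_ker /sgm (le_trans (ler_normB _ _))// normrN normrM.
have -> : 2 * C / e = e * (C / e ^+ 2) + C / e by field; rewrite gt_eqF.
by apply: lerD => //; apply: ler_pM.
Qed.

(** Zero mean allows h(x) to be subtracted; the kernel has height 2 C / e on an interval of length 2
    e. *)
Lemma conv_zero_mean_cont C e h w x : 0 < e -> 0 < C -> (forall z, `|moll e z| <= C / e) ->
  (forall z, `|moll_der e z| <= C / e ^+ 2) -> continuous h ->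
  (forall y, `|x - y| <= e -> `|h x - h y| <= w) ->
  `|\int[mu]_y (zero_mean_ker e (x - y) * h y)| <= 4 * C * w.
Proof.
move=> e0 C0 H1 H2 ch hw.
have Ck := zero_mean_ker_Cc e0; have ck := smooth_cont Ck.1.
have kb := zero_mean_ker_bound e0 C0 H1 H2.
have ckx : continuous (fun y => zero_mean_ker e (x - y)).
  by move=> y; apply: (@continuous_comp _ _ _ (fun y => x - y) (zero_mean_ker e));
    [apply: cvgB; [exact: cvg_cst|exact: cvg_id]|exact: ck].
have cM (f1 f2 : R -> R) : continuous f1 -> continuous f2 -> continuous (fun y => f1 y * f2 y).
  by move=> c1 c2 y; apply: cvgM; [exact: c1|exact: c2].
have xe : x - e <= x + e by lra.
have out y : ~ `[x - e, x + e]%classic y -> zero_mean_ker e (x - y) = 0.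
  move=> yJ; apply: Ck.2; rewrite ltNge; apply/negP; rewrite ler_norml => /andP[y1 y2].
  by apply: yJ; rewrite /= in_itv/=; apply/andP; split; lra.
have Z : \int[mu]_(y in `[x - e, x + e]) zero_mean_ker e (x - y) = 0.
  (* A primitive of the kernel that vanishes at both endpoints. *)
  pose A y := (x - y) * moll e (x - y).
  have dA y : is_derive y 1 A (zero_mean_ker e (x - y)).
    have d1 : is_derive y 1 (fun y => x - y) (-1).
      by apply: is_derive_eq (der_sub (der_const y x) (der_id y)) _; rewrite sub0r.
    apply: is_derive_eq (der_mul d1 (@der_comp _ (moll e) (fun y => x - y) y _ _ (moll_is_der e _) d1)) _.
    by rewrite /zero_mean_ker /sgm; ring.
  rewrite (FTC2 xe dA ckx) /A.
  have E1 : (x - (x + e)) = - e by ring.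
  have E2 : (x - (x - e)) = e by ring.
  rewrite E1 E2 /bumpat.
  have r1 : rho ((- e - 0) * e^-1) = 0 :> R /\ rho ((e - 0) * e^-1) = 0 :> R.
    (* The support bound speaks only of |x| > 1; at the endpoints themselves continuity is used. *)
    have z1 : rho (-1 : R) = 0 /\ rho (1 : R) = 0.
      have cr : continuous (@rho R) := smooth_cont (rho_Cc R).1.
      have lim0 (a : R) : `|a| = 1 -> rho a = 0.
        move=> a1; apply/eqP; rewrite -normr_le0; apply/ler_addgt0Pr => u u0; rewrite add0r.
        have /cvgrPdist_le/(_ _ u0)/nbhs_ballP[d /= d0 Hd] := cr a.
        have ad : ball a d (a * (1 + d / 2)).
          rewrite /ball/= (_ : a - _ = - (a * (d / 2))); last by ring.
          by rewrite normrN normrM a1 mul1r gtr0_norm ?divr_gt0//; lra.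
        have ra : rho (a * (1 + d / 2)) = 0.
          apply: (rho_Cc R).2; rewrite normrM a1 mul1r ger0_norm; lra.
        by have := Hd _ ad; rewrite /= ra subr0.
      by split; apply: lim0; rewrite ?normrN normr1.
    have -> : (- e - 0) * e^-1 = -1 by field; rewrite gt_eqF.
    by have -> : (e - 0) * e^-1 = 1 by field; rewrite gt_eqF.
  by case: r1 => -> ->; rewrite !mulr0 subrr.
rewrite (@Int_supp _ `[x - e, x + e]); last by move=> y /out ->; rewrite mul0r.
have -> : \int[mu]_(y in `[x - e, x + e]) (zero_mean_ker e (x - y) * h y) =
  \int[mu]_(y in `[x - e, x + e]) (zero_mean_ker e (x - y) * (h y - h x)).
  have I1 : integ `[x - e, x + e] (fun y => zero_mean_ker e (x - y) * h y) by apply: integ_itv_cont; exact: cM.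
  have I2 : integ `[x - e, x + e] (fun y => zero_mean_ker e (x - y)) by exact: integ_itv_cont.
  have mI : measurable (`[x - e, x + e]%classic : set R) by exact: measurable_itv.
  have I3 : integ `[x - e, x + e] (fun y => zero_mean_ker e (x - y) * h x).
    by apply: integ_itv_cont; apply: cM => // y; exact: cvg_cst.
  under [RHS]eq_Rintegral do rewrite mulrBr.
  rewrite (Int_sub mI I1 I3).
  have -> : \int[mu]_(y in `[x - e, x + e]) (zero_mean_ker e (x - y) * h x) =
    h x * \int[mu]_(y in `[x - e, x + e]) zero_mean_ker e (x - y).
    by rewrite -(Int_scale _ mI I2); apply: eq_Rintegral => y _; exact: mulrC.
  by rewrite Z mulr0 subr0.
have -> : 4 * C * w = (2 * C / e * w) * (x + e - (x - e)) by field; rewrite gt_eqF.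
apply: Int_itv_bound => //.
  apply: measurable_funTS; apply: meas_cont; apply: cM => // y.
  by apply: cvgB; [exact: ch|exact: cvg_cst].
move=> y; rewrite /= in_itv/= => /andP[y1 y2]; rewrite normrM; apply: ler_pM => //.
by rewrite distrC; apply: hw; rewrite ler_norml; apply/andP; split; lra.
Qed.

(** Density of continuous functions in L^1: the continuous approximant is handled by zero mean, the
    remainder by the L^1 bound of the kernels, which does not depend on e. *)
Lemma conv_zero_mean_small f r eta : integ setT f -> 0 < r -> 0 < eta -> exists2 d, 0 < d &
  forall e, 0 < e -> e < d -> \int[mu]_(x in `[- r, r]) `|conv (zero_mean_ker e) f x| <= eta.
Proof.
move=> If r0 eta0; have [C C0 HC] := moll_bounds.
(* Room for a kernel of width e < 1 around [-r, r]. *)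
pose q := r + 1.
have IE : integ `[- q, q] f by apply: integS If.
pose Jq : set R := `[- q, q]%classic.
have muE : (mu Jq < +oo)%E.
  by rewrite lebesgue_measure_itv/=; case: ifP => _; rewrite ?ltry.
have [g_ [cg_ Ig_ cv]] := @approximation_continuous_integrable R `[- q, q]%classic f (measurable_itv _) muE IE.
(* Half of eta goes to the remainder, 4 C th, and half to the approximant, 4 C w over a length 2
   r. *)
pose th := eta / (8 * C).
have th0 : 0 < th by rewrite divr_gt0// mulr_gt0.
have [h ch Hh] : exists2 h, continuous h & \int[mu]_(x in `[- q, q]) `|f x - h x| <= th.
  have /fine_cvgP[fin /cvgrPdist_le/(_ _ th0)[N _ HN]] := cv.
  exists (g_ N); first exact: cg_.
  have := HN N (leqnn N); rewrite /= sub0r normrN => H.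
  by apply: le_trans H; rewrite /Rintegral; exact: ler_norm.
pose w := eta / (16 * C * r).
have w0 : 0 < w by rewrite divr_gt0// !mulr_gt0.
have [d d0 Hd] := unif_cont (- r) r ch w0.
exists (Num.min d 1); first by rewrite lt_min d0 ltr01.
move=> e e0; rewrite lt_min => /andP[ed e1]; have [H1 H2] := HC _ e0.
have Ck := zero_mean_ker_Cc e0; have ck := smooth_cont Ck.1.
have kb := zero_mean_ker_bound e0 C0 H1 H2.
have mE : measurable (`[- q, q]%classic : set R) by exact: measurable_itv.
have mJ : measurable (`[- r, r]%classic : set R) by exact: measurable_itv.
have Ih : integ `[- q, q] (fun x => f x - h x) := integB mE IE (integ_itv_cont _ _ ch).
pose f1 := (fun x => f x - h x) \_ `[- q, q].
have If1 : integ setT f1 by apply/(integ_mk _ mE).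
have E x : `[- r, r]%classic x -> `|conv (zero_mean_ker e) f x| <= `|conv (zero_mean_ker e) f1 x| + 4 * C * w.
  rewrite /= in_itv/= => /andP[x1 x2].
  have -> : conv (zero_mean_ker e) f x = conv (zero_mean_ker e) f1 x + \int[mu]_y (zero_mean_ker e (x - y) * h y).
    rewrite /conv -Int_add//.
    - apply: eq_Rintegral => y _; rewrite /f1 patchE; case: ifPn => yE; first by ring.
      rewrite Ck.2 ?mul0r ?addr0//; rewrite ltNge; apply/negP => xy.
      by move/negP: yE; apply; rewrite inE/= in_itv/=; exact: enlarge_itv xy.
    - exact: (integ_conv x (meas_cont ck) kb If1).
    - apply: (@integ_supp _ `[x - e, x + e]) => //.
        move=> y yJ; rewrite Ck.2 ?mul0r//; rewrite ltNge; apply/negP; rewrite distrC ler_distl => xy.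
        by apply: yJ; rewrite /= in_itv.
      apply: integ_itv_cont => y; apply: cvgM; last exact: ch.
      apply: (@continuous_comp _ _ _ (fun y => x - y) (zero_mean_ker e)).
        by apply: cvgB; [exact: cvg_cst|exact: cvg_id].
      exact: ck.
  apply: (le_trans (ler_normD _ _)); rewrite lerD2l.
  apply: conv_zero_mean_cont => // y xy; apply: Hd; last by rewrite (le_trans xy)// ltW.
  by rewrite x1.
have c1 := conv_c Ck If; have c2 := conv_c Ck If1.
have I2 : integ `[- r, r] (fun x => `|conv (zero_mean_ker e) f1 x|) := integ_abs (integ_itv_cont _ _ c2).
apply: (@le_trans _ _ (\int[mu]_(x in `[- r, r]) (`|conv (zero_mean_ker e) f1 x| + 4 * C * w))).
  apply: (Int_le mJ) => //; first exact: integ_abs (integ_itv_cont _ _ c1).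
  exact: integD mJ I2 (integ_cst _ _ _).
rewrite (Int_add mJ I2 (integ_cst _ _ _)) Int_cst_itv; last exact: (ge0_cp (ltW r0)).2.
have C2 : 0 <= 2 * C / e by rewrite divr_ge0 ?(ltW e0)// mulr_ge0// ltW.
have HL := conv_L1 (- r) r e0 C2 ck c2 If1 kb Ck.2.
have H3 : \int[mu]_y `|f1 y| <= th.
  apply: le_trans Hh; rewrite [leRHS]Rintegral_mkcond le_eqVlt; apply/orP; left; apply/eqP.
  by apply: eq_Rintegral => y _; rewrite /f1 !patchE; case: ifP; rewrite ?normr0.
have -> : eta = 4 * C * th + 4 * C * w * (r - - r).
  by rewrite /th /w; field; rewrite !gt_eqF.
rewrite lerD2r; apply: (le_trans HL).
have -> : 2 * e * (2 * C / e) = 4 * C by field; rewrite gt_eqF.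
by rewrite ler_wpM2l// mulr_ge0// ltW.
Qed.

End moll.

(** * Positivity of the momentum *)

Section local_mass.
Variable R : realType.
Local Notation mu := (@lebesgue_measure R).
Implicit Types (f g h v w k : R -> R) (t s T e d x y z q r : R).
Notation moll e := (bumpat 0 e).

Lemma sqnorm_near f g : L2 f -> L2 g -> sqnorm f <= 2 * sqnorm (fun x => f x - g x) + 2 * sqnorm g.
Proof.
move=> Lf Lg; have LB := L2B Lf Lg.
have LN : L2 (fun x => - g x).
  split; first by apply: measurableT_comp => //; exact: Lg.1.
  by apply: eq_integ Lg.2 => // x _; rewrite sqrrN.
have := sqnorm_sub LB LN.
have -> : (fun x => f x - g x - - g x) = f by apply/funext => x; rewrite opprK subrK.
by have -> : sqnorm (fun x => - g x) = sqnorm g by apply: eq_Rintegral => x _; rewrite sqrrN.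
Qed.

(** |f| <= e + f^2 / (4 e). The free parameter makes the coefficient of the length as small as
    desired, which is how an L^2 bound absorbs the cost of a wide cutoff. *)
Lemma Int_abs_amgm f a c e : a <= c -> 0 < e -> L2 f ->
  \int[mu]_(x in `[a, c]) `|f x| <= e * (c - a) + sqnorm f / (4 * e).
Proof.
move=> ac e0 Lf.
have mJ : measurable (`[a, c]%classic : set R) by exact: measurable_itv.
have I2 := L2_itv a c Lf.
have I3 : integ `[a, c] (fun x => (4 * e)^-1 * f x ^+ 2) := integZ _ mJ I2.
have e4 : 0 < (4 * e)^-1 by rewrite invr_gt0 mulr_gt0.
apply: (@le_trans _ _ (\int[mu]_(x in `[a, c]) (e + (4 * e)^-1 * f x ^+ 2))).
  apply: (Int_le mJ).
  - exact: integ_abs (L2_itv1 _ _ Lf).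
  - exact: integD mJ (integ_cst _ _ _) I3.
  - move=> x _; rewrite -[f x ^+ 2]real_normK ?num_real//.
    set z := `|f x|; have -> : e + (4 * e)^-1 * z ^+ 2 = z + (4 * e)^-1 * (z - 2 * e) ^+ 2.
      by field; rewrite gt_eqF.
    by rewrite lerDl mulr_ge0// ?sqr_ge0// ltW.
rewrite (Int_add mJ (integ_cst _ _ _) I3) (Int_cst_itv _ ac) lerD2l (Int_scale _ mJ I2) mulrC.
by rewrite ler_wpM2r// ?(ltW e4)// sqnorm_itv.
Qed.

Lemma Int_abs_small f q e : 0 < q -> 0 < e -> L2 f -> sqnorm f <= e ^+ 2 / (2 * q) ->
  \int[mu]_(x in `[- q, q]) `|f x| <= e.
Proof.
move=> q0 e0 Lf Hf; apply: sqr_le_le; first exact: ltW.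
have qq : - q <= q by lra.
apply: (le_trans (CS_itv qq (L2_abs Lf))); rewrite sqnorm_abs opprK.
have -> : e ^+ 2 = (q + q) * (e ^+ 2 / (2 * q)) by field; rewrite gt_eqF.
by rewrite ler_wpM2l//; lra.
Qed.

Lemma Cc_pair v g w k r : AC v g -> AC g w -> Cc k r ->
  [/\ integ setT (fun x => v x * k x), integ setT (fun x => w x * k x) &
  \int[mu]_x ((v x - w x) * k x) = \int[mu]_x (v x * (k x - k^`()^`()%classic x))].
Proof.
move=> A1 A2 Ck.
have Ck' := Cc_der Ck; have Ck'' := Cc_der Ck'.
have B1 : AC k k^`()%classic by apply: AC_C1; [exact: smoothD1 Ck.1|exact: smooth_cont Ck'.1].
have B2 : AC k^`()%classic k^`()^`()%classic by apply: AC_C1; [exact: smoothD1 Ck'.1|exact: smooth_cont Ck''.1].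
have [I1 I2 E1] := AC_ibp A1 B2 Ck'.2 Ck''.2.
have [I3 I4 E2] := AC_ibp A2 B1 Ck.2 Ck'.2.
have cv : continuous v by case: A1.
have Iv := integ_cont_Cc cv Ck.
split => //.
have E3 : \int[mu]_x (w x * k x) = \int[mu]_x (v x * k^`()^`()%classic x) by rewrite E1 E2 opprK.
under eq_Rintegral do rewrite mulrBl.
under [RHS]eq_Rintegral do rewrite mulrBr.
by rewrite (Int_sub measurableT Iv I4) (Int_sub measurableT Iv I1) E3.
Qed.

Variables (b : R) (V D W : R -> R -> R) (HH : H2sol b V D W).

Lemma H2_bounded T : exists2 K, 0 < K & forall t, 0 <= t <= T ->
  [/\ sqnorm (V t) <= K, sqnorm (D t) <= K & sqnorm (W t) <= K].
Proof.
(* The bound is written as the inverse of e, so that a threshold for small e yields a uniform large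
   constant. *)
pose P e t := [/\ sqnorm (V t) <= e^-1, sqnorm (D t) <= e^-1 & sqnorm (W t) <= e^-1].
have [d d0 Hd] : exists2 d, 0 < d & forall e t, 0 < e -> e < d -> 0 <= t <= T -> P e t.
  apply: uniform_on_segment => t0 /andP[t0p _].
  have [d d0 Hd] := H2_cont HH t0p ltr01.
  pose B := 2 + 2 * (sqnorm (V t0) + sqnorm (D t0) + sqnorm (W t0)).
  have [h1 h2 h3] : [/\ 0 <= sqnorm (V t0), 0 <= sqnorm (D t0) & 0 <= sqnorm (W t0)] by split; exact: sqnorm_ge0.
  have B0 : 0 < B by rewrite /B; lra.
  exists (Num.min d B^-1); first by rewrite lt_min d0 invr_gt0.
  move=> t e t0' ; rewrite !lt_min => /andP[td _] e0 /andP[_ eB].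
  have Be : B <= e^-1 by rewrite -[B]invrK lef_pV2 ?posrE ?invr_gt0// ltW.
  have [H1 H2 H3] := Hd _ t0' td.
  have G1 := sqnorm_near (H2_V HH t0') (H2_V HH t0p).
  have G2 := sqnorm_near (H2_D HH t0') (H2_D HH t0p).
  have G3 := sqnorm_near (H2_W HH t0') (H2_W HH t0p).
  have [s1 s2 s3] := sum3_le h1 h2 h3.
  by split; apply: le_trans Be; [exact: near_bound G1 H1 s1|exact: near_bound G2 H2 s2|
    exact: near_bound G3 H3 s3].
exists (d / 2)^-1; first by rewrite invr_gt0; lra.
by move=> t tT; apply: (Hd (d / 2)) => //; lra.
Qed.

(** V - W is only known to be square integrable; truncation produces an integrable function that can
    be mollified, and test functions supported in [-q, q] do not see it. *)
Definition mom q t := (fun x => V t x - W t x) \_ `[- q, q].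

Lemma mom_integ q t : 0 <= t -> integ setT (mom q t).
Proof.
move=> t0; apply/(integ_mk _ (measurable_itv _)).
by apply: integB => //; [apply: L2_itv1; exact: H2_V HH _ t0|apply: L2_itv1; exact: H2_W HH _ t0].
Qed.

Lemma mom_abs q t : \int[mu]_x `|mom q t x| = \int[mu]_(x in `[- q, q]) `|V t x - W t x|.
Proof.
rewrite [RHS]Rintegral_mkcond; apply: eq_Rintegral => x _.
by rewrite /mom !patchE; case: ifP; rewrite ?normr0.
Qed.

Lemma mom_L2 t : 0 <= t -> L2 (fun x => V t x - W t x).
Proof. by move=> t0; apply: L2B; [exact: H2_V HH _ t0|exact: H2_W HH _ t0]. Qed.

Lemma mom_cont q t eta : 0 < q -> 0 <= t -> 0 < eta -> exists2 d, 0 < d &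
  forall s, 0 <= s -> `|s - t| < d -> \int[mu]_x `|mom q s x - mom q t x| <= eta.
Proof.
move=> q0 t0 eta0.
pose e := eta ^+ 2 / (8 * q).
have e0 : 0 < e by rewrite divr_gt0 ?exprn_gt0// mulr_gt0.
have [d d0 Hd] := H2_cont HH t0 e0; exists d => // s s0 st.
have [H1 _ H3] := Hd _ s0 st.
have L1 := L2B (H2_V HH s0) (H2_V HH t0); have L3 := L2B (H2_W HH s0) (H2_W HH t0).
have -> : \int[mu]_x `|mom q s x - mom q t x| =
  \int[mu]_(x in `[- q, q]) `|V s x - V t x - (W s x - W t x)|.
  rewrite [RHS]Rintegral_mkcond; apply: eq_Rintegral => x _.
  rewrite /mom !patchE; case: ifP => _; last by rewrite subrr normr0.
  by congr (`| _ |); ring.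
apply: Int_abs_small => //; first exact: L2B L1 L3.
apply: (le_trans (sqnorm_sub L1 L3)); rewrite /sqnorm.
have -> : eta ^+ 2 / (2 * q) = 2 * e + 2 * e by rewrite /e; field; rewrite gt_eqF.
by apply: lerD; rewrite ler_pM2l.
Qed.

(** Uniformity in time comes from the L^1 continuity of the truncated momentum and the e-independent
    bound 4 C on the L^1 effect of the kernels. *)
Lemma mom_mollified T r q eta : 0 < r -> 0 < q -> 0 < eta -> exists2 d, 0 < d &
  forall e t, 0 < e -> e < d -> 0 <= t <= T ->
  \int[mu]_(x in `[- r, r]) `|conv (zero_mean_ker e) (mom q t) x| <= eta.
Proof.
move=> r0 q0 eta0; have [C C0 HC] := moll_bounds R.
apply: uniform_on_segment => t0 /andP[t0p _].
have eta2 : 0 < eta / 2 by lra.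
have eta8 : 0 < eta / (8 * C) by rewrite divr_gt0// mulr_gt0.
have [d1 d10 H1] := conv_zero_mean_small (mom_integ q t0p) r0 eta2.
have [d2 d20 H2] := mom_cont q0 t0p eta8.
exists (Num.min d1 d2); first by rewrite lt_min d10.
move=> t e tp; rewrite !lt_min => /andP[_ td] e0 /andP[ed _].
have {H1} H1 := H1 _ e0 ed; have {H2} H2 := H2 _ tp td.
have [K1 K2] := HC _ e0.
have Ck := zero_mean_ker_Cc e0; have ck := smooth_cont Ck.1.
have kb := zero_mean_ker_bound e0 C0 K1 K2.
have If := mom_integ q tp; have If0 := mom_integ q t0p.
have IfB := integB measurableT If If0.
have C2 : 0 <= 2 * C / e by rewrite divr_ge0 ?(ltW e0)// mulr_ge0// ltW.
have HL := conv_L1 (- r) r e0 C2 ck (conv_c Ck IfB) IfB kb Ck.2.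
have mJ : measurable (`[- r, r]%classic : set R) by exact: measurable_itv.
have cI h : integ setT h -> integ `[- r, r] (fun x => `|conv (zero_mean_ker e) h x|).
  by move=> Ih; apply: integ_abs; apply: integ_itv_cont; exact: conv_c Ck Ih.
have E x : conv (zero_mean_ker e) (mom q t) x = conv (zero_mean_ker e) (mom q t0) x +
    conv (zero_mean_ker e) (fun y => mom q t y - mom q t0 y) x.
  rewrite /conv -(Int_add measurableT (integ_conv x (meas_cont ck) kb If0) (integ_conv x (meas_cont ck) kb IfB)).
  by apply: eq_Rintegral => y _; ring.
apply: (@le_trans _ _ (\int[mu]_(x in `[- r, r]) (`|conv (zero_mean_ker e) (mom q t0) x| +
    `|conv (zero_mean_ker e) (fun y => mom q t y - mom q t0 y) x|))).
  apply: (Int_le mJ (cI _ If) (integD mJ (cI _ If0) (cI _ IfB))) => x _.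
  by rewrite E ler_normD.
rewrite (Int_add mJ (cI _ If0) (cI _ IfB)).
have -> : eta = eta / 2 + eta / 2 by field.
apply: lerD H1 (le_trans HL _).
have -> : eta / 2 = 2 * e * (2 * C / e) * (eta / (8 * C)) by field; rewrite !gt_eqF.
by rewrite ler_wpM2l// mulr_ge0// mulr_ge0// ltW.
Qed.

End local_mass.

(** * The regularized negative mass *)

Section negative_part.
Variable R : realType.
Local Notation mu := (@lebesgue_measure R).
Implicit Types (f g h v w k chi : R -> R) (t s T e d x y z q r : R).
Notation moll e := (bumpat 0 e).

Definition neg_mass chi k f := \int[mu]_x (chi x * beta (conv k f x)).

Lemma beta_lip (a c : R) : `|beta a - beta c| <= `|a - c|.
Proof.
have H (x y : R) : beta x - beta y <= `|x - y|.
  apply: (le_trans (beta_convex x y)); apply: (le_trans (ler_norm _)).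
  by rewrite normrM -[leRHS]mul1r ler_wpM2r// dbeta_norm.
by rewrite ler_norml H andbT lerNl opprB distrC.
Qed.

Lemma beta_cont : continuous (@beta R).
Proof. by apply: (@lip_cont _ _ 1) => x y; rewrite mul1r beta_lip. Qed.

Section fixed.
Variables (chi k : R -> R) (r e : R).
Hypotheses (Cchi : Cc chi r) (chi01 : forall x, 0 <= chi x <= 1) (e0 : 0 < e) (Ck : Cc k e).

Lemma neg_integ f : integ setT f -> integ setT (fun x => chi x * beta (conv k f x)).
Proof.
move=> If; apply: (@integ_cont_supp _ _ r); last by move=> x /Cchi.2 ->; rewrite mul0r.
move=> x; apply: cvgM; first exact: smooth_cont Cchi.1 _.
by apply: (@continuous_comp _ _ _ (conv k f) (@beta R)); [exact: (conv_c Ck If)|exact: beta_cont].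
Qed.

(** The tangent inequality for [beta], integrated. The differential is taken at [f] alone, so with f
    = m(t) it is a test function that does not move with the earlier time. *)
Lemma neg_sub f h : integ setT f -> integ setT h ->
  neg_mass chi k f - neg_mass chi k h <= \int[mu]_y ((f y - h y) * psi f chi k y).
Proof.
move=> If Ih; have IB' := integB measurableT If Ih.
rewrite (pair_k If Cchi Ck Ck IB') /neg_mass -(Int_sub measurableT (neg_integ If) (neg_integ Ih)).
have [M M0 HM] := Cc_bounded Ck.
have cB := Bfun_cont If Cchi Ck.
apply: (Int_le measurableT).
- exact: integB measurableT (neg_integ If) (neg_integ Ih).
- apply: (@integ_cont_supp _ _ r); last by move=> x xr; rewrite (@Bfun0 _ f chi k r Cchi x xr) mul0r.
  by move=> x; apply: cvgM; [exact: cB|exact: conv_c Ck IB' x].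
- move=> x _; rewrite /Bfun -mulrBr -mulrA ler_wpM2l//; first by case/andP: (chi01 x).
  have -> : conv k (fun y => f y - h y) x = conv k f x - conv k h x; last exact: beta_convex.
  have mk : measurable_fun setT k := meas_cont (smooth_cont Ck.1).
  rewrite /conv -(Int_sub measurableT (integ_conv x mk HM If) (integ_conv x mk HM Ih)).
  by apply: eq_Rintegral => y _; ring.
Qed.

Lemma neg_lip f h C : 0 <= C -> (forall z, `|k z| <= C / e) -> integ setT f -> integ setT h ->
  `|neg_mass chi k f - neg_mass chi k h| <= 2 * C * \int[mu]_y `|f y - h y|.
Proof.
move=> C0 kC If Ih; have IB' := integB measurableT If Ih.
rewrite /neg_mass -(Int_sub measurableT (neg_integ If) (neg_integ Ih)).
set F := fun x => _ - _.
have FE x : F x = chi x * (beta (conv k f x) - beta (conv k h x)) by rewrite /F mulrBr.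
have mk : measurable_fun setT k := meas_cont (smooth_cont Ck.1).
have Fz x : ~ `[- r, r]%classic x -> F x = 0 by move=> /(Cc_supp Cchi) cx; rewrite FE cx mul0r.
rewrite (Int_supp Fz).
have mJ : measurable (`[- r, r]%classic : set R) by exact: measurable_itv.
have IF : integ `[- r, r] F.
  by apply: (@integS _ setT) => //; exact: integB measurableT (neg_integ If) (neg_integ Ih).
have Ce : 0 <= C / e by rewrite divr_ge0// ltW.
have ck := smooth_cont Ck.1.
have HL := conv_L1 (- r) r e0 Ce ck (conv_c Ck IB') IB' kC Ck.2.
have -> : 2 * C = 2 * e * (C / e) by field; rewrite gt_eqF.
apply: le_trans HL; apply: (Int_abs_le mJ (integ_meas IF)).
  by apply: integ_abs; apply: integ_itv_cont; exact: conv_c Ck IB'.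
move=> x _; rewrite FE normrM.
have -> : conv k (fun y => f y - h y) x = conv k f x - conv k h x.
  rewrite /conv -(Int_sub measurableT (integ_conv x mk kC If) (integ_conv x mk kC Ih)).
  by apply: eq_Rintegral => y _; ring.
rewrite -[leRHS]mul1r ler_pM// ?beta_lip//.
by have /andP[x0 x1] := chi01 x; rewrite ger0_norm.
Qed.

End fixed.

Variables (b : R) (V D W : R -> R -> R) (HH : H2sol b V D W).

(** The equation for u tested with k - k'' is the equation for m tested with k. *)
Lemma flux_deriv t k r : 0 < t -> Cc k r ->
  is_derive t 1 (fun s => \int[mu]_x ((V s x - W s x) * k x))
  (\int[mu]_x (V t x * (V t x - W t x) * k^`()%classic x)
   - (b - 1) * \int[mu]_x (D t x * (V t x - W t x) * k x)).
Proof.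
move=> t0 Ck; have t0' := ltW t0.
have Ck' := Cc_der Ck; have Ck'' := Cc_der Ck'; have Ck''' := Cc_der Ck''.
have CB := CcB Ck Ck''.
rewrite -(flux_test b (H2_AC1 HH t0') (H2_AC2 HH t0') (H2_V HH t0') (H2_D HH t0') (H2_W HH t0') Ck).
have -> : \int[mu]_x (flux b (V t) (D t) x * (k^`()%classic x - k^`()^`()^`()%classic x)) =
  \int[mu]_x (flux b (V t) (D t) x * (fun x => k x - k^`()^`()%classic x)^`()%classic x).
  apply: eq_Rintegral => x _; congr (_ * _); symmetry; apply: der_val.
  by apply: der_sub; [exact: smoothD1 Ck.1 x|exact: smoothD1 Ck''.1 x].
apply: is_derive_near (H2_eq HH CB t0).
exists t => //= s /= st; have s0 : 0 <= s by move: st; rewrite ltr_norml => /andP[_ h]; lra.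
by have [_ _ ->] := Cc_pair (H2_AC1 HH s0) (H2_AC2 HH s0) Ck.
Qed.

End negative_part.

Lemma rate_le (R : realFieldType) (P1 P2 p x d t s : R) : 0 < t - s -> p <= x ->
  - (d * (t - s)) <= P2 - P1 - (s - t) * p -> P1 - P2 <= (x + d) * (t - s).
Proof. by move=> ? ? ?; nra. Qed.

(** * Gronwall estimate for the negative mass *)

Section evolution.
Variable R : realType.
Local Notation mu := (@lebesgue_measure R).
Implicit Types (f g h v w k chi : R -> R) (t s d x y z : R).
Notation moll e := (bumpat 0 e).
Variables (b : R) (V D W : R -> R -> R) (HH : H2sol b V D W).

Lemma mom_supp q t k r x : r <= q -> Cc k r -> mom V W q t x * k x = (V t x - W t x) * k x.
Proof.
move=> rq Ck; rewrite /mom patchE; case: ifPn => // /negP xq.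
rewrite Ck.2 ?mulr0//; rewrite ltNge; apply/negP => xr; apply: xq.
by rewrite inE/= in_itv/= -ler_norml (le_trans xr).
Qed.

Lemma uniform_bound T K0 : 0 < K0 -> (forall t, 0 <= t <= T ->
  [/\ sqnorm (V t) <= K0, sqnorm (D t) <= K0 & sqnorm (W t) <= K0]) ->
  forall t, 0 <= t <= T -> forall x, `|V t x| <= K0 + 1 /\ `|D t x| <= K0 + 1.
Proof.
move=> K00 HK t tT x; have /andP[t0 _] := tT; have [H1 H2 H3] := HK _ tT.
have S1 := sup_bound (H2_AC1 HH t0) (H2_V HH t0) (H2_D HH t0) x.
have S2 := sup_bound (H2_AC2 HH t0) (H2_D HH t0) (H2_W HH t0) x.
have F (z a c : R) : z ^+ 2 <= 2 * a + 2 * c -> a <= K0 -> c <= K0 -> `|z| <= K0 + 1.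
  move=> h1 h2 h3; apply: sqr_le_le; first by lra.
  (* 4 K0 <= (K0 + 1)^2, which gives a bound without square roots. *)
  rewrite real_normK ?num_real//; have := sqr_ge0 (K0 - 1).
  have -> : (K0 - 1) ^+ 2 = (K0 + 1) ^+ 2 - 4 * K0 by ring.
  by move: (z ^+ 2) h1 => y h1; lra.
by split; [apply: F S1 _ _|apply: F S2 _ _].
Qed.

Section estimate.
Variables (T K0 C c1 Bq eta om e q r : R) (chi : R -> R).
Hypotheses (T0 : 0 < T) (K00 : 0 < K0) (HK : forall t, 0 <= t <= T ->
  [/\ sqnorm (V t) <= K0, sqnorm (D t) <= K0 & sqnorm (W t) <= K0]).
Hypotheses (Cchi : Cc chi r) (chi01 : forall x, 0 <= chi x <= 1).
Hypotheses (r0 : 0 < r) (dchi : forall x, `|chi^`()%classic x| <= c1) (e0 : 0 < e) (erq : e + r <= q).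
Hypotheses (C0 : 0 <= C) (kC : forall z, `|moll e z| <= C / e) (dkC : forall z, `|moll_der e z| <= C / e ^+ 2).
Hypothesis HBq : forall t, 0 <= t <= T -> \int[mu]_x `|mom V W q t x| <= Bq.
Hypothesis Heta : forall t, 0 <= t <= T -> \int[mu]_(x in `[- r, r]) `|conv (zero_mean_ker e) (mom V W q t) x| <= eta.
Hypotheses (om0 : 0 <= om) (Hom : e * K0 <= om ^+ 2).
Hypothesis pos0 : {ae mu, forall x, 0 <= V 0 x - W 0 x}.

Let K := K0 + 1.
Let N t := neg_mass chi (moll e) (mom V W q t).
Let A := K + 2 * `|b| * K.
(** The three defects: cutoff, zero-mean kernel, commutators. *)
Let c := c1 * K * (2 * C * Bq) + K * eta + 2 * C * (1 + `|b - 1|) * om * Bq.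
Let Ck := moll_Cc e0.
Let Ck' := moll_der_Cc e0.
Let c10 : 0 <= c1 := le_trans (normr_ge0 _) (dchi 0).
Let K0' : 0 <= K. Proof. by apply: addr_ge0 => //; exact: ltW. Qed.

(** [psi] is frozen at time t, the weak equation differentiates the pairing of m(s) with it at s =
    t, and [neg_sub] transfers the resulting rate to the nonlinear functional for s < t. *)
Lemma neg_rate t : 0 < t <= T -> forall d, 0 < d -> exists2 del, 0 < del &
  forall s, 0 <= s -> s < t -> t - s < del -> N t - N s <= (A * N t + c + d) * (t - s).
Proof.
move=> /andP[t0 tT] d d0; have t0' := ltW t0.
have tT' : 0 <= t <= T by rewrite t0'.
have If := mom_integ HH q t0'.
set F := mom V W q t in If *.
have Cpsi : Cc (psi F chi (moll e)) (e + r)  := psi_Cc If Cchi Ck.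
have cg : continuous (D t) by case: (H2_AC2 HH t0').
have dv := AC_derive (H2_AC1 HH t0') cg.
have vK x : `|V t x| <= K by case: (uniform_bound K00 HK tT' x).
have gK x : `|D t x| <= K by case: (uniform_bound K00 HK tT' x).
(* u_x is 1/2-Hoelder with constant the L^2 norm of u_xx, so om^2 is compared with e K0. *)
have gmod x y : `|x - y| <= e -> `|D t x - D t y| <= om.
  move=> xy; apply: sqr_le_le => //; rewrite real_normK ?num_real//.
  apply: (le_trans (AC_holder (H2_AC2 HH t0') (H2_W HH t0') x y)); apply: le_trans Hom.
  by apply: ler_pM => //; [exact: sqnorm_ge0|case: (HK tT')].
have KB := renormalized_bound b dv cg vK gK gmod If Cchi chi01 dchi e0 Ck Ck' C0 (moll_is_der e) kC dkC.
have Dp := flux_deriv HH t0 Cpsi.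
have E1 : \int[mu]_y (V t y * (V t y - W t y) * (psi F chi (moll e))^`()%classic y) =
    \int[mu]_y (V t y * F y * (psi F chi (moll e))^`()%classic y).
  by apply: eq_Rintegral => y _; rewrite -!mulrA (mom_supp _ _ erq (Cc_der Cpsi)).
have E2 : \int[mu]_y (D t y * (V t y - W t y) * psi F chi (moll e) y) =
    \int[mu]_y (D t y * F y * psi F chi (moll e) y).
  by apply: eq_Rintegral => y _; rewrite -!mulrA (mom_supp _ _ erq Cpsi).
rewrite E1 E2 in Dp.
set p' := (X in is_derive _ _ _ X) in Dp.
have Hp' : p' <= A * N t + c.
  have C1 : \int[mu]_(x in `[- r, r]) `|conv (moll e) F x| <= 2 * C * Bq.
    have Ce : 0 <= C / e by rewrite divr_ge0// ltW.
    have HL := conv_L1 (- r) r e0 Ce (smooth_cont Ck.1) (conv_c Ck If) If kC Ck.2.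
    apply: (le_trans HL).
    have -> : 2 * e * (C / e) = 2 * C by field; rewrite gt_eqF.
    by rewrite ler_wpM2l ?HBq// mulr_ge0.
  have p2 : 0 <= 2 * C * (1 + `|b - 1|) * om by rewrite !mulr_ge0// addr_ge0.
  apply: (le_trans KB); rewrite /c !addrA.
  apply: lerD; last by rewrite ler_wpM2l//; exact: HBq.
  apply: lerD; last by rewrite ler_wpM2l//; exact: Heta.
  by apply: lerD; [exact: lexx|rewrite ler_wpM2l// mulr_ge0].
have [del del0 Hdel] := proj1 (@nbhs_ballP R R t _) (is_derive_epsP Dp d0).
exists del => // s s0 st tsd.
have If' := mom_integ HH q s0.
apply: (le_trans (neg_sub Cchi chi01 Ck If If')).
have sp : 0 < t - s by rewrite subr_gt0.
have := Hdel s; rewrite /ball/= (gtr0_norm sp) => /(_ tsd).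
have -> : \int[mu]_y ((F y - mom V W q s y) * psi F chi (moll e) y) =
   \int[mu]_x ((V t x - W t x) * psi F chi (moll e) x) -
   \int[mu]_x ((V s x - W s x) * psi F chi (moll e) x).
  have [I1 I2 _] := Cc_pair (H2_AC1 HH t0') (H2_AC2 HH t0') Cpsi.
  have [I3 I4 _] := Cc_pair (H2_AC1 HH s0) (H2_AC2 HH s0) Cpsi.
  have J1 := integB measurableT I1 I2; have J2 := integB measurableT I3 I4.
  have J1' : integ setT (fun x => (V t x - W t x) * psi F chi (moll e) x).
    by apply: eq_integ J1 => // x _; rewrite mulrBl.
  have J2' : integ setT (fun x => (V s x - W s x) * psi F chi (moll e) x).
    by apply: eq_integ J2 => // x _; rewrite mulrBl.
  rewrite -(Int_sub measurableT J1' J2'); apply: eq_Rintegral => y _.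
  by rewrite mulrBl (mom_supp _ _ erq Cpsi) (mom_supp _ _ erq Cpsi).
set P1 := \int[mu]_x _; set P2 := \int[mu]_x _.
rewrite (_ : `|s - t| = t - s); last by rewrite distrC gtr0_norm.
rewrite ler_norml => /andP[h1 _].
exact: rate_le sp Hp' h1.
Qed.

Lemma neg_gronwall d : 0 < d -> N T <= (c + d) * expR ((A + 1) * T).
Proof.
move=> d0.
have T00 : (0 : R) <= 0 <= T by rewrite lexx (ltW T0).
have B0 : 0 <= Bq by apply: le_trans (HBq T00); apply: Rintegral_ge0.
have eta0 : 0 <= eta by apply: le_trans (Heta T00); apply: Rintegral_ge0.
apply: (gronwall_dini (f := N)) => //.
- by rewrite /A addr_ge0// !mulr_ge0.
- rewrite /c !addr_ge0// !mulr_ge0// ?addr_ge0//.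
(* Initially the mollified momentum is nonnegative, where [beta] vanishes. *)
- rewrite /N /neg_mass le_eqVlt; apply/orP; left; apply/eqP.
  have E x : chi x * beta (conv (moll e) (mom V W q 0) x) = 0.
    rewrite beta_pos ?mulr0// /conv.
    have mk : measurable_fun setT (moll e) := meas_cont (smooth_cont Ck.1).
    have I0 := mom_integ HH q (lexx 0).
    apply: Int_ge0_ae => //; first exact: integ_meas (integ_conv x mk kC I0).
    apply: ae_impl pos0 => y y0 _; apply: mulr_ge0; first exact: bumpat_ge0.
    by rewrite /mom patchE; case: ifP.
  by under eq_Rintegral do rewrite E; rewrite /Rintegral integral0.
- move=> t /andP[t0 tT] u u0; have q0 : 0 < q by apply: lt_le_trans erq; exact: addr_gt0.
  have u1 : 0 < u / (2 * C + 1) by rewrite divr_gt0// ltr_wpDl// mulr_ge0.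
  have [del del0 Hdel] := mom_cont HH q0 t0 u1; exists del => // s s0 st.
  have If := mom_integ HH q t0; have If' := mom_integ HH q s0.
  apply: (le_trans (neg_lip Cchi chi01 e0 Ck C0 kC If' If)).
  apply: (@le_trans _ _ ((2 * C) * (u / (2 * C + 1)))).
    by rewrite ler_wpM2l ?mulr_ge0//; exact: Hdel.
  rewrite mulrCA ler_piMr ?(ltW u0)// ler_pdivrMr ?mul1r; last by rewrite ltr_wpDl// mulr_ge0.
  by rewrite lerDl.
- exact: neg_rate.
Qed.

End estimate.
End evolution.

(** * From the mollified estimate to positivity *)

Section positivity.
Variable R : realType.
Local Notation mu := (@lebesgue_measure R).
Implicit Types (f g h v w k chi th : R -> R) (t s d x y z r l : R).
Notation moll e := (bumpat 0 e).

Lemma locint_of_itv f : measurable_fun setT f -> (forall a b, integ `[a, b] f) ->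
  locally_integrable setT f.
Proof.
move=> mf If; split => //; first exact: openT.
move=> K _ cK.
have [M [_ HM]] := compact_bounded cK.
have mK : measurable K by exact: compact_measurable.
have KM : K `<=` `[- (M + 1), M + 1]%classic.
  move=> x Kx; have M1 : M < M + 1 by lra.
  have := HM (M + 1) M1 x Kx.
  by rewrite /= in_itv/= ler_norml.
by have /integrableP[_] := integS (measurable_itv _) mK KM (If _ _).
Qed.

Lemma wide_cut : exists2 C, 0 < C & forall l, 0 < l -> exists chi,
  [/\ Cc chi (3 * l), forall x, 0 <= chi x <= 1, forall x, `|chi^`()%classic x| <= C / l,
   forall x, `|chi^`()^`()%classic x| <= C / l ^+ 2 & forall x, `|x| <= l -> chi x = 1].
Proof.
have [C C0 HC] := Cc_bounded (rho_Cc R); have [C' C'0 HC'] := Cc_bounded (Cc_der (rho_Cc R)).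
have s1 := smoothD1 (rho_Cc R).1.
exists (2 * (C + C' + 1)); first by rewrite mulr_gt0// ltr_wpDl// addr_ge0.
move=> l l0; have H : - (2 * l) + l <= 2 * l - l by lra.
have li : 0 <= l^-1 by rewrite invr_ge0 ltW.
have e1 : (cut (- (2 * l)) l (2 * l) l)^`()%classic = dcut (- (2 * l)) l (2 * l) l.
  by apply/funext => y; exact: der_val (cutD _ _ _ _ _).
exists (cut (- (2 * l)) l (2 * l) l); split.
- apply: Cc_le (cut_Cc l0 l0 H).
  by rewrite ge_max; apply/andP; split; lra.
- by move=> x; rewrite cut_ge0 ?cut_le1.
- move=> x; rewrite e1 /dcut (le_trans (ler_normB _ _))// !normrM (ger0_norm li).
  have -> : 2 * (C + C' + 1) / l = l^-1 * (C + C' + 1) + l^-1 * (C + C' + 1) by ring.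
  by apply: lerD; rewrite ler_wpM2l// (le_trans (HC _))//; lra.
- move=> x; have -> : (cut (- (2 * l)) l (2 * l) l)^`()^`()%classic x =
    l^-1 * (l^-1 * (@rho R)^`()%classic ((x - - (2 * l)) * l^-1)) -
    l^-1 * (l^-1 * (@rho R)^`()%classic ((x - 2 * l) * l^-1)).
    by rewrite e1; apply: der_val; apply: der_sub; apply: der_scale; exact: der_rescale.
  rewrite (le_trans (ler_normB _ _))// !normrM (ger0_norm li).
  have -> : 2 * (C + C' + 1) / l ^+ 2 =
    l^-1 * (l^-1 * (C + C' + 1)) + l^-1 * (l^-1 * (C + C' + 1)) by field; rewrite gt_eqF.
  by apply: lerD; do 2 (rewrite ler_wpM2l//); rewrite (le_trans (HC' _))//; lra.
- move=> x; rewrite ler_norml => /andP[x1 x2]; apply: cut_in => //; apply/andP; split; lra.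
Qed.

Lemma moll_unit th (e w : R) y : 0 < e -> continuous th ->
  (forall x, `|y - x| <= e -> `|th y - th x| <= w) ->
  `|\int[mu]_x (moll e (x - y) * th x) - th y| <= w.
Proof.
move=> e0 ct Hw.
have bE x : moll e (x - y) = bumpat y e x by rewrite /bumpat subr0.
under eq_Rintegral do rewrite bE.
have Cb := bumpat_Cc y e0; have Ib := integ_Cc Cb.
have I1 : integ setT (fun x => bumpat y e x * th x).
  by apply: eq_integ (integ_cont_Cc ct Cb) => // x _; rewrite mulrC.
have I2 : integ setT (fun x => th y * bumpat y e x) := integZ _ measurableT Ib.
have -> : th y = \int[mu]_x (th y * bumpat y e x).
  by rewrite (Int_scale _ measurableT Ib) bumpat_int// mulr1.
rewrite -(Int_sub measurableT I1 I2).
have -> : w = \int[mu]_x (w * bumpat y e x).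
  by rewrite (Int_scale _ measurableT Ib) bumpat_int// mulr1.
apply: (Int_abs_le measurableT).
- exact: integ_meas (integB measurableT I1 I2).
- exact: integZ.
- move=> x _; rewrite -[th y * _]mulrC -mulrBr normrM (ger0_norm (bumpat_ge0 _ _ e0)) mulrC.
  have [xy|xy] := leP `|x - y| e; last by rewrite bumpat0// !mulr0.
  by rewrite ler_wpM2r ?bumpat_ge0// distrC Hw// distrC.
Qed.

(** Moving the mollifier from [f] to [th] costs [w] times the L^1 norm of [f]; then the mollified
    [f] is bounded below by minus its negative part, which [npart_le] trades for [beta] and a
    constant [e1] on the support of [th]. *)
Lemma neg_test chi r f th (rho0 Th e e1 w : R) : Cc chi r -> (forall x, 0 <= chi x <= 1) ->
  (forall x, `|x| <= rho0 -> chi x = 1) -> integ setT f -> Cc th rho0 -> 0 < rho0 ->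
  (forall x, 0 <= th x <= Th) -> 0 < e -> 0 < e1 -> 
  (forall x y, `|x - y| <= e -> `|th x - th y| <= w) ->
  - (Th * e1 * (2 * rho0)) - Th * ((1 + e1) / e1) * neg_mass chi (moll e) f - w * \int[mu]_x `|f x|
  <= \int[mu]_x (f x * th x).
Proof.
move=> Cchi chi01 chi1 If Cth r0 thTh e0 e10 Hw.
have Ck := moll_Cc e0; have [M M0 HM] := Cc_bounded Ck.
have mk : measurable_fun setT (moll e) := meas_cont (smooth_cont Ck.1).
have Ith := integ_Cc Cth; have ct := smooth_cont Cth.1.
have cc := conv_c Ck If.
have mJ : measurable (`[- rho0, rho0]%classic : set R) by exact: measurable_itv.
have Th0 : 0 <= Th by have /andP[+ +] := thTh 0; exact: le_trans.
pose S y := \int[mu]_x (moll e (x - y) * th x).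
have F1 : \int[mu]_x (th x * conv (moll e) f x) = \int[mu]_y (f y * S y) := conv_swap mk HM Ith If.
have Sw y : `|S y - th y| <= w by apply: (moll_unit e0 ct) => x xy; exact: Hw.
have mS : measurable_fun setT S.
  apply: meas_cont; rewrite /S.
  have Ck2 := bumpat_Cc 0 e0.
  have CkR : Cc (fun z => moll e ((z - 0) * -1)) e.
    split; first by apply: smooth_aff; exact: Ck.1.
    by move=> z ze; apply: Ck.2; rewrite subr0 mulrN1 normrN.
  have := conv_c CkR Ith; rewrite /conv.
  suff -> : (fun y => \int[mu]_x (moll e (x - y) * th x)) =
    (fun x => \int[mu]_y (moll e ((x - y - 0) * -1) * th y)) by [].
  by apply/funext => y; apply: eq_Rintegral => x _; congr (moll e _ * _); ring.
have IfS : integ setT (fun y => f y * (S y - th y)).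
  apply: (integM (c := w) measurableT If); last by move=> x _; exact: Sw.
  exact: measurable_funB mS (meas_cont ct).
have Ift : integ setT (fun y => f y * th y).
  apply: (integM (c := Th) measurableT If); first exact: meas_cont.
  by move=> x _; have /andP[h1 h2] := thTh x; rewrite ger0_norm.
have E1 : \int[mu]_y (f y * S y) <= \int[mu]_x (f x * th x) + w * \int[mu]_x `|f x|.
  have -> : \int[mu]_y (f y * S y) = \int[mu]_y (f y * (S y - th y)) + \int[mu]_x (f x * th x).
    by rewrite -(Int_add measurableT IfS Ift); apply: eq_Rintegral => y _; ring.
  rewrite addrC lerD2l; apply: (le_trans (ler_norm _)).
  have Ia := integ_abs If.
  rewrite -(Int_scale _ measurableT Ia); apply: (Int_abs_le measurableT (integ_meas IfS)).
    exact: integZ.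
  by move=> y _; rewrite normrM mulrC ler_wpM2r.
have E2 : - (Th * e1 * (2 * rho0)) - Th * ((1 + e1) / e1) * neg_mass chi (moll e) f <=
  \int[mu]_x (th x * conv (moll e) f x).
  rewrite (@Int_supp _ `[- rho0, rho0] (fun x => th x * _)); last first.
    by move=> x /(Cc_supp Cth) ->; rewrite mul0r.
  have Ic : integ `[- rho0, rho0] (fun x => th x * conv (moll e) f x).
    by apply: integ_itv_cont => x; apply: cvgM; [exact: ct|exact: cc].
  have In := neg_integ Cchi Ck If.
  have In' : integ `[- rho0, rho0] (fun x => chi x * beta (conv (moll e) f x)).
    exact: (integS measurableT mJ (@subsetT _ _) In).
  have In2 := integZ (- (Th * ((1 + e1) / e1))) mJ In'.
  have Icst := integ_cst (- rho0) rho0 (- (Th * e1)).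
  have rr : - rho0 <= rho0 := (ge0_cp (ltW r0)).2.
  apply: (@le_trans _ _ (\int[mu]_(x in `[- rho0, rho0]) (- (Th * e1) +
     - (Th * ((1 + e1) / e1)) * (chi x * beta (conv (moll e) f x))))).
    rewrite (Int_add mJ Icst In2) (Int_cst_itv _ rr) (Int_scale _ mJ In').
    have -> : - (Th * e1) * (rho0 - - rho0) = - (Th * e1 * (2 * rho0)) by ring.
    rewrite lerD2l mulNr lerN2; apply: ler_wpM2l.
      exact: mulr_ge0 Th0 (divr_ge0 (addr_ge0 ler01 (ltW e10)) (ltW e10)).
    apply: (Int_subset mJ measurableT (@subsetT _ _) In) => x _; apply: mulr_ge0; last exact: beta_ge0.
    by case/andP: (chi01 x).
  apply: (Int_le mJ (integD mJ Icst In2) Ic) => x; rewrite /= in_itv/= => xJ.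
  rewrite chi1 ?mul1r; last by rewrite ler_norml.
  set c := conv _ _ _; have /andP[t0 t1] := thTh x.
  have np := npart_le c e10; have nN := npart_geN c; have n0 := npart_ge0 c.
  have h1 : th x * npart c <= Th * npart c by rewrite ler_wpM2r.
  have h2 : Th * npart c <= Th * (e1 + (1 + e1) / e1 * beta c) by rewrite ler_wpM2l.
  have h3 : th x * (- c) <= th x * npart c by rewrite ler_wpM2l.
  move: h1 h2 h3; clear; rewrite mulrDr mulrA mulrN mulNr; lra.
by rewrite lerBlDr; apply: le_trans E2 _; rewrite F1; exact: E1.
Qed.

End positivity.

Section positivity.
Variable R : realType.
Local Notation mu := (@lebesgue_measure R).
Implicit Types (f g h v w k chi th : R -> R) (t s d x y z r l : R).
Notation moll e := (bumpat 0 e).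
Variables (b : R) (V D W : R -> R -> R) (HH : H2sol b V D W).
Hypothesis pos0 : {ae mu, forall x, 0 <= V 0 x - W 0 x}.

Lemma mom_bound T K0 q z t : (forall t, 0 <= t <= T ->
  [/\ sqnorm (V t) <= K0, sqnorm (D t) <= K0 & sqnorm (W t) <= K0]) -> 0 <= q -> 0 < z -> 0 <= t <= T ->
  \int[mu]_x `|mom V W q t x| <= z * (2 * q) + K0 / z.
Proof.
move=> HK q0 z0 tT; have /andP[t0 _] := tT; have [H1 _ H3] := HK _ tT.
rewrite mom_abs; have qq : - q <= q by lra.
apply: (le_trans (Int_abs_amgm qq z0 (mom_L2 HH t0))).
have -> : q - - q = 2 * q by ring.
rewrite lerD2l.
have -> : K0 / z = (2 * K0 + 2 * K0) / (4 * z) by field; rewrite gt_eqF.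
rewrite ler_pM2r ?invr_gt0 ?mulr_gt0//.
by apply: (le_trans (sqnorm_sub (H2_V HH t0) (H2_W HH t0))); lra.
Qed.

(** [l] and [Bq] are provided before [e1]: the scale e at which a test function must be resolved
    depends on the L^1 bound [Bq]. Inside, nu is split into four equal shares: three defects and the
    slack of the Gronwall lemma. *)
Lemma neg_small T p nu : 0 < T -> 0 < nu -> 0 < p -> exists l Bq, [/\ p <= l, 0 < Bq,
  \int[mu]_x `|mom V W (3 * l + 1) T x| <= Bq & forall e1, 0 < e1 -> exists chi e,
   [/\ Cc chi (3 * l), forall x, 0 <= chi x <= 1, forall x, `|x| <= l -> chi x = 1, 0 < e < e1 &
    neg_mass chi (moll e) (mom V W (3 * l + 1) T) <= nu]].
Proof.
move=> T0 nu0 p0.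
have [K0 K00 HK] := H2_bounded HH T; have [C C0 HC] := moll_bounds R.
have [Cr Cr0 Hcut] := wide_cut R.
pose K := K0 + 1; pose A := K + 2 * `|b| * K.
have Kp : 0 < K by rewrite /K; lra.
pose ex := expR ((A + 1) * T); have ex0 : 0 < ex by exact: expR_gt0.
pose ka := nu / (4 * ex); have ka0 : 0 < ka by rewrite divr_gt0// mulr_gt0.
pose Q := 2 * Cr * K * C; have Q0 : 0 < Q by rewrite !mulr_gt0.
(* The cutoff costs Q (8 z) + Q K0 / (z l). This z makes the first term ka / 2, whatever l is. *)
pose z := ka / (16 * Q); have z0 : 0 < z by rewrite divr_gt0// mulr_gt0.
(* Now l makes the second term at most ka / 2; l >= 1 also gives 3 l + 1 <= 4 l, as used in [Bq]. *)
pose l := 1 + p + 2 * Q * K0 / (z * ka).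
have l2 : 0 < 2 * Q * K0 / (z * ka).
  apply: divr_gt0; last exact: mulr_gt0.
  by apply: mulr_gt0 => //; exact: mulr_gt0.
have l1 : 1 <= l by rewrite /l; lra.
have l0 : 0 < l by lra.
pose q := 3 * l + 1; pose Bq := z * (2 * (4 * l)) + K0 / z.
have l8 : 0 < 2 * (4 * l) by rewrite !pmulr_rgt0.
have Bq0 : 0 < Bq := addr_gt0 (mulr_gt0 z0 l8) (divr_gt0 K00 z0).
have HBq t : 0 <= t <= T -> \int[mu]_x `|mom V W q t x| <= Bq.
  move=> tT; have q0 : 0 <= q by rewrite /q; lra.
  apply: (le_trans (mom_bound HK q0 z0 tT)); rewrite lerD2r ler_pM2l// ler_pM2l//.
  by rewrite /q; lra.
exists l, Bq; split => //.
- by rewrite /l; lra.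
- by apply: HBq; rewrite lexx andbT ltW.
move=> e1 e10.
have [chi [Cchi chi01 dchi _ chi1]] := Hcut _ l0.
pose eta := ka / K; have eta0 : 0 < eta by rewrite divr_gt0.
pose bb := 1 + `|b - 1|; have bb0 : 0 < bb by rewrite /bb; have := normr_ge0 (b - 1); lra.
(* Chosen so that the commutator term is exactly [ka]; Hoelder continuity then dictates e <= om^2 /
   K0. *)
pose om := ka / (2 * C * bb * Bq); have om0 : 0 < om by rewrite divr_gt0// !mulr_gt0.
have r0 : 0 < 3 * l by exact: mulr_gt0.
have q0 : 0 < q := addr_gt0 r0 ltr01.
have [e2 e20 He2] := mom_mollified HH T r0 q0 eta0.
pose e3 := om ^+ 2 / K0; have e30 : 0 < e3 by rewrite divr_gt0// exprn_gt0.
have [e [e0 ee1 ee2 ee3 ee4]] := below3 e10 e20 e30.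
exists chi, e; split => //; first by rewrite e0.
have [kC dkC] := HC _ e0.
have erq : e + 3 * l <= q by rewrite /q addrC lerD2l.
have Heta t : 0 <= t <= T -> \int[mu]_(x in `[- (3 * l), (3 * l)]) `|conv (zero_mean_ker e) (mom V W q t) x| <= eta.
  by move=> tT; exact: He2.
have Hom : e * K0 <= om ^+ 2.
  have -> : om ^+ 2 = e3 * K0 by rewrite /e3 divfK// gt_eqF.
  by rewrite ler_pM2r.
have := neg_gronwall HH T0 K00 HK Cchi chi01 r0 dchi e0 erq (ltW C0) kC dkC HBq Heta (ltW om0) Hom pos0 ka0.
rewrite -/K -/A -/ex => H; apply: (le_trans H).
have -> : nu = 4 * ka * ex by rewrite /ka; field; rewrite gt_eqF.
rewrite ler_pM2r//.
have -> : K * eta = ka by rewrite /eta mulrCA divff ?mulr1// gt_eqF.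
rewrite -/bb.
have -> : 2 * C * bb * om * Bq = ka by rewrite /om; field; rewrite !gt_eqF.
apply: four_parts.
have -> : Cr / l * K * (2 * C * Bq) = Q * (8 * z) + Q * K0 / (z * l).
  by rewrite /Bq /Q; field; rewrite !gt_eqF.
have -> : Q * (8 * z) = ka / 2 by rewrite /z; field; rewrite gt_eqF.
apply: two_halves.
rewrite ler_pdivrMr ?(mulr_gt0 z0 l0)//.
have -> : Q * K0 = (2 * Q * K0 / (z * ka)) * (z * ka / 2) by field; rewrite !gt_eqF.
have -> : ka / 2 * (z * l) = l * (z * ka / 2) by ring.
rewrite ler_pM2r; last by apply: divr_gt0 => //; exact: mulr_gt0 z0 ka0.
by rewrite /l lerDr addr_ge0 ?ler01 ?(ltW p0).
Qed.

(** The pairing with a nonnegative test function is at least minus three quarters of an arbitrary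
    eta. Choices are made in the order e1, nu, then l and Bq, then w, then e. *)
Lemma momentum_ge0 T : 0 <= T -> {ae mu, forall x, 0 <= V T x - W T x}.
Proof.
rewrite le_eqVlt => /orP[/eqP <-//|T0]; have T0' := ltW T0.
have LM := mom_L2 HH T0'.
apply: test_ge0_ae.
  by apply: locint_of_itv => [|a c]; [exact: LM.1|exact: L2_itv1].
move=> th r1 Cth1 th0.
pose r := Num.max r1 1; have r0 : 0 < r by rewrite lt_max ltr01 orbT.
have Cth : Cc th r by apply: Cc_le Cth1; rewrite le_max lexx.
have [Th1 Th10 HTh] := Cc_bounded Cth.
pose Th := Th1 + 1; have Thp : 0 < Th by rewrite /Th; lra.
have thTh x : 0 <= th x <= Th.
  by rewrite th0/= /Th (le_trans (ler_norm _))// (le_trans (HTh x))// lerDl.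
rewrite -[leRHS]addr0; apply/ler_addgt0Pr => eta eta0; rewrite addr0.
pose e1 := eta / (8 * Th * r); have e10 : 0 < e1 by rewrite divr_gt0// !mulr_gt0.
(* Inverts the factor Th (1 + e1) / e1 in front of the negative mass. *)
pose nu := eta / 4 * (e1 / (1 + e1)) / Th.
have e11 : 0 < 1 + e1 by lra.
have nu0 : 0 < nu by rewrite !(divr_gt0, mulr_gt0).
have [l [Bq [rl Bq0 HBq He]]] := neg_small T0 nu0 r0.
pose w := eta / 4 / Bq; have w0 : 0 < w by rewrite !divr_gt0.
have ct := smooth_cont Cth.1.
have [d d0 Hd] := unif_cont (- (r + 1)) (r + 1) ct w0.
have e20 : 0 < Num.min d 1 by rewrite lt_min d0 ltr01.
have [chi [e [Cchi chi01 chi1 /andP[e0]]]] := He _ e20.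
rewrite lt_min => /andP[ed e1'] HN.
have Hw x y : `|x - y| <= e -> `|th x - th y| <= w.
  move=> xy; have [xr|xr] := leP `|x| (r + 1).
    by apply: Hd; [rewrite -ler_norml|rewrite (le_trans xy)// ltW].
  have yr : r < `|y|.
    exact: far_norm xr e1' xy.
  have xr' : r < `|x| by apply: lt_trans xr; rewrite ltrDl.
  by rewrite (Cth.2 _ xr') (Cth.2 _ yr) subrr normr0 ltW.
have chi1' x : `|x| <= r -> chi x = 1 by move=> xr; apply: chi1; rewrite (le_trans xr).
have Iq := mom_integ HH (3 * l + 1) T0'.
have := neg_test Cchi chi01 chi1' Iq Cth r0 thTh e0 e10 Hw.
have -> : \int[mu]_x (mom V W (3 * l + 1) T x * th x) = \int[mu]_x ((V T x - W T x) * th x).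
  by apply: eq_Rintegral => x _; apply: mom_supp Cth; exact: triple_ge.
have -> : Th * e1 * (2 * r) = eta / 4 by rewrite /e1; field; rewrite !gt_eqF.
have h1 : Th * ((1 + e1) / e1) * neg_mass chi (moll e) (mom V W (3 * l + 1) T) <= eta / 4.
  have -> : eta / 4 = Th * ((1 + e1) / e1) * nu by rewrite /nu; field; rewrite !gt_eqF.
  by rewrite ler_pM2l// !(divr_gt0, mulr_gt0).
have h2 : w * \int[mu]_x `|mom V W (3 * l + 1) T x| <= eta / 4.
  have -> : eta / 4 = w * Bq by rewrite /w divfK// gt_eqF.
  by rewrite ler_pM2l.
by move=> h3; exact: quarters eta0 h1 h2 h3.
Qed.

End positivity.

Lemma flux_sum (R : realFieldType) (p q r z y K : R) :
  p <= z * K -> q <= z * (3 * K) -> r <= y -> y <= z * (6 * K) -> 0 <= z * K ->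
  p + (q + r) <= z * K * 20.
Proof. by move=> *; lra. Qed.

(** * Positivity of the velocity *)

Section maximum_principle.
Variable R : realType.
Local Notation mu := (@lebesgue_measure R).
Implicit Types (f g h v w k : R -> R) (a c t s x y z r l : R).

Lemma L2_below f a l c : L2 f -> 0 <= l -> 0 <= c -> (forall x, a <= x <= a + l -> c <= `|f x|) ->
  c ^+ 2 * l <= sqnorm f.
Proof.
move=> Lf l0 c0 H; apply: le_trans (sqnorm_itv a (a + l) Lf).
have al : a <= a + l by lra.
have -> : c ^+ 2 * l = \int[mu]_(x in `[a, a + l]) c ^+ 2 by rewrite (Int_cst_itv _ al); congr (_ * _); ring.
apply: Int_le => //; [exact: integ_cst|exact: L2_itv|].
by move=> x /=; rewrite in_itv/= => /H h; rewrite -[leRHS]real_normK ?num_real// lerXn2r ?nnegrE.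
Qed.

(** A square-integrable function cannot stay above a positive level on arbitrarily long
    intervals. *)
Lemma L2_not_below f (c : R) : 0 < c ->
  (forall l, 0 <= l -> c ^+ 2 * l <= sqnorm f) -> False.
Proof.
move=> c0 H; have := H ((sqnorm f + 1) / c ^+ 2).
have c2 : 0 < c ^+ 2 by rewrite exprn_gt0.
have n0 := sqnorm_ge0 f.
rewrite divr_ge0 ?(ltW c2)// ?addr_ge0// => /(_ isT).
by rewrite mulrCA divff ?gt_eqF// mulr1; lra.
Qed.

Lemma AC_nonincr f f' a c : AC f f' -> {ae mu, forall x, f' x <= 0} -> a <= c -> f c <= f a.
Proof.
move=> [_ mf If E] H ac; rewrite -subr_le0 (E _ _ ac) -oppr_ge0.
have mJ : measurable (`[a, c]%classic : set R) by exact: measurable_itv.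
rewrite -(Int_opp mJ (If a c)); apply: (Int_ge0_ae mJ).
  by apply: measurable_funTS; apply: measurableT_comp.
by apply: ae_impl H => x ? _; rewrite oppr_ge0.
Qed.

Lemma AC_D f f' g g' : AC f f' -> AC g g' ->
  AC (fun x => f x + g x) (fun x => f' x + g' x).
Proof.
move=> [c1 m1 I1 E1] [c2 m2 I2 E2]; split.
- by move=> x; apply: cvgD; [exact: c1|exact: c2].
- exact: measurable_funD.
- by move=> a c; apply: integD => //; exact: measurable_itv.
- move=> a c ac; rewrite (Int_add (measurable_itv _) (I1 a c) (I2 a c)) -E1// -E2//; ring.
Qed.

Lemma exp_AC (e : R) : AC (fun x => expR (e * x)) (fun x => e * expR (e * x)).
Proof.
have d x : is_derive x 1 (fun x => expR (e * x)) (e * expR (e * x)).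
  apply: is_derive_eq (@der_comp _ expR (fun x => e * x) x _ _ (is_derive_expR _) (der_scale e (der_id x))) _.
  by ring.
have c : continuous (fun x : R => expR (e * x)) := deriv_cont d.
by apply: AC_C1 => // x; apply: cvgM; [exact: cvg_cst|exact: c].
Qed.

(* With m = v - v'' >= 0, e^-x (v + v') is nonincreasing, so v + v' < 0 somewhere would contradict
   v + v' in L^2; hence e^x v is nondecreasing, and v < 0 somewhere would contradict v in L^2. *)
Lemma potential_ge0 v g w : AC v g -> AC g w -> L2 v -> L2 g ->
  {ae mu, forall x, 0 <= v x - w x} -> forall x, 0 <= v x.
Proof.
move=> A1 A2 Lv Lg H.
have S1 a c : a <= c -> expR (-1 * c) * (v c + g c) <= expR (-1 * a) * (v a + g a).
  apply: (AC_nonincr (AC_M (exp_AC (-1)) (AC_D A1 A2))).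
  apply: ae_impl H => x Hx; have := expR_gt0 (-1 * x); move: (expR _) => E E0.
  have -> : -1 * E * (v x + g x) + (g x + w x) * E = - (E * (v x - w x)) by ring.
  by rewrite oppr_le0 mulr_ge0// ltW.
have P x : 0 <= v x + g x.
  rewrite leNgt; apply/negP => neg_mass.
  have c0 : 0 < - (v x + g x) by lra.
  have LD : L2 (fun x => v x + g x).
    have LN : L2 (fun x => - g x).
      split; first by apply: measurableT_comp => //; exact: Lg.1.
      by apply: eq_integ Lg.2 => // y _; rewrite sqrrN.
    have := L2B Lv LN; congr L2; apply/funext => y; ring.
  apply: (L2_not_below c0 (f := fun x => v x + g x)) => l l0; apply: (L2_below (a := x) LD l0 (ltW c0)).
  move=> y /andP[xy _]; have := S1 _ _ xy.
  have E1 : expR (-1 * y) <= expR (-1 * x) by rewrite ler_expR; lra.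
  have := expR_gt0 (-1 * y); move: (expR (-1 * y)) (expR (-1 * x)) E1 => p q pq p0 h.
  rewrite ler0_norm; last by nra.
  rewrite lerN2; nra.
move=> x; rewrite leNgt; apply/negP => neg_mass.
have c0 : 0 < - v x by lra.
have S2 a c : a <= c -> - (expR (1 * c) * v c) <= - (expR (1 * a) * v a).
  (* [exp_AC 0] is the constant 1 with zero density; it serves only to change the sign, so that
     [AC_nonincr] applies. *)
  move=> ac; have := AC_B (exp_AC 0) (AC_M (exp_AC 1) A1).
  move=> /AC_nonincr -/(_ a c) Q.
  have := Q _ ac; rewrite !mul0r expR0 => Q'.
  have : 1 - expR (1 * c) * v c <= 1 - expR (1 * a) * v a.
    apply: Q'; apply: ae_impl H => y _; have := expR_gt0 (1 * y); move: (expR (1 * y)) => E E0.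
    rewrite !mul0r sub0r oppr_le0.
    have -> : 1 * E * v y + g y * E = E * (v y + g y) by ring.
    by rewrite mulr_ge0// ltW.
  lra.
apply: (L2_not_below c0 (f := v)) => l l0; apply: (L2_below (a := x - l) Lv l0 (ltW c0)).
move=> y; rewrite subrK => /andP[_ xy]; have := S2 _ _ xy.
have E1 : expR (1 * y) <= expR (1 * x) by rewrite ler_expR; lra.
have := expR_gt0 (1 * y); move: (expR (1 * y)) (expR (1 * x)) E1 => p q pq p0 h.
rewrite ler0_norm; last by nra.
rewrite lerN2; nra.
Qed.

Lemma G_ge0 h x : (forall y, 0 <= h y) -> 0 <= G h x.
Proof.
move=> h0; rewrite /G mulr_ge0// ?invr_ge0//; apply: Rintegral_ge0 => y _.
by rewrite mulr_ge0// expR_ge0.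
Qed.

Lemma G_le h x : integ setT h -> `|G h x| <= \int[mu]_y `|h y|.
Proof.
move=> Ih; rewrite GE normrM (ger0_norm (x := 2^-1)) ?invr_ge0//.
have Ic := integ_conv x (@ker_meas R) (@ker_bound R) Ih.
have : `|conv (@ker R) h x| <= \int[mu]_y `|h y|.
  apply: (Int_abs_le measurableT (integ_meas Ic)); first exact: integ_abs.
  by move=> y _; rewrite normrM -[leRHS]mul1r ler_wpM2r// ker_bound.
have := normr_ge0 (conv (@ker R) h x); lra.
Qed.

Lemma bumpat_der2 a l x : (bumpat a l)^`()^`()%classic x =
  l^-1 * (l^-1 * (l^-1 * (@rho R)^`()^`()%classic ((x - a) * l^-1))).
Proof.
have s1 := smoothD1 (rho_Cc R).1; have s2 := smoothD1 (Cc_der (rho_Cc R)).1.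
have -> : (bumpat a l)^`()%classic = fun x => l^-1 * (l^-1 * (@rho R)^`()%classic ((x - a) * l^-1)).
  by apply/funext => y; apply: der_val; apply: der_scale; exact: der_rescale.
by apply: der_val; apply: der_scale; apply: der_scale; exact: der_rescale.
Qed.

Lemma bump_bounds : exists2 C, 0 < C & forall a l, 0 < l ->
  (forall x, bumpat a l x <= C / l) /\
  (forall x, `|(bumpat a l)^`()^`()%classic x| <= C / l ^+ 3).
Proof.
have [C C0 HC] := Cc_bounded (rho_Cc R).
have [C' C'0 HC'] := Cc_bounded (Cc_der (Cc_der (rho_Cc R))).
exists (C + C' + 1); first by lra.
move=> a l l0; have li : 0 <= l^-1 by rewrite invr_ge0 ltW.
split=> x.
  rewrite /bumpat mulrC ler_wpM2r//.
  by rewrite (le_trans (ler_norm _))// (le_trans (HC _))//; lra.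
rewrite bumpat_der2 !normrM (ger0_norm li).
have -> : (C + C' + 1) / l ^+ 3 = l^-1 * (l^-1 * (l^-1 * (C + C' + 1))) by field; rewrite gt_eqF.
by do 3 (rewrite ler_wpM2l//); rewrite (le_trans (HC' _))//; lra.
Qed.

Variables (b : R) (V D W : R -> R -> R) (HH : H2sol b V D W) (hb : 0 < b < 3).

Lemma hsrc_ge0 f g y : 0 <= hsrc b f g y.
Proof. by case/andP: hb => b0 b3; rewrite /hsrc addr_ge0// mulr_ge0 ?sqr_ge0//; lra. Qed.

Lemma flux_cont t : 0 <= t -> continuous (flux b (V t) (D t)).
Proof.
move=> t0 x; apply: cvgD; last exact: (G_cont (hsrc_integ b (H2_V HH t0) (H2_D HH t0))).
by apply: cvgM; [exact: cvg_cst|apply: continuousM; case: (H2_AC1 HH t0) => c _ _ _; exact: c].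
Qed.

(* The cutoff on the left is spread over a length [l], and costs only O(1 / l). *)
Lemma flux_left T : exists2 C, 0 <= C & forall t a l, 0 <= t <= T -> 1 <= l ->
  \int[mu]_x (flux b (V t) (D t) x * bumpat a l x) <= C / l.
Proof.
have [K K0 HK] := H2_bounded HH T; have [C C0 HC] := bump_bounds.
(* The local term, the source and the correction contribute K, 3 K and 6 K times C / l. *)
exists (C * K * 20); first by rewrite !mulr_ge0// ltW.
move=> t a l /[dup] tT /andP[t0 _] l1; have l0 : 0 < l by lra.
have li : 0 <= l^-1 by rewrite invr_ge0 ltW.
have [k1 k2] := HC a _ l0.
have [V1 D1 _] := HK _ tT.
have LV := H2_V HH t0; have LD := H2_D HH t0.
have cV : continuous (V t) by case: (H2_AC1 HH t0).
set h := hsrc b (V t) (D t).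
have Ih : integ setT h := hsrc_integ b LV LD.
have h0 y : 0 <= h y := hsrc_ge0 _ _ _.
have Jh : \int[mu]_y h y <= 3 * K.
  have I1 := integZ (b / 2) measurableT LV.2; have I2 := integZ ((3 - b) / 2) measurableT LD.2.
  rewrite /h /hsrc (Int_add measurableT I1 I2) (Int_scale _ measurableT LV.2) (Int_scale _ measurableT LD.2).
  by case/andP: hb => b0 b3; have := sqnorm_ge0 (V t); have := sqnorm_ge0 (D t); rewrite /sqnorm in V1 D1 *; nra.
have Jh' : \int[mu]_y `|h y| <= 3 * K by under eq_Rintegral do rewrite ger0_norm//.
have Ck := bumpat_Cc a l0; have k0 x := bumpat_ge0 a x l0.
set k := bumpat a l in k1 k2 Ck k0 *.
have Ck2 := Cc_der (Cc_der Ck).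
have cG := G_cont Ih.
have cV2 : continuous (fun x => 2^-1 * V t x ^+ 2).
  by move=> x; apply: cvgM; [exact: cvg_cst|apply: continuousM; exact: cV].
have Ia := integ_cont_Cc cV2 Ck; have Ib := integ_cont_Cc cG Ck; have Ic := integ_cont_Cc cG Ck2.
have Id : integ setT (fun x => h x * k x).
  apply: (integM (c := C / l)) => //; first exact: meas_cont (smooth_cont Ck.1).
  by move=> x _; rewrite ger0_norm.
have -> : \int[mu]_x (flux b (V t) (D t) x * k x) =
  \int[mu]_x (2^-1 * V t x ^+ 2 * k x) + \int[mu]_x (G h x * k x).
  by rewrite -(Int_add measurableT Ia Ib); apply: eq_Rintegral => x _; rewrite /flux mulrDl.
(* Writing k = (k - k'') + k'' trades [G h] against k for [h] against k, where the L^1 norm of [h]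
   helps, plus [G h] against k'', of size 1 / l^3 on a length 2 l. *)
have E : \int[mu]_x (G h x * k x) = \int[mu]_x (h x * k x) + \int[mu]_x (G h x * k^`()^`()%classic x).
  rewrite -(G_test Ih Ck); have := Int_sub measurableT Ib Ic.
  have -> : \int[mu]_x (G h x * k x - G h x * k^`()^`()%classic x) =
     \int[mu]_x (G h x * (k x - k^`()^`()%classic x)) by apply: eq_Rintegral => x _; rewrite mulrBr.
  by move=> ->; rewrite subrK.
rewrite E.
have B1 : \int[mu]_x (2^-1 * V t x ^+ 2 * k x) <= C / l * K.
  apply: (@le_trans _ _ (\int[mu]_x (C / l * V t x ^+ 2))); last first.
    by rewrite (Int_scale _ measurableT LV.2) ler_wpM2l// mulr_ge0// ltW.
  apply: (Int_le measurableT Ia (integZ _ measurableT LV.2)) => x _.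
  have := k1 x; have := k0 x; have := sqr_ge0 (V t x); move: (_ ^+ 2) (k x) (C / l) => p q r; nra.
have B2 : \int[mu]_x (h x * k x) <= C / l * (3 * K).
  apply: (@le_trans _ _ (\int[mu]_x (C / l * h x))).
    by apply: (Int_le measurableT Id (integZ _ measurableT Ih)) => x _; rewrite mulrC ler_wpM2r.
  by rewrite (Int_scale _ measurableT Ih) ler_wpM2l// mulr_ge0// ltW.
have B3 : \int[mu]_x (G h x * k^`()^`()%classic x) <= C / l ^+ 3 * (3 * K) * (2 * l).
  have supp x : ~ `[a - l, a + l]%classic x -> G h x * k^`()^`()%classic x = 0.
    move=> xJ; have lk : l < `|x - a|.
      rewrite ltNge; apply/negP; rewrite ler_distl => h1.
      by apply: xJ; rewrite /= in_itv.
    rewrite (_ : _^`()^`()%classic x = 0) ?mulr0//.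
    rewrite bumpat_der2 (Cc_der (Cc_der (rho_Cc R))).2 ?mulr0//.
    by rewrite normrM (ger0_norm li) ltr_pdivlMr ?mul1r.
  rewrite (Int_supp supp); apply: (le_trans (ler_norm _)).
  have -> : 2 * l = a + l - (a - l) by ring.
  apply: Int_itv_bound; first by rewrite lerD2l; exact: (ge0_cp (ltW l0)).2.
    by apply: measurable_funTS; exact: integ_meas Ic.
  move=> x _; rewrite normrM mulrC; apply: ler_pM => //.
  exact: le_trans (G_le x Ih) Jh'.
have l3 : C / l ^+ 3 * (3 * K) * (2 * l) <= C / l * (6 * K).
  have -> : C / l ^+ 3 * (3 * K) * (2 * l) = C / l * (6 * K) * l^-1 by field; rewrite gt_eqF.
  rewrite ler_piMr//; first by rewrite !mulr_ge0// ltW.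
  by rewrite invf_le1.
have -> : C * K * 20 / l = C / l * K * 20 by ring.
by apply: flux_sum B1 B2 B3 l3 _; rewrite !mulr_ge0// ltW.
Qed.

End maximum_principle.

Section algebra.
Variable R : realFieldType.
Implicit Types (p q y z : R).

Lemma window_alg1 (A m v p Q d C : R) : v <= Q -> A <= m -> m = v - d -> - p <= d ->
  p <= C * Q -> A <= (1 + C) * Q.
Proof. by move=> *; lra. Qed.

Lemma window_alg2 (A m M v d p q : R) : A <= v -> m <= M -> m = v - d -> d <= p -> p <= q ->
  A <= M + q.
Proof. by move=> *; lra. Qed.

End algebra.

(** * Mass in windows and the virial argument *)

Section windows.
Variable R : realType.
Local Notation mu := (@lebesgue_measure R).
Implicit Types (f g h v w k th : R -> R) (p q a c t s x y z r l : R).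

Lemma window_le f th p q r : continuous f -> (forall x, 0 <= f x) -> Cc th r ->
  (forall x, 0 <= th x) -> (forall x, p <= x <= q -> th x = 1) ->
  \int[mu]_(x in `[p, q]) f x <= \int[mu]_x (f x * th x).
Proof.
move=> cf f0 Cth th0 th1; have I := integ_cont_Cc cf Cth.
have mJ : measurable (`[p, q]%classic : set R) by exact: measurable_itv.
have -> : \int[mu]_(x in `[p, q]) f x = \int[mu]_(x in `[p, q]) (f x * th x).
  by apply: eq_Rintegral => x; rewrite inE/= in_itv/= => /th1 ->; rewrite mulr1.
apply: (Int_subset mJ measurableT) => // x _; exact: mulr_ge0.
Qed.

Lemma window_ge f th p q r : continuous f -> (forall x, 0 <= f x) -> Cc th r ->
  (forall x, 0 <= th x <= 1) -> (forall x, x < p -> th x = 0) -> (forall x, q < x -> th x = 0) ->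
  \int[mu]_x (f x * th x) <= \int[mu]_(x in `[p, q]) f x.
Proof.
move=> cf f0 Cth th01 thp thq; have I := integ_cont_Cc cf Cth.
have mJ : measurable (`[p, q]%classic : set R) by exact: measurable_itv.
have supp x : ~ `[p, q]%classic x -> f x * th x = 0.
  move=> xJ; have [xp|xp] := ltP x p; first by rewrite thp// mulr0.
  have [xq|xq] := ltP q x; first by rewrite thq// mulr0.
  by exfalso; apply: xJ; rewrite /= in_itv/= xp xq.
rewrite (Int_supp supp); apply: (Int_le mJ).
- exact: (@integS _ setT) I.
- exact: integ_itv_cont.
- by move=> x _; rewrite ler_piMr//; case/andP: (th01 x).
Qed.

Lemma window_sub f p q p' q' : continuous f -> (forall x, 0 <= f x) -> p' <= p -> q <= q' ->
  \int[mu]_(x in `[p, q]) f x <= \int[mu]_(x in `[p', q']) f x.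
Proof.
move=> cf f0 pp qq; apply: Int_subset => //; last exact: integ_itv_cont.
by move=> x /=; rewrite !in_itv/= => /andP[h1 h2]; apply/andP; split; lra.
Qed.

Lemma momentum_window : exists2 C, 0 < C & forall v g w l K,
  AC v g -> AC g w -> L2 w -> (forall x, 0 <= v x <= K) -> {ae mu, forall x, 0 <= v x - w x} -> 1 <= l ->
  \int[mu]_(x in `[- l, l]) (v x - w x) <= (1 + C) * \int[mu]_(x in `[- (3 * l), 3 * l]) v x /\
  (integ setT (fun x => v x - w x) ->
   \int[mu]_(x in `[- l, l]) v x <= \int[mu]_x (v x - w x) + 6 * C * K).
Proof.
have [C C0 Hcut] := wide_cut R; exists C => // v g w l K A1 A2 Lw vK pos l1.
have l0 : 0 < l by lra.
have [chi [Cchi chi01 _ d2 chi1]] := Hcut _ l0.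
have [I1 I2 E] := Cc_pair A1 A2 Cchi.
have cv : continuous v by case: A1.
have v0 x : 0 <= v x by case/andP: (vK x).
have chi0 x : 0 <= chi x by case/andP: (chi01 x).
have Cd := Cc_der (Cc_der Cchi).
have I3 := integ_cont_Cc cv Cd.
have E' : \int[mu]_x ((v x - w x) * chi x) = \int[mu]_x (v x * chi x) -
   \int[mu]_x (v x * chi^`()^`()%classic x).
  by rewrite E -(Int_sub measurableT I1 I3); apply: eq_Rintegral => x _; rewrite mulrBr.
have mJ c : measurable (`[- c, c]%classic : set R) by exact: measurable_itv.
have I4 : integ setT (fun x => (v x - w x) * chi x).
  by apply: eq_integ (integB measurableT I1 I2) => // x _; rewrite mulrBl.
have l2 : C / l ^+ 2 <= C.
  by rewrite ler_piMr ?(ltW C0)// invf_le1 ?exprn_gt0// exprn_ege1.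
have lr : - (3 * l) <= 3 * l by lra.
have B : `|\int[mu]_x (v x * chi^`()^`()%classic x)| <= C / l ^+ 2 * \int[mu]_(x in `[- (3 * l), 3 * l]) v x.
  have supp x : ~ `[- (3 * l), 3 * l]%classic x -> v x * chi^`()^`()%classic x = 0.
    by move=> /(Cc_supp Cd) ->; rewrite mulr0.
  have Iv : integ `[- (3 * l), 3 * l] v := integ_itv_cont _ _ cv.
  rewrite (Int_supp supp) -(Int_scale _ (mJ _) Iv); apply: (Int_abs_le (mJ _)).
  - by apply: measurable_funTS; exact: integ_meas I3.
  - exact: integZ.
  - by move=> x _; rewrite normrM (ger0_norm (v0 x)) mulrC ler_wpM2r.
have V3 : 0 <= \int[mu]_(x in `[- (3 * l), 3 * l]) v x by apply: Rintegral_ge0.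
move: B; rewrite ler_norml => /andP[B1 B2].
have le1 : \int[mu]_x (v x * chi x) <= \int[mu]_(x in `[- (3 * l), 3 * l]) v x.
by apply: (window_ge cv v0 Cchi chi01) => x xl; apply: Cchi.2; rewrite ltr_normr ?xl// ltrNr xl orbT.
split.
  have le2 : \int[mu]_(x in `[- l, l]) (v x - w x) <= \int[mu]_x ((v x - w x) * chi x).
    rewrite [leLHS]Rintegral_mkcond; apply: (Int_le_ae measurableT _ I4).
      apply/(integ_mk _ (mJ l)); apply: integB => //; first exact: integ_itv_cont.
      exact: L2_itv1.
    apply: ae_impl pos => x vw _; rewrite patchE; case: ifPn => [|_]; last exact: mulr_ge0.
    by rewrite inE/= in_itv/= -ler_norml => xl; rewrite chi1 ?mulr1.
  have : C / l ^+ 2 * \int[mu]_(x in `[- (3 * l), 3 * l]) v x <= C * \int[mu]_(x in `[- (3 * l), 3 * l]) v x.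
    by rewrite ler_wpM2r.
  exact: window_alg1 le1 le2 E' B1.
move=> I5.
have le3 : \int[mu]_(x in `[- l, l]) v x <= \int[mu]_x (v x * chi x).
  by apply: (window_le cv v0 Cchi chi0) => x; rewrite -ler_norml; exact: chi1.
have le4 : \int[mu]_x ((v x - w x) * chi x) <= \int[mu]_x (v x - w x).
  apply: (Int_le_ae measurableT I4 I5); apply: ae_impl pos => x vw _.
  by rewrite ler_piMr//; case/andP: (chi01 x).
have K0 : 0 <= K by case/andP: (vK 0) => h1 h2; exact: le_trans h1 h2.
have le5 : C / l ^+ 2 * \int[mu]_(x in `[- (3 * l), 3 * l]) v x <= 6 * C * K.
  have le6 : \int[mu]_(x in `[- (3 * l), 3 * l]) v x <= K * (6 * l).
    have -> : K * (6 * l) = \int[mu]_(x in `[- (3 * l), 3 * l]) K.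
      by rewrite (Int_cst_itv _ lr); congr (_ * _); ring.
    apply: (Int_le (mJ _)); [exact: integ_itv_cont|exact: integ_cst|].
    by move=> x _; case/andP: (vK x).
  apply: (@le_trans _ _ (C / l ^+ 2 * (K * (6 * l)))).
    by rewrite ler_wpM2l// divr_ge0 ?(ltW C0)// exprn_ge0// ltW.
  have -> : C / l ^+ 2 * (K * (6 * l)) = 6 * C * K * l^-1 by field; rewrite gt_eqF.
  by rewrite ler_piMr ?invf_le1// !mulr_ge0// ltW.
exact: window_alg2 le3 le4 E' B2 le5.
Qed.

End windows.

Lemma budget (R : realFieldType) (p q r z y m e : R) :
  p - q <= r - z -> q <= y -> y <= m -> 0 <= p -> r <= e -> z <= m + e.
Proof. by move=> *; lra. Qed.

Section virial.
Variable R : realType.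
Local Notation mu := (@lebesgue_measure R).
Implicit Types (f g h v w k th : R -> R) (p q a c t s x y z r l T : R).

Lemma increasing_cut a L c l : 0 < L -> 0 < l -> a + L <= c - l ->
  [/\ Cc (cut a L c l) (Num.max (L - a) (c + l)), forall x, 0 <= cut a L c l x <= 1,
   forall x, a + L <= x <= c - l -> cut a L c l x = 1,
   forall x, x < a - L -> cut a L c l x = 0 & forall x, c + l < x -> cut a L c l x = 0].
Proof.
move=> L0 l0 H; split.
- exact: cut_Cc.
- by move=> x; rewrite cut_ge0 ?cut_le1.
- by move=> x xJ; exact: cut_in.
- by move=> x xa; apply: cut_left => //; exact: ltW.
- by move=> x xa; apply: cut_right => //; exact: ltW.
Qed.

(** A left edge wide enough that the mass entering through it up to time T is at most e. *)
Lemma sqrt_slack (C T : R) : 0 <= C -> 0 <= T -> forall e, 0 < e -> exists2 L, 1 <= L & C / L * T <= e.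
Proof.
move=> C0 T0 e e0; exists (1 + C * T / e).
  by rewrite lerDl divr_ge0 ?mulr_ge0// ltW.
have L0 : 0 < 1 + C * T / e by rewrite ltr_pwDl// divr_ge0 ?mulr_ge0// ltW.
rewrite mulrAC ler_pdivrMr// mulrDr mulr1 mulrCA divff ?gt_eqF// mulr1.
by rewrite lerDr ltW.
Qed.

Variables (b : R) (V D W : R -> R -> R) (HH : H2sol b V D W) (hb : 0 < b < 3).

Lemma pair_continuous k r t : Cc k r -> 0 <= t -> forall e, 0 < e -> exists2 d, 0 < d &
  forall s, 0 <= s -> `|s - t| < d ->
  `|\int[mu]_x (V s x * k x) - \int[mu]_x (V t x * k x)| <= e.
Proof.
move=> Ck t0 e e0; have ck := smooth_cont Ck.1.
have Ik2 : integ setT (fun x => k x ^+ 2).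
  have ck2 : continuous (fun x => k x * k x) by move=> x; apply: cvgM; exact: ck.
  by apply: (@integ_cont_supp _ _ r); [exact: ck2|move=> x /Ck.2 ->; rewrite expr0n].
have mk := meas_cont ck.
pose B := \int[mu]_x k x ^+ 2; have B0 : 0 <= B by apply: Rintegral_ge0 => x _; exact: sqr_ge0.
have e'0 : 0 < e ^+ 2 / (B + 1) by rewrite divr_gt0 ?exprn_gt0// ltr_wpDl.
have [d d0 Hd] := H2_cont HH t0 e'0; exists d => // s s0 st; have [H1 _ _] := Hd _ s0 st.
have cV u : 0 <= u -> continuous (V u) by move=> u0; case: (H2_AC1 HH u0).
have Is := integ_cont_Cc (cV s s0) Ck; have It := integ_cont_Cc (cV t t0) Ck.
have LB := L2B (H2_V HH s0) (H2_V HH t0).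
rewrite -(Int_sub measurableT Is It).
have -> : \int[mu]_x (V s x * k x - V t x * k x) = \int[mu]_x ((V s x - V t x) * k x).
  by apply: eq_Rintegral => x _; rewrite mulrBl.
apply: sqr_le_le; first exact: ltW.
rewrite real_normK ?num_real//; apply: (le_trans (CauchySchwarz measurableT LB.1 mk LB.2 Ik2)).
have B1 : 0 < B + 1 by rewrite ltr_wpDl.
apply: (@le_trans _ _ (e ^+ 2 / (B + 1) * (B + 1))); last by rewrite divfK// gt_eqF.
apply: ler_pM => //; last by rewrite /B lerDl.
by apply: Rintegral_ge0 => x _; exact: sqr_ge0.
Qed.

Lemma pair_mvt k r s t : Cc k r -> 0 <= s -> s < t -> exists2 c, s < c < t &
  \int[mu]_x (V t x * k x) - \int[mu]_x (V s x * k x) =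
  \int[mu]_x (flux b (V c) (D c) x * k^`()%classic x) * (t - s).
Proof.
move=> Ck s0 st.
pose f u := \int[mu]_x (V (Num.max u 0) x * k x).
have fE u : 0 <= u -> f u = \int[mu]_x (V u x * k x) by move=> u0; rewrite /f max_l.
have maxB u z : `|Num.max u 0 - Num.max z 0| <= `|u - z|.
  by rewrite ler_norml; have [? ?] : (`|u - z| >= u - z /\ `|u - z| >= - (u - z));
    [split; [exact: ler_norm|by rewrite -normrN ler_norm]|case: (leP u 0); case: (leP z 0) => *; apply/andP; split; lra].
have cf : continuous f.
  move=> u; apply/cvgrPdist_le => e e0.
  have u0 : 0 <= Num.max u 0 by rewrite le_max lexx orbT.
  have [d d0 Hd] := pair_continuous Ck u0 e0.
  near=> z; rewrite distrC; apply: Hd; first by rewrite le_max lexx orbT.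
  by apply: (le_lt_trans (maxB _ _)); rewrite distrC; near: z; exact: cvgr_dist_lt.
have fd u : u \in `]s, t[ -> is_derive u 1 f (\int[mu]_x (flux b (V u) (D u) x * k^`()%classic x)).
  rewrite in_itv/= => /andP[su _].
  have u0 : 0 < u by exact: le_lt_trans su.
  apply: is_derive_near (H2_eq HH Ck u0); exists u => //= z /= uz.
  by symmetry; apply: fE; move: uz; rewrite ltr_norml => /andP[_ h]; lra.
have cw : {within `[s, t], continuous f} by apply: continuous_subspaceT => z; exact: cf.
have [c + E] := MVT st fd cw; rewrite in_itv/= => cst; exists c => //.
by rewrite -!fE//; exact: le_trans s0 (ltW st).
Unshelve. all: by end_near.
Qed.

Hypothesis V0 : forall t, 0 <= t -> forall x, 0 <= V t x.

(** The slope of the cutoff is a bump at [a] minus a bump at [c]: inflow on the left at most C / L,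
    outflow on the right at least its local part since G of the source is nonnegative. Here and
    below [zero_mean_ker] is a real number, a lower bound for that outflow. *)
Lemma flux_cut T C a L c l zero_mean_ker t : 0 < L -> 0 < l -> 0 <= t <= T ->
  (forall t a l, 0 <= t <= T -> 1 <= l ->
    \int[mu]_x (flux b (V t) (D t) x * bumpat a l x) <= C / l) -> 1 <= L ->
  zero_mean_ker <= \int[mu]_x (2^-1 * V t x ^+ 2 * bumpat c l x) ->
  \int[mu]_x (flux b (V t) (D t) x * (cut a L c l)^`()%classic x) <= C / L - zero_mean_ker.
Proof.
move=> L0 l0 /[dup] tT /andP[t0 _] HC L1 Hk.
have cF := flux_cont HH t0.
have I1 := integ_cont_Cc cF (bumpat_Cc a L0); have I2 := integ_cont_Cc cF (bumpat_Cc c l0).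
have -> : \int[mu]_x (flux b (V t) (D t) x * (cut a L c l)^`()%classic x) =
  \int[mu]_x (flux b (V t) (D t) x * bumpat a L x) - \int[mu]_x (flux b (V t) (D t) x * bumpat c l x).
  rewrite -(Int_sub measurableT I1 I2); apply: eq_Rintegral => x _.
  by rewrite (der_val (cutD _ _ _ _ _)) /dcut mulrBr.
apply: lerB; first exact: HC.
apply: (le_trans Hk); apply: (Int_le measurableT _ I2).
  apply: (integ_cont_Cc _ (bumpat_Cc c l0)) => x.
  by apply: cvgM; [exact: cvg_cst|apply: continuousM; case: (H2_AC1 HH t0) => q _ _ _; exact: q].
move=> x _; rewrite ler_wpM2r ?bumpat_ge0//.
by rewrite /flux lerDl G_ge0// => y; exact: hsrc_ge0.
Qed.

Lemma virial_step T C a L c l zero_mean_ker s t :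
  (forall t a l, 0 <= t <= T -> 1 <= l ->
    \int[mu]_x (flux b (V t) (D t) x * bumpat a l x) <= C / l) ->
  1 <= L -> 0 < l -> a + L <= c - l -> 0 <= s -> s <= t -> t <= T ->
  (forall u, s < u < t -> zero_mean_ker <= \int[mu]_x (2^-1 * V u x ^+ 2 * bumpat c l x)) ->
  \int[mu]_x (V t x * cut a L c l x) - \int[mu]_x (V s x * cut a L c l x) <=
  (C / L - zero_mean_ker) * (t - s).
Proof.
move=> HC L1 l0 H s0; rewrite le_eqVlt => /orP[/eqP <-|st] tT Hk.
  by rewrite !subrr mulr0.
have L0 : 0 < L by lra.
have [u /andP[su ut] ->] := pair_mvt (cut_Cc L0 l0 H) s0 st.
rewrite ler_pM2r ?subr_gt0//; apply: (flux_cut (T := T)) => //.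
  by rewrite (le_trans s0 (ltW su)) (le_trans (ltW ut)).
by apply: Hk; rewrite su.
Qed.

(** The outflow on the right is bounded below by 0, so only the inflow through the wide left edge
    remains. *)
Lemma virial_mono T C a L c l s t : 0 <= C ->
  (forall t a l, 0 <= t <= T -> 1 <= l ->
    \int[mu]_x (flux b (V t) (D t) x * bumpat a l x) <= C / l) ->
  1 <= L -> 0 < l -> a + L <= c - l -> 0 <= s -> s <= t -> t <= T ->
  \int[mu]_x (V t x * cut a L c l x) <= \int[mu]_x (V s x * cut a L c l x) + C / L * T.
Proof.
move=> C0 HC L1 l0 H s0 st tT; have L0 : 0 < L by lra.
have := @virial_step T C a L c l 0 s t HC L1 l0 H s0 st tT.
rewrite subr0 => Q; rewrite -lerBlDl; apply: (le_trans (Q _)).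
  move=> u /andP[su _]; apply: Rintegral_ge0 => x _.
  by rewrite mulr_ge0 ?bumpat_ge0// mulr_ge0 ?sqr_ge0.
by rewrite ler_wpM2l ?divr_ge0 ?(ltW L0)//; lra.
Qed.

(* Mass only moves to the right, so at all times before [T] the window [-2 la, 2 la] holds at least
   the mass of [-la, la] at time [T] minus [de]; it then leaks to the right at a rate bounded below,
   which the total mass [M] cannot sustain for long. *)
Lemma window_mass_bound : exists2 c0, 0 < c0 & forall T la de M, 0 < T -> 0 < la ->
  (forall a, 0 <= a -> \int[mu]_(x in `[- a, - la]) V 0 x <= de) ->
  (forall p q, \int[mu]_(x in `[p, q]) V 0 x <= M) ->
  de < \int[mu]_(x in `[- la, la]) V T x ->
  c0 * (\int[mu]_(x in `[- la, la]) V T x - de) ^+ 2 * T <= la ^+ 2 * M.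
Proof.
have [c0 c00 Hrho] := rho_lower R.
exists (c0 / 32); first by rewrite divr_gt0.
move=> T la de M T0 la0 Hde HM.
set al := \int[mu]_(x in _) V T x => del.
have T0' := ltW T0.
have [C C0 HC] := flux_left HH hb T.
have cV u : 0 <= u -> continuous (V u) by move=> u0; case: (H2_AC1 HH u0).
have la2 : 0 < la / 2 by rewrite divr_gt0.
(* The right edge descends from 1 at -2 la to 0 at -la, hence the centre -3/2 la and half-width la /
   2; the mass it retains is compared with that at time 0. *)
have left_tail u a : 0 <= u <= T -> 0 <= a -> \int[mu]_(x in `[- a, - (2 * la)]) V u x <= de.
  move=> /andP[u0 uT] a0; apply/ler_addgt0Pr => e e0.
  have [L L1 HL] := sqrt_slack C0 T0' e0; have L0 : 0 < L by lra.
  pose a' := - a - L - 2 * la.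
  have H : a' + L <= - (3 / 2 * la) - la / 2 by rewrite /a'; lra.
  have [Cth th01 th1 thl thr] := increasing_cut L0 la2 H.
  have th0 x : 0 <= cut a' L (- (3 / 2 * la)) (la / 2) x by case/andP: (th01 x).
  have S := virial_mono C0 HC L1 la2 H (lexx 0) u0 uT.
  have W1 : \int[mu]_(x in `[- a, - (2 * la)]) V u x <= \int[mu]_x (V u x * cut a' L (- (3 / 2 * la)) (la / 2) x).
    by apply: (window_le (cV _ u0) (V0 u0) Cth th0) => x /andP[x1 x2]; apply: th1; rewrite /a'; apply/andP; split; lra.
  have W2 : \int[mu]_x (V 0 x * cut a' L (- (3 / 2 * la)) (la / 2) x) <= \int[mu]_(x in `[- (a - - L * 2 + 2 * la), - la]) V 0 x.
    apply: (window_ge (cV _ (lexx 0)) (V0 (lexx 0)) Cth th01) => x xa.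
      by apply: thl; rewrite /a'; lra.
    by apply: thr; lra.
  apply: (le_trans W1); apply: (le_trans S); apply: lerD HL; apply: (le_trans W2).
  by apply: Hde; lra.
(* Backwards in time: up to e, the mass of [-la, la] at time T lay at time u to the left of 2 la,
   and at most [de] of it to the left of -2 la. *)
have window u : 0 <= u <= T -> al - de <= \int[mu]_(x in `[- (2 * la), 2 * la]) V u x.
  move=> /[dup] uT /andP[u0 u1]; apply/ler_addgt0Pr => e e0.
  have [L1' L11' HL'] := sqrt_slack C0 T0' e0.
  (* Adding [la] ensures la + 2 L >= 2 la, so that the left part of the support splits off as a
     tail. *)
  pose L := L1' + la; have L1 : 1 <= L by rewrite /L; lra.
  have L0 : 0 < L by lra.
  have HL : C / L * T <= e.
    apply: le_trans HL'; rewrite ler_wpM2r// ler_wpM2l// lef_pV2 ?posrE//; last by lra.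
    by rewrite /L lerDl ltW.
  pose a' := - la - L.
  have H : a' + L <= 3 / 2 * la - la / 2 by rewrite /a'; lra.
  have [Cth th01 th1 thl thr] := increasing_cut L0 la2 H.
  have th0 x : 0 <= cut a' L (3 / 2 * la) (la / 2) x by case/andP: (th01 x).
  have S := virial_mono C0 HC L1 la2 H u0 u1 (lexx T).
  have W1 : al <= \int[mu]_x (V T x * cut a' L (3 / 2 * la) (la / 2) x).
    by apply: (window_le (cV _ T0') (V0 T0') Cth th0) => x /andP[x1 x2]; apply: th1; rewrite /a'; apply/andP; split; lra.
  have W2 : \int[mu]_x (V u x * cut a' L (3 / 2 * la) (la / 2) x) <= \int[mu]_(x in `[- (la + 2 * L), 2 * la]) V u x.
    apply: (window_ge (cV _ u0) (V0 u0) Cth th01) => x xa.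
      by apply: thl; rewrite /a'; lra.
    by apply: thr; lra.
  have g1 : - (la + 2 * L) <= - (2 * la) by rewrite /L; lra.
  have g2 : - (2 * la) <= 2 * la by lra.
  have g3 : 0 <= la + 2 * L by lra.
  have E := Int_cat g1 g2 (integ_itv_cont _ _ (cV _ u0)).
  have Lt := left_tail u (la + 2 * L) uT g3.
  rewrite lerBlDr; apply: (le_trans W1); apply: (le_trans S).
  rewrite addrAC; apply: lerD HL; apply: (le_trans W2); rewrite E [leRHS]addrC lerD2r.
  exact: Lt.
(* A factor c0 / (8 la) from the bump and (al - de)^2 / (4 la) from Cauchy-Schwarz. *)
pose zero_mean_ker := c0 * (al - de) ^+ 2 / (32 * la ^+ 2).
have la4 : 0 < 4 * la by lra.
have rate u : 0 <= u <= T -> zero_mean_ker <= \int[mu]_x (2^-1 * V u x ^+ 2 * bumpat 0 (4 * la) x).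
  move=> /[dup] uT /andP[u0 u1]; have LV := H2_V HH u0.
  have g2 : - (2 * la) <= 2 * la by lra.
  have mJ : measurable (`[- (2 * la), 2 * la]%classic : set R) by exact: measurable_itv.
  have IV2 := L2_itv (- (2 * la)) (2 * la) LV.
  have CS : (al - de) ^+ 2 <= 4 * la * \int[mu]_(x in `[- (2 * la), 2 * la]) V u x ^+ 2.
    have wu := window u uT.
    apply: (@le_trans _ _ ((\int[mu]_(x in `[- (2 * la), 2 * la]) V u x) ^+ 2)).
      by rewrite lerXn2r ?nnegrE//; [rewrite subr_ge0 ltW|apply: Rintegral_ge0 => x _; exact: V0].
    apply: CauchySchwarz1 => //; first exact: integ_cst.
      by apply: measurable_funTS; exact: LV.1.
    by rewrite (Int_cst_itv _ g2); lra.
  apply: (@le_trans _ _ (c0 / (8 * la) * \int[mu]_(x in `[- (2 * la), 2 * la]) V u x ^+ 2)).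
    have -> : zero_mean_ker = c0 / (32 * la ^+ 2) * (al - de) ^+ 2 by rewrite /zero_mean_ker; ring.
    have -> : c0 / (8 * la) * \int[mu]_(x in `[- (2 * la), 2 * la]) V u x ^+ 2 =
       c0 / (32 * la ^+ 2) * (4 * la * \int[mu]_(x in `[- (2 * la), 2 * la]) V u x ^+ 2).
      by field; rewrite gt_eqF.
    by rewrite ler_wpM2l// divr_ge0 ?(ltW c00)// mulr_ge0// exprn_ge0// ltW.
  rewrite -(Int_scale _ mJ IV2).
  have cV2 : continuous (fun x => 2^-1 * V u x ^+ 2).
    by move=> x; apply: cvgM; [exact: cvg_cst|apply: continuousM; exact: cV].
  have I := integ_cont_Cc cV2 (bumpat_Cc 0 la4).
  apply: (@le_trans _ _ (\int[mu]_(x in `[- (2 * la), 2 * la]) (2^-1 * V u x ^+ 2 * bumpat 0 (4 * la) x))).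
    apply: (Int_le mJ); [exact: integZ|exact: (@integS _ setT) I|].
    move=> x; rewrite /= in_itv/= => xJ.
    (* The bump has half-width 4 la, so the window [-2 la, 2 la] is the half of its support where
       [rho] is at least c0. *)
    have rx : c0 <= rho (x / (4 * la)).
      apply: Hrho; rewrite normrM (ger0_norm (x := _^-1)) ?invr_ge0 ?(ltW la4)//.
      by rewrite ler_pdivrMr// ler_norml; move: xJ => /andP[x1 x2]; apply/andP; split; lra.
    rewrite /bumpat subr0.
    have -> : c0 / (8 * la) * V u x ^+ 2 = 2^-1 * V u x ^+ 2 * ((4 * la)^-1 * c0) by field; rewrite gt_eqF.
    apply: ler_wpM2l; first by rewrite mulr_ge0 ?sqr_ge0.
    by apply: ler_wpM2l => //; rewrite invr_ge0 ltW.
  apply: (Int_subset mJ measurableT) => // x _.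
  by rewrite mulr_ge0 ?bumpat_ge0// mulr_ge0 ?sqr_ge0.
suff K : zero_mean_ker * T <= M.
  have la20 : 0 < la ^+ 2 by rewrite exprn_gt0.
  have -> : c0 / 32 * (al - de) ^+ 2 * T = la ^+ 2 * (zero_mean_ker * T) by rewrite /zero_mean_ker; field; rewrite gt_eqF.
  by rewrite ler_pM2l.
apply/ler_addgt0Pr => e e0.
have [L L1 HL] := sqrt_slack C0 T0' e0; have L0 : 0 < L by lra.
(* The right edge descends over [-4 la, 4 la], so its slope is the bump in [rate]. The mass under
   the cutoff starts at most at M and ends nonnegative, which bounds the total outflow by M + e. *)
pose a' := - (4 * la) - L.
have H : a' + L <= 0 - 4 * la by rewrite /a'; lra.
have [Cth th01 th1 thl thr] := increasing_cut L0 la4 H.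
have th0 x : 0 <= cut a' L 0 (4 * la) x by case/andP: (th01 x).
have rate' u : 0 < u < T -> zero_mean_ker <= \int[mu]_x (2^-1 * V u x ^+ 2 * bumpat 0 (4 * la) x).
  by move=> /andP[u0 u1]; apply: rate; rewrite !ltW.
have S := virial_step HC L1 la4 H (lexx 0) T0' (lexx T) rate'.
have W2 : \int[mu]_x (V 0 x * cut a' L 0 (4 * la) x) <= \int[mu]_(x in `[a' - L, 0 + 4 * la]) V 0 x.
  exact: (window_ge (cV _ (lexx 0)) (V0 (lexx 0)) Cth th01).
have W3 := HM (a' - L) (0 + 4 * la).
have W1 : 0 <= \int[mu]_x (V T x * cut a' L 0 (4 * la) x).
  by apply: Rintegral_ge0 => x _; rewrite mulr_ge0// V0.
move: S; rewrite subr0 mulrBl => S.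
exact: budget S W2 W3 W1 HL.
Qed.

End virial.

(** * Decay in the growing window *)

Section decay.
Variable R : realType.
Local Notation mu := (@lebesgue_measure R).
Implicit Types (f g h v w k th : R -> R) (p q a c t s x y z r l T e : R).

Lemma cvg0_pinfty (f : R -> \bar R) :
  (forall e, 0 < e -> exists T, forall t, T < t -> exists2 r, 0 <= r <= e & f t = r%:E) ->
  f t @[t --> +oo] --> 0%:E.
Proof.
move=> H; apply/fine_cvgP; split.
  have [T HT] := H 1 ltr01; exists T; split; first exact: num_real.
  by move=> t /= /HT[r _ ->].
apply/cvgrPdist_le => e e0; have [T HT] := H e e0; exists T; split; first exact: num_real.
by move=> t /= /HT[r /andP[r0 re] ->]; rewrite /= sub0r normrN ger0_norm.
Qed.

Lemma ln_pinfty B : exists2 T, 0 < T & forall t, T < t -> B <= ln t.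
Proof.
exists (expR B); first exact: expR_gt0.
move=> t Bt; have t0 : 0 < t := lt_trans (expR_gt0 B) Bt.
by rewrite -[B]expRK ler_ln ?posrE ?expR_gt0// ltW.
Qed.

(** With y = t^(1/4) one has ln t = 4 ln y <= 4 y, so the quotient is at least y / 4. *)
Lemma window_pinfty B : exists2 T, 1 < T & forall t, T < t -> B <= Num.sqrt t / ln t.
Proof.
pose M := Num.max (4 * B) 2.
have M2 : 2 <= M by rewrite /M le_max lexx orbT.
have MB : 4 * B <= M by rewrite /M le_max lexx.
have M0 : 0 <= M by lra.
exists (M ^+ 4); first by rewrite exprn_egt1//; lra.
move=> t Mt; have t1 : 1 < t by apply: lt_trans Mt; rewrite exprn_egt1//; lra.
have t0 : 0 <= t by lra.
pose y := Num.sqrt (Num.sqrt t).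
have y2 : y ^+ 2 = Num.sqrt t by rewrite sqr_sqrtr// sqrtr_ge0.
have y4 : y ^+ 4 = t by rewrite (exprM y 2 2) y2 sqr_sqrtr.
have y0 : 0 <= y := sqrtr_ge0 _.
have My : M <= y.
  rewrite leNgt; apply/negP => yM; have : y ^+ 4 <= M ^+ 4 by rewrite lerXn2r ?nnegrE// ltW.
  by rewrite y4 leNgt Mt.
have yp : 0 < y by lra.
have lt0 : 0 < ln t by rewrite ln_gt0.
have lny : ln t <= 4 * y.
  rewrite -y4 lnXn// -[X in X <= _]mulr_natl ler_pM2l//.
  have := expR_ge1Dx (ln y); rewrite lnK ?posrE//; lra.
rewrite ler_pdivlMr// -y2.
have [B0|B0] := leP B 0.
  by apply: (@le_trans _ _ 0); [rewrite mulr_le0_ge0 ?(ltW lt0)|exact: sqr_ge0].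
apply: (@le_trans _ _ (B * (4 * y))); first by rewrite ler_pM2l.
by rewrite expr2 mulrA ler_pM2r// mulrC; lra.
Qed.

(** The masses of [-a, 0] are bounded by M; once one of them is within e of their supremum, what
    lies further left is at most e. *)
Lemma left_tails f M : continuous f -> (forall x, 0 <= f x) ->
  (forall p q, \int[mu]_(x in `[p, q]) f x <= M) ->
  forall e, 0 < e -> exists l0, forall l, l0 <= l -> 0 <= l -> forall a, 0 <= a ->
  \int[mu]_(x in `[- a, - l]) f x <= e.
Proof.
move=> cf f0 HM e e0.
pose S := [set \int[mu]_(x in `[- a, 0]) f x | a in [set a | 0 <= a]].
have hS : has_sup S.
  split; first by exists (\int[mu]_(x in `[- 0, 0]) f x); exists 0 => //=.
  by exists M => _ [a _ <-].
have [_ [L /= L0 <-] HL] := sup_adherent e0 hS.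
exists L => l Ll l0 a a0; pose a' := Num.max a l.
have aa : a <= a' by rewrite le_max lexx.
have la : l <= a' by rewrite le_max lexx orbT.
have g1 : - a' <= - L by lra.
have g2 : - L <= 0 by lra.
have E := Int_cat g1 g2 (integ_itv_cont _ _ cf).
have h1 : \int[mu]_(x in `[- a, - l]) f x <= \int[mu]_(x in `[- a', - L]) f x.
  by apply: window_sub => //; lra.
have h2 : \int[mu]_(x in `[- a', 0]) f x <= sup S.
  by apply: sup_upper_bound => //; exists a' => //=; exact: le_trans a0 aa.
lra.
Qed.

Section solution.
Variables (b : R) (V D W : R -> R -> R) (HH : H2sol b V D W) (hb : 0 < b < 3).
Hypothesis pos0 : {ae mu, forall x, 0 <= V 0 x - W 0 x}.
Hypothesis int0 : integ setT (fun x => V 0 x - W 0 x).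

Lemma velocity_ge0 t : 0 <= t -> forall x, 0 <= V t x.
Proof.
move=> t0; exact: (potential_ge0 (H2_AC1 HH t0) (H2_AC2 HH t0) (H2_V HH t0) (H2_D HH t0)
  (momentum_ge0 HH pos0 t0)).
Qed.

Lemma initial_mass : exists M, forall p q, \int[mu]_(x in `[p, q]) V 0 x <= M.
Proof.
have [K K0 HK] := H2_bounded HH 1.
have UB := uniform_bound HH K0 HK.
have [C C0 HC] := momentum_window R.
have t01 : (0 : R) <= (0 : R) <= (1 : R) by rewrite lexx ler01.
have v0 := velocity_ge0 (lexx 0).
have vK x : 0 <= V 0 x <= K + 1.
  by rewrite v0 /=; case: (UB _ t01 x) => h _; exact: le_trans (ler_norm _) h.
exists (\int[mu]_x (V 0 x - W 0 x) + 6 * C * (K + 1)) => p q.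
pose l := 1 + `|p| + `|q|; have l1 : 1 <= l by rewrite /l -addrA lerDl addr_ge0.
have [_ H] := HC _ _ _ _ _ (H2_AC1 HH (lexx 0)) (H2_AC2 HH (lexx 0)) (H2_W HH (lexx 0)) vK pos0 l1.
apply: le_trans (H int0); apply: window_sub => //; first by case: (H2_AC1 HH (lexx 0)).
  by have := ler_norm (- p); rewrite normrN /l; have := normr_ge0 q; lra.
by have := ler_norm q; rewrite /l; have := normr_ge0 p; lra.
Qed.

(** The dilation [c] is 1 for the velocity and 3 for the momentum, which is controlled by the
    velocity on a tripled window. *)
Lemma window_decay c : 0 < c -> forall e, 0 < e -> exists T, 1 < T /\ forall t, T < t ->
  1 <= Num.sqrt t / ln t /\
  \int[mu]_(x in `[- (c * (Num.sqrt t / ln t)), c * (Num.sqrt t / ln t)]) V t x <= e.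
Proof.
move=> c_gt0 e e0; have [M HM] := initial_mass.
have cV0 : continuous (V 0) by case: (H2_AC1 HH (lexx 0)).
have v0 := velocity_ge0.
have [c0 c00 Hesc] := window_mass_bound HH hb v0.
have e2 : 0 < e / 2 by lra.
have [l0 Hl0] := left_tails cV0 (v0 _ (lexx 0)) HM e2.
have M0 : 0 <= M by apply: le_trans (HM 0 0); apply: Rintegral_ge0 => x _; exact: v0.
(* If the window held more than e, [window_mass_bound] with de = e / 2 would bound (ln t)^2 by B -
   1; as B >= 1, ln t >= B gives (ln t)^2 >= B. *)
pose B := c ^+ 2 * M / (c0 * (e / 2) ^+ 2) + 1.
have ce : 0 < c0 * (e / 2) ^+ 2 by rewrite mulr_gt0// exprn_gt0.
have B1 : 1 <= B by rewrite lerDr divr_ge0 ?(ltW ce)// mulr_ge0// exprn_ge0// ltW.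
have [T1 T10 H1] := ln_pinfty B.
have [T2 T21 H2] := window_pinfty (Num.max 1 (l0 / c)).
exists (Num.max T1 T2); split; first by rewrite lt_max T21 orbT.
move=> t; rewrite gt_max => /andP[/H1 Bt /[dup] T2t /H2]; rewrite ge_max => /andP[h1 h2].
have t1 : 1 < t := lt_trans T21 T2t; have t0 : 0 < t by lra.
split => //; set la := Num.sqrt t / ln t in h1 h2 *.
rewrite leNgt; apply/negP => He.
have la0 : 0 < c * la by rewrite mulr_gt0//; lra.
have l0la : l0 <= c * la by rewrite mulrC -ler_pdivrMr.
have tails := Hl0 _ l0la (ltW la0).
have := Hesc t (c * la) (e / 2) M t0 la0 tails HM.
set al := \int[mu]_(x in _) V t x in He *.
have h3 : e / 2 < al by lra.
move=> /(_ h3); rewrite exprMn.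
have lt0 : 0 < ln t by rewrite ln_gt0.
have laE : la ^+ 2 = t / ln t ^+ 2 by rewrite /la expr_div_n sqr_sqrtr// ltW.
rewrite laE => h4.
have h5 : (e / 2) ^+ 2 <= (al - e / 2) ^+ 2 by rewrite lerXn2r ?nnegrE//; lra.
have h6 : c0 * (e / 2) ^+ 2 * t <= c ^+ 2 * (t / ln t ^+ 2) * M.
  by apply: le_trans h4; rewrite ler_pM2r// ler_pM2l.
have h7 : c0 * (e / 2) ^+ 2 * ln t ^+ 2 <= c ^+ 2 * M.
  have -> : c0 * (e / 2) ^+ 2 * ln t ^+ 2 = c0 * (e / 2) ^+ 2 * t * (ln t ^+ 2 / t) by field; rewrite gt_eqF.
  have -> : c ^+ 2 * M = c ^+ 2 * (t / ln t ^+ 2) * M * (ln t ^+ 2 / t) by field; rewrite !gt_eqF.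
  by rewrite ler_pM2r// divr_gt0// exprn_gt0.
have h8 : B <= ln t ^+ 2.
  by apply: (le_trans Bt); rewrite expr2 ler_pMr//; exact: le_trans B1 Bt.
have h9 : c ^+ 2 * M < c0 * (e / 2) ^+ 2 * B.
  by rewrite /B mulrDr mulr1 mulrCA divff ?gt_eqF// mulr1 ltrDl.
have h10 : c0 * (e / 2) ^+ 2 * B <= c0 * (e / 2) ^+ 2 * ln t ^+ 2 by rewrite ler_pM2l.
by have := lt_le_trans h9 (le_trans h10 h7); rewrite ltxx.
Qed.

End solution.
End decay.

Theorem theorem1p4 (R : realType) (b : R) (u : R -> R -> R)
  (hb : 0 < b < 3)
  (hu : global_solution b u)
  (hm0 : {ae @lebesgue_measure R, forall x, 0 <= momentum (u 0) x})
  (hm0L1 : momentum (u 0) \in Lfun (@lebesgue_measure R) 1%:E) :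
  exists L : R,
    L1norm_on (Lambda_half t) (momentum (u t)) @[t --> +oo] --> L%:E /\
    L1norm_on (Lambda_half t) (u t) @[t --> +oo] --> L%:E.
Proof.
have [[[V D] W] /= [HH Hu]] := global_H2sol hu.
have [mu0 _ mm0 em0] := Hu 0 (lexx 0).
have pos0 : {ae @lebesgue_measure R, forall x, 0 <= V 0 x - W 0 x}.
  by apply: ae_impl (ae_and hm0 em0) => x [+ <-].
have int0 : integ setT (fun x => V 0 x - W 0 x).
  have I0 : integ setT (momentum (u 0)) by apply/Lfun1_integrable.
  apply: integ_ae I0 => //; first exact: (mom_L2 HH (lexx 0)).1.
  by apply: ae_impl em0.
have v0 := velocity_ge0 HH pos0.
have pos := momentum_ge0 HH pos0.
have cV t : 0 <= t -> continuous (V t) by move=> t0; case: (H2_AC1 HH t0).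
pose la t : R := Num.sqrt t / ln t.
have LamE t : 0 <= t -> Lambda_half t = `](- la t), (la t)[%classic.
  by move=> t0; rewrite /Lambda_half powR12_sqrt.
have mL t : measurable (`](- la t), (la t)[%classic : set R) by exact: measurable_itv.
have sub t : `](- la t), (la t)[%classic `<=` (`[- la t, la t]%classic : set R).
  by move=> x /=; rewrite !in_itv/= => /andP[h1 h2]; rewrite !ltW.
have mC t : measurable (`[- la t, la t]%classic : set R) by exact: measurable_itv.
(* Passes from the norm on the open window to the integral of a nonnegative representative on the
   closed one, where the estimates are stated. *)
have norm_val t f g : 0 <= t -> measurable_fun setT f -> integ `[- la t, la t] g ->
    {ae @lebesgue_measure R, forall x, f x = g x} -> {ae @lebesgue_measure R, forall x, 0 <= g x} ->
    exists2 r, 0 <= r <= \int[@lebesgue_measure R]_(x in `[- la t, la t]) g x &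
    L1norm_on (Lambda_half t) f = r%:E.
  move=> t0 mf Ig efg pg.
  have Ig' : integ `](- la t), (la t)[ g := integS (mC t) (mL t) (@sub t) Ig.
  have If : integ `](- la t), (la t)[ f.
    by apply: integ_ae Ig' => //; [exact: measurable_funTS|apply: ae_impl efg].
  have Ia := integ_abs If.
  exists (\int[@lebesgue_measure R]_(x in `](- la t), (la t)[) `|f x|); last first.
    by rewrite /L1norm_on LamE// EFin_Int.
  apply/andP; split; first exact: Rintegral_ge0.
  apply: (@le_trans _ _ (\int[@lebesgue_measure R]_(x in `](- la t), (la t)[) `|g x|)).
    apply: (Int_le_ae (mL t) Ia (integ_abs Ig')).
    by apply: ae_impl efg => x -> _.
  apply: (@le_trans _ _ (\int[@lebesgue_measure R]_(x in `[- la t, la t]) `|g x|)).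
    by apply: Int_subset => //; exact: integ_abs.
  apply: (Int_le_ae (mC t) (integ_abs Ig) Ig).
  by apply: ae_impl pg => x ? _; rewrite ger0_norm.
have [C C0 HC] := momentum_window R.
exists 0; split; apply: cvg0_pinfty => e e0.
(* The comparison between momentum and velocity loses the factor 1 + C. *)
- have e' : 0 < e / (1 + C) by rewrite divr_gt0//; lra.
  have [T [T1 HT]] := window_decay HH hb pos0 int0 (ltr0n R 3) e'.
  exists T => t Tt; have [l1 Hd] := HT _ Tt.
  have t0 : 0 <= t by lra.
  have [_ _ mm em] := Hu t t0.
  have LM := mom_L2 HH t0.
  have [r /andP[r0 r1] E] := norm_val t _ _ t0 mm (L2_itv1 _ _ LM) em (pos t t0).
  exists r => //; rewrite r0/=; apply: (le_trans r1).
  have [K K0 HK] := H2_bounded HH t.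
  have tt : 0 <= t <= t by rewrite t0 lexx.
  have vK x : 0 <= V t x <= K + 1.
    by rewrite v0//=; case: (uniform_bound HH K0 HK tt x) => h _; exact: le_trans (ler_norm _) h.
  have [H _] := HC _ _ _ _ _ (H2_AC1 HH t0) (H2_AC2 HH t0) (H2_W HH t0) vK (pos t t0) l1.
  apply: (le_trans H); have -> : e = (1 + C) * (e / (1 + C)) by field; rewrite gt_eqF//; lra.
  by rewrite ler_pM2l//; lra.
- have [T [T1 HT]] := window_decay HH hb pos0 int0 ltr01 e0.
  exists T => t Tt; have [l1 Hd] := HT _ Tt.
  have t0 : 0 <= t by lra.
  have [mut eu _ _] := Hu t t0.
  have pv : {ae @lebesgue_measure R, forall x, 0 <= V t x}.
    by apply: ae_impl (pos t t0) => x _; exact: v0.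
  have [r /andP[r0 r1] E] := norm_val t _ _ t0 mut (integ_itv_cont _ _ (cV t t0)) eu pv.
  exists r => //; rewrite r0/=; apply: (le_trans r1).
  by move: Hd; rewrite !mul1r.
Qed.
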